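(* Let $n\ge 1$ and let $(U_t)_{t>0}$ be a family of operators, acting boundedly and uniformly in $t$ on $L^2(\mathbb{R}^n)$, given by $U_tf(x)=\int_{\mathbb{R}^n} U_t(x,y)f(y)\,dy$, where for each $t>0$ the kernel $U_t(x,y)$ is complex-valued, is supported in $\{|x-y|\le t\}$, and satisfies $$|U_t(x,y)|\le t^{-n}\quad\text{and}\quad |\nabla_y U_t(x,y)|\le t^{-n-1}.$$ Assume that there is a constant $C<\infty$ such that for each cube $Q\subset\mathbb{R}^n$ there is a function $b_Q:3Q\to\mathbb{C}$ with $$\int_{3Q}|b_Q|^2\le C|Q|,\qquad \left|\int_Q b_Q\right|\ge |Q|,\qquad \int_Q\int_0^{\ell(Q)}|(U_tb_Q)(x)|^2\,\frac{dx\,dt}{t}\le C|Q|,$$ where $C$ is independent of $Q$. Then $|(U_t1)(x)|^2\,\frac{dx\,dt}{t}$ is a Carleson measure on $\mathbb{R}^n\times(0,+\infty)$.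
   Context: Cubes $Q$ in $\mathbb{R}^n$ have sides parallel to the axes; $|Q|$ is the volume of $Q$, $\ell(Q)$ its sidelength, and $3Q$ is the cube obtained by dilating $Q$ by the factor $3$ from its centre. $U_t1$ denotes $U_t$ applied to the constant function $1$, i.e. $(U_t1)(x)=\int_{\mathbb{R}^n}U_t(x,y)\,dy$. For $x\in Q$ and $0<t\le\ell(Q)$, the support condition on the kernel shows that $(U_tb_Q)(x)=\int_{3Q}U_t(x,y)b_Q(y)\,dy$ depends only on the values of $b_Q$ on $3Q$. The kernel $U_t(x,y)$ is assumed jointly measurable in $(t,x,y)$ so that all integrals make sense. A positive Borel regular measure $\mu$ on $\mathbb{R}^n\times(0,+\infty)$ is a Carleson measure if $$\|\mu\|_c:=\sup_Q\frac{\mu(\mathcal{R}_Q)}{|Q|}<+\infty,\qquad \mathcal{R}_Q=Q\times(0,\ell(Q)],$$ where the supremum is taken over all cubes $Q$. *)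

(* Defs.v *)
(* MathComp-Analysis, with the complex numbers R[i] of mathcomp-real-closed. *)
From HB Require Import structures.
From mathcomp Require Import all_boot all_order all_algebra.
From mathcomp Require Import complex.
From mathcomp Require Import all_classical all_reals all_analysis.

Set Implicit Arguments.
Unset Strict Implicit.
Unset Printing Implicit Defensive.

Import Order.TTheory GRing.Theory Num.Theory.
Import numFieldNormedType.Exports.
Import ComplexField.Normc.

Local Open Scope classical_set_scope.
Local Open Scope ring_scope.

(* The Borel sigma-algebra of R^n, generated by the coordinate functions, as
   the library does for n.-tuple. *)
Definition measure_rV_display : measure_display.
Proof. exact: default_measure_display. Qed.

Section measurable_rV.
Variables (R : realType) (n : nat).

Let coors : 'I_n -> 'rV[R]_n -> R := fun i x => x ord0 i.

Let rV_set0 : g_sigma_preimage coors set0.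
Proof. exact: sigma_algebra0. Qed.

Let rV_setC A : g_sigma_preimage coors A -> g_sigma_preimage coors (~` A).
Proof. exact: sigma_algebraC. Qed.

Let rV_bigcup (F : (set 'rV[R]_n)^nat) :
  (forall i, g_sigma_preimage coors (F i)) ->
  g_sigma_preimage coors (\bigcup_i (F i)).
Proof. exact: sigma_algebra_bigcup. Qed.

HB.instance Definition _ := @isMeasurable.Build measure_rV_display
  'rV[R]_n (g_sigma_preimage coors) rV_set0 rV_setC rV_bigcup.

Lemma measurable_coor (i : 'I_n) :
  measurable_fun [set: 'rV[R]_n] (fun x : 'rV[R]_n => x ord0 i : R).
Proof.
move=> _ Y mY; rewrite setTI; apply: sub_sigma_algebra => /=.
rewrite -bigcup_seq/=; exists i => /=; first by rewrite mem_index_enum.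
by exists Y => //; rewrite setTI.
Qed.

Lemma measurable_fun_rVP d (T : measurableType d) (f : T -> 'rV[R]_n) :
  (forall i, measurable_fun [set: T] (fun x => f x ord0 i : R)) ->
  measurable_fun [set: T] f.
Proof.
move=> mf _ A mA; rewrite setTI.
have : preimage_set_system [set: T] f (g_sigma_preimage coors) (f @^-1` A).
  by exists A => //; rewrite setTI.
rewrite -g_sigma_preimage_comp; apply: smallest_sub.
  exact: sigma_algebra_measurable.
move=> B; rewrite -bigcup_seq/= => -[i _ [C mC <-]].
exact: mf.
Qed.

End measurable_rV.

Lemma product_sigma_finite d1 d2 (T1 : measurableType d1)
    (T2 : measurableType d2) (R : realType)
    (m1 : {sigma_finite_measure set T1 -> \bar R})
    (m2 : {sigma_finite_measure set T2 -> \bar R}) :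
  sigma_finite setT (m1 \x m2)%E.
Proof.
have /sigma_finiteP[F [TF ndF Foo]] := sigma_finiteT m1.
have /sigma_finiteP[G [TG ndG Goo]] := sigma_finiteT m2.
exists (fun n => F n `*` G n).
  rewrite -setXTT TF TG predeqE => -[x y]; split.
    move=> [/= [n _ Fnx] [k _ Gky]]; exists (maxn n k) => //; split.
    - by move: x Fnx; exact/subsetPset/ndF/leq_maxl.
    - by move: y Gky; exact/subsetPset/ndG/leq_maxr.
  by move=> [n _ []/= ? ?]; split; exists n.
move=> k; have [? ?] := Foo k; have [? ?] := Goo k.
split; first exact: measurableX.
by rewrite product_measure1E// lte_mul_pinfty// ge0_fin_numE.
Qed.

Section lebesgue_rV.
Variable R : realType.

Definition rV_cons n (p : R * 'rV[R]_n) : 'rV[R]_n.+1 :=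
  \row_i oapp (fun j => p.2 ord0 j) p.1 (unlift ord0 i).

Definition rV_uncons n (x : 'rV[R]_n.+1) : R * 'rV[R]_n :=
  (x ord0 ord0, \row_j x ord0 (lift ord0 j)).

Lemma rV_consK n : cancel (@rV_cons n) (@rV_uncons n).
Proof.
move=> [a x]; rewrite /rV_uncons /rV_cons mxE unlift_none /=; congr pair.
by apply/rowP => j; rewrite !mxE liftK.
Qed.

Lemma measurable_rV_cons n : measurable_fun [set: R * 'rV[R]_n] (@rV_cons n).
Proof.
apply: measurable_fun_rVP => i.
under eq_fun do rewrite mxE.
case: unliftP => [j _|_] /=; last exact: measurable_fst.
exact: (measurableT_comp (measurable_coor j)).
Qed.

Lemma measurable_rV_uncons n :
  measurable_fun [set: 'rV[R]_n.+1] (@rV_uncons n).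
Proof.
apply: measurable_fun_pair; first exact: measurable_coor.
apply: measurable_fun_rVP => i.
under eq_fun do rewrite mxE.
exact: measurable_coor.
Qed.

Section lebesgue_rV_succ.
Variables (n : nat) (mu : {sigma_finite_measure set 'rV[R]_n -> \bar R}).

Definition lebesgue_rV_succ : set 'rV[R]_n.+1 -> \bar R :=
  pushforward (@lebesgue_measure R \x mu)%E (@rV_cons n).

HB.instance Definition _ := Measure.copy lebesgue_rV_succ
  (measure_function_pushforward__canonical__measure_function_Measure
    (@lebesgue_measure R \x mu)%E (@measurable_rV_cons n)).

Let lebesgue_rV_succ_sigma_finite : sigma_finite setT lebesgue_rV_succ.
Proof.
have [F FT mF] := product_sigma_finite (@lebesgue_measure R) mu.
exists (fun k => @rV_uncons n @^-1` F k).
  by rewrite -preimage_bigcup -FT preimage_setT.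
move=> k; have [mFk Fk] := mF k; split.
  by rewrite -[X in measurable X]setTI; exact: measurable_rV_uncons.
rewrite /lebesgue_rV_succ /pushforward -comp_preimage.
rewrite (_ : _ \o _ = id) ?preimage_id//.
by apply/funext => x; exact: rV_consK.
Qed.

HB.instance Definition _ := @Measure_isSigmaFinite.Build _ _ _
  lebesgue_rV_succ lebesgue_rV_succ_sigma_finite.

End lebesgue_rV_succ.

(* Lebesgue measure on R^n: the image of the product of n copies of the
   one-dimensional Lebesgue measure (a unit mass when n = 0). *)
Fixpoint lebesgue_rV n : {sigma_finite_measure set 'rV[R]_n -> \bar R} :=
  match n return {sigma_finite_measure set 'rV[R]_n -> \bar R} with
  | 0 => dirac (0 : 'rV[R]_0)
  | n'.+1 => lebesgue_rV_succ (lebesgue_rV n')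
  end.

End lebesgue_rV.

Section lebesgue_rV_box.
Variable R : realType.

Definition rV_box n (a b : 'rV[R]_n) : set 'rV[R]_n :=
  [set x | forall i, a ord0 i <= x ord0 i <= b ord0 i].

Lemma measurable_rV_box n (a b : 'rV[R]_n) : measurable (rV_box a b).
Proof.
rewrite (_ : rV_box a b = \bigcap_(i in [set: 'I_n])
    ((fun x : 'rV[R]_n => x ord0 i) @^-1` `[a ord0 i, b ord0 i])).
  apply: fin_bigcap_measurable => [|i _]; first exact: finite_finset.
  by rewrite -[X in measurable X]setTI; exact: measurable_coor.
apply/seteqP; split => x /= xab i => [_|]; first by rewrite /= in_itv/=.
by have := xab i I; rewrite /= in_itv.
Qed.

Lemma lebesgue_rV_box n (a b : 'rV[R]_n) :
  (forall i, a ord0 i <= b ord0 i) ->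
  lebesgue_rV R n (rV_box a b) = (\prod_i (b ord0 i - a ord0 i))%:E.
Proof.
elim: n a b => [|n IHn] a b ab.
  by rewrite big_ord0 /= diracE mem_set// => -[].
pose tl (x : 'rV[R]_n.+1) := (rV_uncons x).2.
transitivity ((@lebesgue_measure R \x lebesgue_rV R n)%E
    (`[a ord0 ord0, b ord0 ord0] `*` rV_box (tl a) (tl b))).
  rewrite /= /lebesgue_rV_succ /pushforward; congr (_ _).
  apply/seteqP; split => -[x y] /=.
    move=> xy; split=> [|i].
      by have := xy ord0; rewrite !mxE unlift_none /= in_itv.
    by have := xy (lift ord0 i); rewrite !mxE liftK.
  rewrite in_itv/= => -[xab yab] i; rewrite !mxE.
  case: unliftP => [j ->|->]//=.
  by have := yab j; rewrite !mxE.
rewrite product_measure1E//; last exact: measurable_rV_box.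
rewrite IHn => [|i]; last by rewrite !mxE.
have itvE : lebesgue_measure `[a ord0 ord0, b ord0 ord0] =
    (b ord0 ord0 - a ord0 ord0)%:E.
  rewrite lebesgue_measure_itv/= lte_fin.
  have [//|ba] := ltP (a ord0 ord0) (b ord0 ord0).
  by rewrite (@le_anti _ R (a ord0 ord0) (b ord0 ord0)) ?subrr// ab ba.
rewrite big_ord_recl EFinM; congr (_ * _)%E; first exact: itvE.
by congr EFin; apply: eq_bigr => i _; rewrite !mxE.
Qed.

End lebesgue_rV_box.

Section euclidean_complex.
Variables (R : realType) (n : nat).

Definition enorm (x : 'rV[R]_n) : R := Num.sqrt (\sum_i x ord0 i ^+ 2).

(* The closed cube with centre c and sidelength l, so that 3Q is
   cube c (3 * l) when Q is cube c l. *)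
Definition cube (c : 'rV[R]_n) (l : R) : set 'rV[R]_n :=
  [set x | forall i, `|x ord0 i - c ord0 i| <= l / 2].

(* The library has no topology, measurability or integral on R[i] relative to
   R: these are taken componentwise. *)
Definition cmeasurable_fun d (T : measurableType d) (D : set T)
    (f : T -> R[i]) : Prop :=
  measurable_fun D (fun x => complex.Re (f x) : R) /\
  measurable_fun D (fun x => complex.Im (f x) : R).

Definition cintegral d (T : measurableType d) (mu : {measure set T -> \bar R})
    (D : set T) (f : T -> R[i]) : R[i] :=
  Complex (\int[mu]_(x in D) complex.Re (f x))
          (\int[mu]_(x in D) complex.Im (f x)).

Definition cdifferentiable (f : 'rV[R]_n -> R[i]) (y : 'rV[R]_n) : Prop :=
  differentiable (fun z => complex.Re (f z) : R) y /\
  differentiable (fun z => complex.Im (f z) : R) y.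

Definition cpartial (f : 'rV[R]_n -> R[i]) (i : 'I_n) (y : 'rV[R]_n) : R[i] :=
  Complex ('D_(delta_mx ord0 i) (fun z => complex.Re (f z) : R) y)
          ('D_(delta_mx ord0 i) (fun z => complex.Im (f z) : R) y).

Definition norm_gradient (f : 'rV[R]_n -> R[i]) (y : 'rV[R]_n) : R :=
  Num.sqrt (\sum_i normc (cpartial f i y) ^+ 2).

Definition L2norm (f : 'rV[R]_n -> R[i]) : \bar R :=
  ('N[lebesgue_rV R n]_(2%:E)[(fun x => (normc (f x))%:E)])%E.

End euclidean_complex.

Section integral_operators.
Variables (R : realType) (n : nat).

(* The function x |-> \int_D U_t(x, y) f(y) dy, so that D need only contain
   the domain of f. *)
Definition kernel_op (U : R -> 'rV[R]_n -> 'rV[R]_n -> R[i]) (t : R)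
    (D : set 'rV[R]_n) (f : 'rV[R]_n -> R[i]) (x : 'rV[R]_n) : R[i] :=
  cintegral (lebesgue_rV R n) D (fun y => U t x y * f y).

Definition uniformly_bounded_L2
    (U : R -> 'rV[R]_n -> 'rV[R]_n -> R[i]) : Prop :=
  exists M : R, forall t : R, 0 < t ->
    forall f : 'rV[R]_n -> R[i], cmeasurable_fun setT f ->
    (L2norm f < +oo)%E ->
    (L2norm (kernel_op U t setT f) <= M%:E * L2norm f)%E.

End integral_operators.

Section carleson.
Variables (R : realType) (n : nat).

(* R^n x (0, +oo), as a subset of R^n x R. *)
Definition upper_half_space : set ('rV[R]_n * R) := [set z | 0 < z.2].

Definition carleson_box (c : 'rV[R]_n) (l : R) : set ('rV[R]_n * R) :=
  cube c l `*` `]0, l].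

Definition carleson_norm (mu : set ('rV[R]_n * R) -> \bar R) : \bar R :=
  ereal_sup [set r | exists c l, 0 < l /\
    r = (mu (carleson_box c l) * ((fine (lebesgue_rV R n (cube c l)))^-1)%:E)%E].

(* Borel measures on the upper half-space are Borel measures on R^n x R that
   vanish off it; regularity is outer by open sets and inner by compact sets. *)
Definition regular_on_half_space
    (mu : {measure set ('rV[R]_n * R) -> \bar R}) : Prop :=
  forall A, measurable A -> A `<=` upper_half_space ->
    mu A = ereal_inf [set mu O | O in
      [set O : set ('rV[R]_n * R) | open O /\ A `<=` O /\
                                     O `<=` upper_half_space]] /\
    mu A = ereal_sup [set mu K | K in
      [set K : set ('rV[R]_n * R) | compact K /\ K `<=` A]].

Definition carleson_measure
    (mu : {measure set ('rV[R]_n * R) -> \bar R}) : Prop :=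
  [/\ mu (~` upper_half_space) = 0%E, regular_on_half_space mu &
      (carleson_norm mu < +oo)%E].

(* The measure on R^n x (0, +oo) with density F(x, t) dx dt / t. *)
Definition has_density_dxdt_over_t
    (mu : {measure set ('rV[R]_n * R) -> \bar R}) (F : 'rV[R]_n -> R -> R) :
    Prop :=
  forall A, measurable A ->
    mu A = (\int[lebesgue_rV R n \x @lebesgue_measure R]_(z in
              A `&` upper_half_space) (F z.1 z.2 / z.2)%:E)%E.

End carleson.

(* Main.v *)
(* Let gamma_t = U_t 1 and let E_k be the average over the dyadic cells of side
   l / 2^k. For f in L^2 and t between two consecutive scales, U_t f is close to
   gamma_t E_k f in square-function sense: in the martingale decomposition of f, a
   difference with mean zero on cells of side h < t contributes at most h / t by
   the Lipschitz bound, and on functions constant on cells of side h > t the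
   operator U_t is multiplication by gamma_t off a boundary layer of relative
   size t / h.

   Given a cell Q, rotate b_Q by a unit complex number e so that
   r = Re (conj e * b_Q) has mean at least 1 on Q, and stop at the maximal dyadic
   subcells on which r has mean at most 1/2. Above the stopped cells
   |gamma_t|^2 <= 4 |gamma_t E_k b_Q|^2 is controlled by |U_t b_Q|^2 and the square
   function, so it has energy O(|Q|); by Cauchy-Schwarz the stopped cells fill at
   most (1 - 1/(4C)) |Q|. Induction on the number of scales then bounds the energy
   of every cell by a constant times its volume, and a density with finite energy
   on the Carleson boxes is a locally finite, hence regular, Borel measure. *)

Require Import Defs.
From HB Require Import structures.
From mathcomp Require Import all_boot all_order all_algebra.
From mathcomp Require Import complex.
From mathcomp Require Import all_classical all_reals all_analysis.
From mathcomp Require Import measurable_realfun.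
From mathcomp Require Import ring lra.

Set Implicit Arguments.
Unset Strict Implicit.
Unset Printing Implicit Defensive.

Import Order.TTheory GRing.Theory Num.Theory.
Import numFieldNormedType.Exports.
Import ComplexField.Normc.

Local Open Scope classical_set_scope.
Local Open Scope ring_scope.

(** * Square-integrable functions *)

(** The hypotheses control only the mean of b_Q, which may vanish or oscillate on most of Q.
    Comparing |gamma_t|^2 with |U_t b_Q|^2 is legitimate only where the averages E_k b_Q stay away
    from 0, and the stopping time secures exactly this. The rotation by e replaces a complex mean by
    a real one, so that stopping is a one-sided condition that adds up over disjoint cells.

    The recursion has the form K -> A + (1 - 1/(4C)) K and closes at K = 4 C A. Running it on
    energies truncated to N scales replaces the absorption argument, which would need the Carleson
    norm to be finite in advance: for N = 0 the energy is 0, and K does not depend on N.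

    The squared norms of the errors gain (h / t)^2 from pieces finer than t, but only t / h from
    coarser ones; both are geometric in the distance between the scales, which makes the sum over
    all pairs of scales converge. The error bounds hold at each t with a constant depending on its
    band ]l / 2^(k+1), l / 2^k] only, and dt / t gives a band mass at most 1. *)

Lemma integrable_cst_set d (T : measurableType d) (R : realType)
    (mu : {measure set T -> \bar R}) (A : set T) (c : R) :
  measurable A -> (mu A < +oo)%E -> mu.-integrable A (EFin \o cst c).
Proof.
move=> mA Aoo; apply/integrableP; split; first exact/measurable_EFinP.
by rewrite (integral_cst mu mA `|c|%:E) lte_mul_pinfty// lee_fin.
Qed.

Section square_integrable.
Context d (T : measurableType d) (R : realType) (mu : {measure set T -> \bar R}).
Implicit Types (f g : T -> R) (A : set T).

Definition L2fun f : Prop :=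
  measurable_fun setT f /\ (\int[mu]_x (f x ^+ 2)%:E < +oo)%E.

Lemma L2fun_sqr f : L2fun f -> mu.-integrable setT (fun x => (f x ^+ 2)%:E).
Proof.
move=> [mf foo]; apply/integrableP; split.
  exact/measurable_EFinP/measurable_funX.
by under eq_integral do rewrite gee0_abs ?lee_fin ?sqr_ge0//.
Qed.

(** The domination has the shape of (a + b)^2 <= 2 a^2 + 2 b^2, which serves sums, differences and
    pointwise comparison alike. *)
Lemma L2fun_bound f g (h : T -> R) : measurable_fun setT h -> L2fun f -> L2fun g ->
  (forall x, h x ^+ 2 <= 2 * f x ^+ 2 + 2 * g x ^+ 2) -> L2fun h.
Proof.
move=> mh Lf Lg hfg; split => //.
have ifg : mu.-integrable setT
    (fun x => 2%:E * (f x ^+ 2)%:E + 2%:E * (g x ^+ 2)%:E)%E.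
  by apply: integrableD => //; apply: integrableZl => //; exact: L2fun_sqr.
apply: le_lt_trans (integrable_lty measurableT ifg).
apply: ge0_le_integral => //.
- by move=> x _; rewrite lee_fin sqr_ge0.
- exact/measurable_EFinP/measurable_funX.
- exact: measurable_int ifg.
- by move=> x _; rewrite -!EFinM -EFinD lee_fin hfg.
Qed.

Lemma L2fun_le f g : measurable_fun setT f -> L2fun g ->
  (forall x, `|f x| <= `|g x|) -> L2fun f.
Proof.
move=> mf Lg fg; apply: (L2fun_bound mf Lg Lg) => x.
have : f x ^+ 2 <= g x ^+ 2.
  by rewrite -[f x ^+ 2]real_normK ?num_real// -[g x ^+ 2]real_normK ?num_real// ler_sqr.
have := sqr_ge0 (g x); lra.
Qed.

Lemma L2funD f g : L2fun f -> L2fun g -> L2fun (fun x => f x + g x).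
Proof.
move=> Lf Lg; apply: (L2fun_bound _ Lf Lg) => [|x].
  by apply: measurable_funD; [case: Lf|case: Lg].
by have := sqr_ge0 (f x - g x); nra.
Qed.

Lemma L2funB f g : L2fun f -> L2fun g -> L2fun (fun x => f x - g x).
Proof.
move=> Lf Lg; apply: (L2fun_bound _ Lf Lg) => [|x].
  by apply: measurable_funB; [case: Lf|case: Lg].
by have := sqr_ge0 (f x + g x); nra.
Qed.

Lemma L2fun_indic A : measurable A -> (mu A < +oo)%E -> L2fun \1_A.
Proof.
move=> mA Aoo; split; first exact: measurable_indic.
under eq_integral => x _.
  rewrite (_ : (\1_A x ^+ 2)%:E = (\1_A x)%:E); last first.
    by rewrite indicE; case: (x \in A); rewrite ?expr1n ?expr0n.
  over.
by rewrite integral_indic// setIT.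
Qed.

Lemma L2funZ (k : R) f : L2fun f -> L2fun (fun x => k * f x).
Proof.
move=> Lf; split; first by apply: measurable_funM => //; case: Lf.
under eq_integral do rewrite exprMn EFinM.
rewrite integralZl//; last exact: L2fun_sqr.
rewrite lte_mul_pinfty ?lee_fin ?sqr_ge0//; exact: Lf.2.
Qed.

Lemma L2fun_mul f g : L2fun f -> L2fun g ->
  mu.-integrable setT (fun x => (f x * g x)%:E).
Proof.
move=> Lf Lg.
have := integrableD measurableT (L2fun_sqr Lf) (L2fun_sqr Lg).
apply: le_integrable => //.
  by apply/measurable_EFinP/measurable_funM; [case: Lf|case: Lg].
move=> x _; rewrite -EFinD !abse_EFin lee_fin [leRHS]ger0_norm ?addr_ge0 ?sqr_ge0//.
rewrite ler_norml; have := sqr_ge0 (f x + g x); have := sqr_ge0 (f x - g x).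
have := sqr_ge0 (f x); have := sqr_ge0 (g x).
by move=> ? ? ? ?; apply/andP; split; nra.
Qed.

Lemma L2fun_integrable f A : measurable A -> (mu A < +oo)%E -> L2fun f ->
  mu.-integrable A (EFin \o f).
Proof.
move=> mA Aoo Lf; apply/integrable_mkcond => //.
apply: eq_integrable (L2fun_mul Lf (L2fun_indic mA Aoo)) => //.
move=> x _ /=; rewrite patchE indicE; case: (x \in A); rewrite ?mulr1//.
by rewrite mulr0.
Qed.

(** Discriminant argument: the quadratic [q - 2 * s * a + s ^+ 2 * m] in [s] is the integral of (|f|
    - s)^2 over [A], hence never negative. *)
Lemma cauchy_schwarz_set f A : measurable A -> (mu A < +oo)%E -> L2fun f ->
  (((\int[mu]_(x in A) `|f x|) ^+ 2)%:E <=
     mu A * \int[mu]_(x in A) (f x ^+ 2)%:E)%E.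
Proof.
move=> mA Aoo Lf; have iA := L2fun_integrable mA Aoo Lf.
have iabs : mu.-integrable A (EFin \o (fun x => `|f x|)).
  exact: integrable_norm.
have isq : mu.-integrable A (EFin \o (fun x => f x ^+ 2)).
  by apply: integrableS (L2fun_sqr Lf).
set a := \int[mu]_(x in A) `|f x|.
have Afin : mu A \is a fin_num by rewrite ge0_fin_numE.
rewrite -(fineK Afin); set m := fine (mu A).
have m0 : 0 <= m by rewrite fine_ge0.
have qfin : (\int[mu]_(x in A) (f x ^+ 2)%:E)%E \is a fin_num.
  exact: integrable_fin_num isq.
rewrite -(fineK qfin) -EFinM lee_fin; set q := fine _.
have icst (c : R) := integrable_cst_set c mA Aoo.
have key s : 0 <= q - 2 * s * a + s ^+ 2 * m.
  have : 0 <= \int[mu]_(x in A) (f x ^+ 2 - 2 * s * `|f x| + s ^+ 2).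
    apply: Rintegral_ge0 => x _.
    rewrite -[f x ^+ 2]real_normK ?num_real//.
    by have := sqr_ge0 (`|f x| - s); nra.
  have iz : mu.-integrable A (EFin \o (fun x => 2 * s * `|f x|)).
    exact: (@integrableZl _ _ _ mu A mA (2 * s) _ iabs).
  have ib : mu.-integrable A (EFin \o (fun x => f x ^+ 2 - 2 * s * `|f x|)).
    exact: (integrableB mA isq iz).
  by rewrite (RintegralD mA ib (icst _)) RintegralB// RintegralZl// Rintegral_cst.
have a0 : 0 <= a by apply: Rintegral_ge0.
have [m_eq0|m_neq0] := eqVneq m 0.
  have [->|an0] := eqVneq a 0; first by rewrite expr0n/= m_eq0 mul0r.
  have q0 : 0 <= q by apply: Rintegral_ge0 => x _; exact: sqr_ge0.
  (* For [m = 0] the quadratic degenerates to the line q - 2 s a, which takes the negative value - q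
     - 2 at this [s]. *)
  have := key ((q + 1) / a).
  by rewrite m_eq0 mulr0 addr0 -mulrA divfK// => ?; lra.
have mgt0 : 0 < m by rewrite lt_neqAle eq_sym m_neq0.
have sm : a / m * m = a by rewrite divfK.
have := key (a / m); rewrite expr2 -[_ * _ * m]mulrA sm => h.
have {h} : a / m * a <= q by lra.
by rewrite -(ler_pM2l mgt0) mulrA [m * _]mulrC sm -expr2.
Qed.

End square_integrable.

(** * Averages over the cells of a countable partition *)

Section partition.
Context d (T : measurableType d) (R : realType) (mu : {measure set T -> \bar R}).
Context (I : countType) (p : T -> I) (v : R).
Hypothesis v_gt0 : 0 < v.

Definition cell_of (x : T) : set T := [set y | p y = p x].

Hypothesis measurable_cell : forall x, measurable (cell_of x).
Hypothesis mu_cell : forall x, mu (cell_of x) = v%:E.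

(** Enumerates the cells inside a saturated [B] by the code of their index, so that countable
    additivity applies; a code that no point of [B] attains gives the empty set. *)
Let F (B : set T) (k : nat) : set T :=
  [set x | B x /\ pickle_inv k = Some (p x)].

Let F_cell B k : (forall x y, p x = p y -> B x -> B y) ->
  F B k = set0 \/ exists2 x, B x & F B k = cell_of x.
Proof.
move=> sB; have [->|/set0P[x [Bx kx]]] := eqVneq (F B k) set0; [by left|right].
exists x => //; apply/seteqP; split => y /=.
  by move=> [By]; rewrite kx => -[].
by move=> yx; split; [apply: (sB x)|rewrite kx yx].
Qed.

Let F_bigcup B : B = \bigcup_k F B k.
Proof.
apply/seteqP; split => x; last by move=> [k _ []].
by move=> Bx; exists (pickle (p x)) => //; split=> //; exact: pickleK_inv.
Qed.

Let F_triv B : trivIset setT (F B).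
Proof.
apply/trivIsetP => i j _ _ ij; apply/seteqP; split => x //= -[[_ ix] [_ jx]].
have := @pickle_invK I i; have := @pickle_invK I j.
by rewrite ix jx /= => jE iE; move: ij; rewrite -iE -jE eqxx.
Qed.

Let F_measurable B k : (forall x y, p x = p y -> B x -> B y) ->
  measurable (F B k).
Proof. by move=> /F_cell-/(_ k)[->|[x _ ->]]. Qed.

Lemma saturated_measurable B :
  (forall x y, p x = p y -> B x -> B y) -> measurable B.
Proof.
by move=> sB; rewrite (F_bigcup B); apply: bigcup_measurable => k _; exact: F_measurable.
Qed.

Lemma cell_constant_measurable d' (T' : measurableType d') (g : T -> T') :
  (forall x y, p x = p y -> g x = g y) -> measurable_fun setT g.
Proof.
move=> gp _ Y mY; rewrite setTI; apply: saturated_measurable => x y xy /=.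
by rewrite (gp _ _ xy).
Qed.

Lemma ge0_le_integral_saturated B (f g : T -> \bar R) :
  (forall x y, p x = p y -> B x -> B y) ->
  measurable_fun setT f -> measurable_fun setT g ->
  (forall x, 0 <= f x)%E -> (forall x, 0 <= g x)%E ->
  (forall x, B x ->
    \int[mu]_(y in cell_of x) f y <= \int[mu]_(y in cell_of x) g y)%E ->
  (\int[mu]_(x in B) f x <= \int[mu]_(x in B) g x)%E.
Proof.
move=> sB mf mg f0 g0 fg; rewrite (F_bigcup B) !ge0_integral_bigcup//;
  do ?[by move=> k; exact: F_measurable | exact: measurable_funTS].
apply: lee_nneseries => k _; first by move=> _; exact: integral_ge0.
by have [->|[x Bx ->]] := F_cell k sB; rewrite ?integral_set0 ?fg.
Qed.

Lemma integral_cells_eq0 (f : T -> \bar R) : mu.-integrable setT f ->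
  (forall x, \int[mu]_(y in cell_of x) f y = 0)%E -> (\int[mu]_x f x = 0)%E.
Proof.
move=> if_ f0; have sT : forall x y, p x = p y -> [set: T] x -> [set: T] y by [].
rewrite (F_bigcup setT) integral_bigcup//.
- rewrite eseries0// => k _ _.
  by have [->|[x _ ->]] := F_cell k sT; rewrite ?integral_set0.
- by move=> k; exact: F_measurable.
- by rewrite -F_bigcup.
Qed.

Let cell_oo x : (mu (cell_of x) < +oo)%E. Proof. by rewrite mu_cell ltry. Qed.

Let L2cell f x : L2fun mu f -> mu.-integrable (cell_of x) (EFin \o f).
Proof. by move=> Lf; apply: L2fun_integrable. Qed.

(** Orthogonality of martingale differences: [psi] leaves the integral over each cell. It is applied
    to averages, to frozen kernels and to indicators of unions of cells. *)
Lemma integral_cell_constant_mul (psi g : T -> R) :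
  L2fun mu psi -> L2fun mu g -> (forall x y, p x = p y -> psi x = psi y) ->
  (forall x, \int[mu]_(y in cell_of x) g y = 0) ->
  \int[mu]_x (psi x * g x) = 0.
Proof.
move=> Lpsi Lg cpsi g0; rewrite /Rintegral integral_cells_eq0//.
  exact: L2fun_mul.
move=> x; transitivity (\int[mu]_(y in cell_of x) ((psi x)%:E * (g y)%:E))%E.
  by apply: eq_integral => y; rewrite inE => xy; rewrite (cpsi _ _ xy) EFinM.
have ig := L2cell x Lg.
rewrite integralZl//.
have fin : (\int[mu]_(y in cell_of x) (EFin \o g) y)%E \is a fin_num.
  exact: integrable_fin_num.
by rewrite -(fineK fin) [fine _]g0 mule0.
Qed.

Definition average (f : T -> R) (x : T) : R :=
  (\int[mu]_(y in cell_of x) f y) / v.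

Lemma average_constant f x y : p x = p y -> average f x = average f y.
Proof. by rewrite /average /cell_of => ->. Qed.

Lemma averageD f g x : L2fun mu f -> L2fun mu g ->
  average (fun x => f x + g x) x = average f x + average g x.
Proof. by move=> Lf Lg; rewrite /average RintegralD ?mulrDl//; exact: L2cell. Qed.

Lemma averageB f g x : L2fun mu f -> L2fun mu g ->
  average (fun x => f x - g x) x = average f x - average g x.
Proof. by move=> Lf Lg; rewrite /average RintegralB ?mulrBl//; exact: L2cell. Qed.

Lemma averageZ k f x : L2fun mu f ->
  average (fun x => k * f x) x = k * average f x.
Proof. by move=> Lf; rewrite /average RintegralZl ?mulrA//; exact: L2cell. Qed.

Lemma average_cell_constant f x : (forall x y, p x = p y -> f x = f y) ->
  average f x = f x.
Proof.
move=> cf; rewrite /average (@eq_Rintegral _ _ _ _ _ (cst (f x))).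
  by rewrite Rintegral_cst// mu_cell mulfK// gt_eqF.
by move=> y; rewrite inE => /cf ->.
Qed.

(** Jensen's inequality on one cell, obtained from Cauchy-Schwarz; summed over the cells it makes
    averaging a contraction of L^2. *)
Lemma average_sqr_le f x : L2fun mu f ->
  ((average f x ^+ 2 * v)%:E <= \int[mu]_(y in cell_of x) (f y ^+ 2)%:E)%E.
Proof.
move=> Lf; have := cauchy_schwarz_set (measurable_cell x) (cell_oo x) Lf.
have isq : mu.-integrable (cell_of x) (EFin \o (fun x => f x ^+ 2)).
  by apply: integrableS (L2fun_sqr Lf).
have qfin : (\int[mu]_(y in cell_of x) (f y ^+ 2)%:E)%E \is a fin_num.
  exact: integrable_fin_num isq.
rewrite mu_cell -(fineK qfin) -EFinM !lee_fin => h.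
have {h} : (\int[mu]_(y in cell_of x) f y) ^+ 2 <=
    v * fine (\int[mu]_(y in cell_of x) (f y ^+ 2)%:E).
  apply: le_trans h.
  rewrite -[leLHS]real_normK ?num_real// ler_sqr ?nnegrE//; last exact: Rintegral_ge0.
  by apply: le_normr_Rintegral => //; exact: L2cell.
rewrite /average expr_div_n (_ : _ / v ^+ 2 * v = (\int[mu]_(y in cell_of x) f y) ^+ 2 / v).
  by rewrite ler_pdivrMr// mulrC.
by field; rewrite gt_eqF.
Qed.

Lemma L2fun_average f : L2fun mu f -> L2fun mu (average f).
Proof.
move=> Lf.
have mavg : measurable_fun setT (average f).
  by apply: cell_constant_measurable => x y; exact: average_constant.
split => //; apply: le_lt_trans Lf.2.
apply: ge0_le_integral_saturated => //.
- exact/measurable_EFinP/measurable_funX.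
- by apply/measurable_EFinP/measurable_funX; case: Lf.
- by move=> x; rewrite lee_fin sqr_ge0.
- by move=> x; rewrite lee_fin sqr_ge0.
move=> x _; apply: le_trans (average_sqr_le x Lf).
rewrite (eq_integral (cst (average f x ^+ 2)%:E)).
  by rewrite integral_cst// mu_cell -EFinM.
by move=> y; rewrite inE => /average_constant ->.
Qed.

Lemma integral_sub_average f x : L2fun mu f ->
  \int[mu]_(y in cell_of x) (f y - average f y) = 0.
Proof.
move=> Lf; have La := L2fun_average Lf.
rewrite RintegralB//; do ?exact: L2cell.
rewrite (@eq_Rintegral _ _ _ _ _ (cst (average f x)) (average f)).
  by rewrite Rintegral_cst// mu_cell /= /average divfK ?gt_eqF ?subrr.
by move=> y; rewrite inE => /average_constant ->.
Qed.

(** Pythagoras: the cross term is a cell-constant function times a function of mean zero on cells,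
    so it integrates to 0. *)
Lemma integral_sqr_average f : L2fun mu f ->
  (\int[mu]_x (f x ^+ 2)%:E = \int[mu]_x (average f x ^+ 2)%:E +
     \int[mu]_x ((f x - average f x) ^+ 2)%:E)%E.
Proof.
move=> Lf; have La := L2fun_average Lf; have Ld := L2funB Lf La.
have i1 := L2fun_sqr La; have i2 := L2fun_sqr Ld.
have i3 := L2fun_mul (L2funZ 2 La) Ld.
have z : (\int[mu]_x ((2 * average f x) * (f x - average f x))%:E = 0)%E.
  rewrite -[LHS]fineK ?integrable_fin_num//; congr EFin.
  apply: (integral_cell_constant_mul (L2funZ 2 La) Ld) => [x y xy|x].
    by rewrite (average_constant _ xy).
  exact: integral_sub_average.
rewrite -integralD// -[RHS]adde0 -z -integralD//; last exact: integrableD.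
by apply: eq_integral => x _; rewrite -!EFinD; congr EFin; ring.
Qed.

End partition.

Section refinement.
Context d (T : measurableType d) (R : realType) (mu : {measure set T -> \bar R}).
Context (I J : countType) (p : T -> I) (q : T -> J) (v w : R).
Hypothesis v_gt0 : 0 < v.
Hypothesis measurable_cell : forall x, measurable (cell_of p x).
Hypothesis mu_cell : forall x, mu (cell_of p x) = v%:E.
Hypothesis mu_coarse_cell : forall x, mu (cell_of q x) = w%:E.
Hypothesis refines : forall x y, p x = p y -> q x = q y.

(** The indicator of a coarse cell is constant on the fine cells, so orthogonality applies to it. *)
Lemma average_coarse_eq0 g x : L2fun mu g ->
  (forall x, \int[mu]_(y in cell_of p x) g y = 0) -> average mu q w g x = 0.
Proof.
move=> Lg g0; rewrite /average Rintegral_mkcond.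
have sat (y z : T) : p y = p z -> cell_of q x y -> cell_of q x z.
  by rewrite /cell_of/= => /refines ->.
have mq : measurable (cell_of q x).
  exact: (saturated_measurable measurable_cell).
rewrite (_ : \int[mu]_y _ = 0) ?mul0r//.
transitivity (\int[mu]_y (\1_(cell_of q x) y * g y)).
  by apply: eq_Rintegral => y _; rewrite patchE indicE; case: ifP; rewrite ?mul1r ?mul0r.
apply: (integral_cell_constant_mul measurable_cell mu_cell) => //.
- by apply: L2fun_indic => //; rewrite mu_coarse_cell ltry.
- move=> y z yz; rewrite !indicE; congr (nat_of_bool _)%:R.
  by apply/idP/idP; rewrite !inE; apply: sat.
Qed.

End refinement.

(** * Boxes, cubes and grids *)

Lemma measure_bigcup_ord_le d (T : measurableType d) (R : realType)
    (mu : {measure set T -> \bar R}) n (A : 'I_n -> set T) :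
  (forall i, measurable (A i)) ->
  measurable (\bigcup_i A i) /\ (mu (\bigcup_i A i) <= \sum_i mu (A i))%E.
Proof.
move=> mA.
have -> : \bigcup_i A i = \big[setU/set0]_(i < n) A i.
  rewrite -bigcup_seq; congr bigcup; apply/seteqP; split => // i _ /=.
  exact: mem_index_enum.
elim/big_ind2 : _ => [|B b B' b' [mB Bb] [mB' Bb']|i _]; first by rewrite measure0.
  split; first exact: measurableU.
  by apply: le_trans (leeD Bb Bb'); exact: measureU2.
by [].
Qed.

Lemma measurable_integral_xsection d1 d2 (T1 : measurableType d1)
    (T2 : measurableType d2) (R : realType)
    (m : {sigma_finite_measure set T2 -> \bar R}) (D : set (T1 * T2))
    (G : T2 -> \bar R) :
  measurable D -> measurable_fun setT G -> (forall y, 0 <= G y)%E ->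
  measurable_fun setT (fun x => \int[m]_(y in xsection D x) G y)%E.
Proof.
move=> mD mG G0; pose f z := (G z.2 * (\1_D z)%:E)%E.
have mf : measurable_fun setT f.
  apply: emeasurable_funM; first exact: measurableT_comp.
  exact/measurable_EFinP/measurable_indic.
have f0 z : (0 <= f z)%E by rewrite mule_ge0// lee_fin.
have := @measurable_fun_fubini_tonelli_F _ _ _ _ _ m f mf f0.
apply: eq_measurable_fun => x _; rewrite /fubini_F [RHS]integral_mkcond.
apply: eq_integral => y _; rewrite /f patchE indicE mem_xsection.
by case: ifPn; rewrite ?mule1 ?mule0.
Qed.

Section boxes.
Variables (R : realType) (n : nat).
Implicit Types (a b c x y : 'rV[R]_n) (h r l t : R).
Local Notation lam := (lebesgue_rV R n).

(** Half-open boxes tile the space, whereas the closed cubes of the statement overlap; the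
    discrepancy is a null set by [lebesgue_rV_faces]. *)
Definition rV_cobox a b : set 'rV[R]_n :=
  [set x | forall i, a ord0 i <= x ord0 i < b ord0 i].

Lemma measurable_rV_coor_itv (I : 'I_n -> interval R) :
  measurable [set x : 'rV[R]_n | forall i, x ord0 i \in I i].
Proof.
rewrite (_ : [set x | _] = \bigcap_(i in [set: 'I_n])
    ((fun x : 'rV[R]_n => x ord0 i) @^-1` [set` I i])).
  apply: fin_bigcap_measurable => [|i _]; first exact: finite_finset.
  by rewrite -[X in measurable X]setTI; exact: measurable_coor.
by apply/seteqP; split => x /= xab i => [_|]; [exact: xab|exact: (xab i Logic.I)].
Qed.

Lemma measurable_rV_cobox a b : measurable (rV_cobox a b).
Proof.
rewrite (_ : rV_cobox a b =
    [set x | forall i, x ord0 i \in `[a ord0 i, b ord0 i[]).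
  exact: (measurable_rV_coor_itv (fun i => `[a ord0 i, b ord0 i[)).
by apply/seteqP; split => x /= xab i; move: (xab i); rewrite in_itv.
Qed.

Definition set_coor a (i : 'I_n) (s : R) : 'rV[R]_n :=
  \row_j if j == i then s else a ord0 j.

Lemma lebesgue_rV_faces a b : (forall i, a ord0 i <= b ord0 i) ->
  lam (rV_box a b `\` rV_cobox a b) = 0%E.
Proof.
move=> ab.
(* The upper face in direction [i], written as a box whose i-th side has collapsed to a point. *)
pose A i := rV_box (set_coor a i (b ord0 i)) b.
have mA i : measurable (A i) by exact: measurable_rV_box.
have A0 i : lam (A i) = 0%E.
  rewrite lebesgue_rV_box.
    by rewrite (bigD1 i)//= mxE eqxx subrr mul0r.
  by move=> j; rewrite mxE; case: eqP => [->|].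
have [mU U0] := measure_bigcup_ord_le lam mA.
have {}U0 : lam (\bigcup_i A i) = 0%E.
  apply/eqP; rewrite -measure_le0; apply: le_trans U0 _.
  by rewrite big1// => i _; exact: A0.
apply: (subset_measure0 _ mU _ U0).
  by apply: measurableD; [exact: measurable_rV_box|exact: measurable_rV_cobox].
move=> x /= [xab /existsNP[i /negP]]; rewrite negb_and -leNgt -ltNge => h.
exists i => // j; rewrite mxE; case: eqP => [->|_]; last exact: xab.
have /andP[ax xb] := xab i; rewrite xb andbT.
by move: h => /orP[|//]; rewrite ltNge ax.
Qed.

Lemma rV_cobox_sub a b : rV_cobox a b `<=` rV_box a b.
Proof. by move=> x h i; have /andP[-> /ltW ->] := h i. Qed.

Lemma lebesgue_rV_cobox a b : (forall i, a ord0 i <= b ord0 i) ->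
  lam (rV_cobox a b) = (\prod_i (b ord0 i - a ord0 i))%:E.
Proof.
move=> ab; rewrite -lebesgue_rV_box//.
rewrite -[in RHS](setDUK (@rV_cobox_sub a b)) measureU//.
- by rewrite [X in (_ + X)%E]lebesgue_rV_faces// adde0.
- exact: measurable_rV_cobox.
- by apply: measurableD; [exact: measurable_rV_box|exact: measurable_rV_cobox].
- by rewrite setDE setICA setICr setI0.
Qed.

Lemma cubeE c l : cube c l = rV_box (c - const_mx (l / 2)) (c + const_mx (l / 2)).
Proof.
apply/seteqP; split => x /= h i; have := h i; rewrite !mxE ler_norml.
  by move=> /andP[h1 h2]; apply/andP; split; lra.
by move=> /andP[h1 h2]; apply/andP; split; lra.
Qed.

Lemma measurable_cube c l : measurable (cube c l).
Proof. by rewrite cubeE; exact: measurable_rV_box. Qed.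

Lemma lebesgue_cube c l : 0 <= l -> lam (cube c l) = (l ^+ n)%:E.
Proof.
move=> l0; rewrite cubeE lebesgue_rV_box.
  rewrite (eq_bigr (fun=> l)); first by rewrite prodr_const card_ord.
  by move=> i _; rewrite !mxE; field.
by move=> i; rewrite !mxE; lra.
Qed.

Lemma cube_sym x y l : cube x l y -> cube y l x.
Proof. by move=> h i; rewrite distrC. Qed.

Lemma measurable_cube_rel l :
  measurable [set z : 'rV[R]_n * 'rV[R]_n | cube z.1 l z.2].
Proof.
rewrite (_ : [set z | _] = \bigcap_(i in [set: 'I_n])
    ((fun z : 'rV[R]_n * 'rV[R]_n => z.2 ord0 i - z.1 ord0 i) @^-1`
       `[- (l / 2), l / 2])).
  apply: fin_bigcap_measurable => [|i _]; first exact: finite_finset.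
  rewrite -[X in measurable X]setTI.
  suff : measurable_fun setT
    (fun z : 'rV[R]_n * 'rV[R]_n => z.2 ord0 i - z.1 ord0 i) by exact.
  by apply: measurable_funB; apply: (measurableT_comp (measurable_coor i)).
apply/seteqP; split => z /= h i => [_|].
  by rewrite /= in_itv/= -ler_norml.
by have := h i I; rewrite /= in_itv/= -ler_norml.
Qed.

(** Tonelli replaces the section of [D] over [x] by the one over [y], and symmetry identifies the
    latter with [xsection D y]. *)
Lemma integral_sections_sym (D : set ('rV[R]_n * 'rV[R]_n))
    (G : 'rV[R]_n -> \bar R) :
  measurable D -> (forall x y, D (x, y) -> D (y, x)) ->
  measurable_fun setT G -> (forall x, 0 <= G x)%E ->
  (\int[lam]_x \int[lam]_(y in xsection D x) G y =
   \int[lam]_y (G y * lam (xsection D y)))%E.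
Proof.
move=> mD sD mG G0.
pose f z := (G z.2 * (\1_D z)%:E)%E.
have mf : measurable_fun setT f.
  apply: emeasurable_funM; first exact: measurableT_comp.
  exact/measurable_EFinP/measurable_indic.
have f0 z : (0 <= f z)%E by rewrite mule_ge0// lee_fin.
transitivity (\int[lam]_x \int[lam]_y f (x, y))%E.
  apply: eq_integral => x _; rewrite integral_mkcond; apply: eq_integral => y _.
  rewrite /f patchE indicE mem_xsection /=.
  by case: ifPn; rewrite ?mule1 ?mule0.
rewrite fubini_tonelli//; apply: eq_integral => y _; rewrite /f /=.
rewrite ge0_integralZl//.
- congr (_ * _)%E.
  rewrite -[xsection D y in RHS]setIT -integral_indic//; last first.
    exact: measurable_xsection.
  apply: eq_integral => x _; congr (_%:E).
  rewrite !indicE mem_xsection; congr (nat_of_bool _)%:R.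
  by apply/idP/idP; rewrite !inE; exact: sD.
- apply/measurable_EFinP.
  exact: (measurableT_comp (measurable_indic mD) (pair2_measurable y)).
Qed.

Lemma integral_cubes l (G : 'rV[R]_n -> \bar R) : 0 <= l ->
  measurable_fun setT G -> (forall x, 0 <= G x)%E ->
  (\int[lam]_x \int[lam]_(y in cube x l) G y = (l ^+ n)%:E * \int[lam]_y G y)%E.
Proof.
move=> l0 mG G0.
pose D := [set z : 'rV[R]_n * 'rV[R]_n | cube z.1 l z.2].
have xD x : xsection D x = cube x l.
  by apply/seteqP; split=> y; rewrite /xsection/= inE.
transitivity (\int[lam]_x \int[lam]_(y in xsection D x) G y)%E.
  by apply: eq_integral => x _; rewrite xD.
rewrite integral_sections_sym//; last 2 first.
- exact: measurable_cube_rel.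
- by move=> x y; exact: cube_sym.
under eq_integral do rewrite xD lebesgue_cube//.
by rewrite ge0_integralZr ?lee_fin ?exprn_ge0// muleC.
Qed.

(** Schur's test for a kernel dominated by [k] on the cubes: one factor [l ^+ n] comes from
    Cauchy-Schwarz on [cube x l], the other from Tonelli in [integral_cubes]. *)
Lemma integral_sqr_le_cubes (g S : 'rV[R]_n -> R) k l : 0 <= k -> 0 <= l ->
  L2fun lam g -> measurable_fun setT S ->
  (forall x, `|S x| <= k * \int[lam]_(y in cube x l) `|g y|) ->
  (\int[lam]_x (S x ^+ 2)%:E <=
     (k ^+ 2 * l ^+ (2 * n))%:E * \int[lam]_x (g x ^+ 2)%:E)%E.
Proof.
move=> k0 l0 Lg mS Sg.
have coo x : (lam (cube x l) < +oo)%E by rewrite lebesgue_cube// ltry.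
have mg2 : measurable_fun setT (fun x => (g x ^+ 2)%:E).
  by apply/measurable_EFinP/measurable_funX; case: Lg.
have g20 x : (0 <= (g x ^+ 2)%:E)%E by rewrite lee_fin sqr_ge0.
have mint : measurable_fun setT
    (fun x => \int[lam]_(y in cube x l) (g y ^+ 2)%:E)%E.
  have := measurable_integral_xsection lam (measurable_cube_rel l) mg2 g20.
  apply: eq_measurable_fun => x _; congr (integral _ _ _).
  by apply/seteqP; split=> y; rewrite /xsection/= inE.
have kl0 : (0 <= (k ^+ 2 * l ^+ n)%:E)%E by rewrite lee_fin mulr_ge0 ?exprn_ge0.
rewrite mulSn mul1n exprD mulrA EFinM -muleA -integral_cubes//.
rewrite -ge0_integralZl//; last by move=> x _; exact: integral_ge0.
apply: ge0_le_integral => //.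
- by move=> x _; rewrite lee_fin sqr_ge0.
- exact/measurable_EFinP/measurable_funX.
- exact: measurable_funeM.
move=> x _; apply: (@le_trans _ _
   (((k * \int[lam]_(y in cube x l) `|g y|) ^+ 2)%:E)).
  rewrite lee_fin -[S x ^+ 2]real_normK ?num_real// ler_sqr ?nnegrE//.
  by apply: mulr_ge0 => //; exact: Rintegral_ge0.
rewrite exprMn EFinM [(k ^+ 2 * l ^+ n)%:E]EFinM -muleA.
rewrite lee_wpmul2l ?lee_fin ?exprn_ge0//.
rewrite -(lebesgue_cube x l0).
exact: (cauchy_schwarz_set (measurable_cube x l) (coo x) Lg).
Qed.

End boxes.

(** * Grids of half-open cells and their boundary layers *)

Section grid.
Variables (R : realType) (n : nat) (a : 'rV[R]_n).
Implicit Types (x y : 'rV[R]_n) (h t : R).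
Local Notation lam := (lebesgue_rV R n).

(** The origin [a] is arbitrary so that any given cube can be made a single cell, up to its
    faces. *)
Definition grid_index h x : {ffun 'I_n -> int} :=
  [ffun i => Num.floor ((x ord0 i - a ord0 i) / h)].

Definition grid_corner h x : 'rV[R]_n :=
  \row_i (a ord0 i + (grid_index h x i)%:~R * h).

Local Notation grid_cell h := (cell_of (grid_index h)).

Lemma grid_cellE h x : 0 < h ->
  grid_cell h x = rV_cobox (grid_corner h x) (grid_corner h x + const_mx h).
Proof.
move=> h0.
have E y i : (grid_index h y i == grid_index h x i) =
    (grid_corner h x ord0 i <= y ord0 i < (grid_corner h x + const_mx h) ord0 i).
  rewrite !mxE {1}/grid_index ffunE floor_eq ler_pdivlMr// ltr_pdivrMr//.
  rewrite intrD mulrDl mul1r.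
  by congr andb; [apply/idP/idP|apply/idP/idP] => ?; lra.
apply/seteqP; split=> y /=.
  by move=> yx i; rewrite -E yx.
by move=> yx; apply/ffunP => i; apply/eqP; rewrite E yx.
Qed.

Lemma grid_corner_const h x y : grid_index h x = grid_index h y ->
  grid_corner h x = grid_corner h y.
Proof. by rewrite /grid_corner => ->. Qed.

Lemma measurable_grid_cell h x : 0 < h -> measurable (grid_cell h x).
Proof. by move=> h0; rewrite grid_cellE//; exact: measurable_rV_cobox. Qed.

Lemma lebesgue_grid_cell h x : 0 < h -> lam (grid_cell h x) = (h ^+ n)%:E.
Proof.
move=> h0; rewrite grid_cellE// lebesgue_rV_cobox.
  rewrite (eq_bigr (fun=> h)); first by rewrite prodr_const card_ord.
  by move=> i _; rewrite !mxE; field.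
by move=> i; rewrite !mxE; lra.
Qed.

Lemma grid_index_coarsen h (m : nat) x y : (0 < m)%N -> 0 < h ->
  grid_index h x = grid_index h y ->
  grid_index (m%:R * h) x = grid_index (m%:R * h) y.
Proof.
move=> m0 h0 xy; apply/ffunP => i; rewrite !ffunE.
have : grid_index h x i = grid_index h y i by rewrite xy.
rewrite !ffunE; set u := x ord0 i - _; set w := y ord0 i - _ => uw.
(* An integer z satisfies z <= s / (m h) iff z m <= s / h, iff z m <= floor (s / h), since z m is an
   integer. Hence the coarse floor depends on the fine floor alone. *)
have key (s s' : R) : Num.floor (s / h) = Num.floor (s' / h) ->
    (Num.floor (s / (m%:R * h)) <= Num.floor (s' / (m%:R * h)))%R.
  move=> ss; rewrite floor_ge_int// ler_pdivlMr ?mulr_gt0 ?ltr0n//.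
  have : (Num.floor (s / (m%:R * h)))%:~R <= s / (m%:R * h) by exact: floor_le.
  rewrite !ler_pdivlMr ?mulr_gt0 ?ltr0n// mulrA -ler_pdivlMr//.
  rewrite (_ : _%:~R * m%:R = (Num.floor (s / (m%:R * h)) * m%:Z)%:~R); last first.
    by rewrite intrM.
  by rewrite -floor_ge_int ss floor_ge_int ler_pdivlMr// !intrM/= -mulrA.
by apply/eqP; rewrite eq_le !key.
Qed.

Definition boundary_layer h t : set 'rV[R]_n :=
  [set x : 'rV[R]_n | exists i, x ord0 i <= grid_corner h x ord0 i + t \/
                     grid_corner h x ord0 i + h - t <= x ord0 i].

Lemma boundary_layerP h t x y : 0 < h -> cube x (2 * t) y ->
  grid_index h y <> grid_index h x -> boundary_layer h t x.
Proof.
move=> h0 xy ne.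
have : ~ grid_cell h x y by [].
rewrite grid_cellE// => /existsNP[i /negP]; rewrite negb_and -leNgt -ltNge => hy.
exists i; have := xy i; rewrite ler_norml => /andP[xy1 xy2].
have : grid_cell h x x by [].
rewrite grid_cellE// => /(_ i)/andP[_ _].
by case/orP: hy; rewrite ?mxE => ?; [left|right]; lra.
Qed.

Lemma measure_boundary_layer h t x : 0 < h -> 0 <= t -> t <= h ->
  measurable (grid_cell h x `&` boundary_layer h t) /\
  (lam (grid_cell h x `&` boundary_layer h t) <=
     (2 * n%:R * (t / h) * h ^+ n)%:E)%E.
Proof.
move=> h0 t0 th.
pose c := grid_corner h x.
(* Two slabs of thickness [t], along the two faces orthogonal to direction [i]; each has the
   fraction t / h of the volume of the cell, whence the factor 2 n. *)
pose A (i : 'I_n) := rV_box c (set_coor (c + const_mx h) i (c ord0 i + t)) `|`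
  rV_box (set_coor c i (c ord0 i + h - t)) (c + const_mx h).
have mA i : measurable (A i) by apply: measurableU; exact: measurable_rV_box.
have [mU leU] := measure_bigcup_ord_le lam mA.
have vol i (b : 'I_n -> R) : (forall j, b j = if j == i then t else h) ->
    \prod_j b j = t / h * h ^+ n.
  move=> bE; rewrite (bigD1 i)//= bE eqxx.
  rewrite (eq_bigr (fun=> h)); last by move=> j /negbTE ji; rewrite bE ji.
  rewrite prodr_const cardC1 card_ord.
  (* A direction [i] exists only in positive dimension, where [h ^+ n] has a factor [h] to exchange
     for [t]. *)
  case: (n) i {b bE A mA mU leU c} => [[]//|k i].
  by rewrite exprS mulrA divfK// gt_eqF.
have leA i : (lam (A i) <= (2 * (t / h) * h ^+ n)%:E)%E.
  have lo : lam (rV_box c (set_coor (c + const_mx h) i (c ord0 i + t))) =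
      (t / h * h ^+ n)%:E.
    rewrite lebesgue_rV_box.
      by rewrite (vol i)// => j; rewrite !mxE; case: eqP => [->|_]; field.
    by move=> j; rewrite !mxE; case: eqP => [->|_]; lra.
  have hi : lam (rV_box (set_coor c i (c ord0 i + h - t)) (c + const_mx h)) =
      (t / h * h ^+ n)%:E.
    rewrite lebesgue_rV_box.
      by rewrite (vol i)// => j; rewrite !mxE; case: eqP => [->|_]; field.
    by move=> j; rewrite !mxE; case: eqP => [->|_]; lra.
  apply: le_trans (measureU2 _ (measurable_rV_box _ _) (measurable_rV_box _ _)) _.
  by rewrite [X in (X + _)%E]lo [X in (_ + X)%E]hi -EFinD lee_fin; lra.
have -> : grid_cell h x `&` boundary_layer h t =
    grid_cell h x `&` \bigcup_i A i.
  apply/seteqP; split => y [yx] yL; split => //; move: (yx); rewrite grid_cellE// => yb.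
    have [i yi] := yL; exists i => //; rewrite (grid_corner_const yx) !mxE in yi.
    case: yi => yi; [left|right] => j; have /andP[/= y1 y2] := yb j; rewrite !mxE in y1 y2 *.
      by case: eqP y1 y2 => [->|_] y1 y2; apply/andP; split => //; lra.
    by case: eqP y1 y2 => [->|_] y1 y2; apply/andP; split => //; lra.
  have [i _ yi] := yL; exists i; rewrite (grid_corner_const yx) -/c.
  by case: yi => yi; [left|right]; have := yi i; rewrite [set_coor _ _ _ _ _]mxE eqxx => /andP[].
have mI : measurable (grid_cell h x `&` \bigcup_i A i).
  by apply: measurableI => //; exact: measurable_grid_cell.
split => //; apply: (@le_trans _ _ (lam (\bigcup_i A i))).
  by apply: le_measure; rewrite ?inE//; exact: subIsetr.
apply: le_trans leU _; apply: le_trans (lee_sum _ (fun i _ => leA i)) _.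
by rewrite sumEFin sumr_const card_ord lee_fin -mulr_natl; lra.
Qed.

End grid.

(** * Kernels against mean-zero and cell-constant functions *)

(** Integrability is not assumed: Tonelli treats the positive and negative parts separately, and
    [fine] is measurable whatever value it gives to infinite integrals. *)
Lemma measurable_Rintegral_snd d1 d2 (T1 : measurableType d1)
    (T2 : measurableType d2) (R : realType)
    (m : {sigma_finite_measure set T2 -> \bar R}) (f : T1 * T2 -> R) :
  measurable_fun setT f ->
  measurable_fun setT (fun x => \int[m]_y f (x, y)).
Proof.
move=> mf; have mEf : measurable_fun setT (EFin \o f) by exact/measurable_EFinP.
have mp := @measurable_fun_fubini_tonelli_F _ _ _ _ _ m _
  (measurable_funepos mEf) (fun z => funepos_ge0 _ z).
have mn := @measurable_fun_fubini_tonelli_F _ _ _ _ _ m _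
  (measurable_funeneg mEf) (fun z => funeneg_ge0 _ z).
have mE : measurable_fun setT (fun x => \int[m]_y (f (x, y))%:E)%E.
  rewrite (_ : (fun _ => _) = fubini_F m (EFin \o f)^\+%E \- fubini_F m (EFin \o f)^\-%E)%E.
    exact: emeasurable_funB.
  by apply/funext => x; rewrite integralE; congr (_ - _)%E; apply: eq_integral => y _; rewrite ?funeposE ?funenegE.
exact: (measurableT_comp (fine_measurable measurableT) mE).
Qed.

Section kernel_estimates.
Variables (R : realType) (n : nat) (t : R) (w : 'rV[R]_n -> 'rV[R]_n -> R).
Local Notation lam := (lebesgue_rV R n).
Hypothesis t_gt0 : 0 < t.
Hypothesis w_measurable :
  measurable_fun setT (fun z : 'rV[R]_n * 'rV[R]_n => w z.1 z.2).
Hypothesis w_support : forall x y, w x y != 0 -> cube x (2 * t) y.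
Hypothesis w_size : forall x y, `|w x y| <= t ^- n.
Hypothesis w_lipschitz : forall (x y y' : 'rV[R]_n) (r : R),
  (forall i, `|y ord0 i - y' ord0 i| <= r) ->
  `|w x y - w x y'| <= r * (n%:R * t ^- n.+1).

Lemma cube_lty (x : 'rV[R]_n) r : 0 <= r -> (lam (cube x r) < +oo)%E.
Proof. by move=> r0; rewrite lebesgue_cube// ltry. Qed.

Lemma kernel_L2fun x : L2fun lam (w x).
Proof.
apply: (@L2fun_le _ _ _ _ _ (fun y => t ^- n * \1_(cube x (2 * t)) y)).
- exact: (measurableT_comp w_measurable (pair1_measurable x)).
- apply: L2funZ; apply: L2fun_indic; first exact: measurable_cube.
  by apply: cube_lty; rewrite mulr_ge0// ltW.
move=> y; rewrite normrM [`|t ^- n|]ger0_norm ?invr_ge0 ?exprn_ge0 ?(ltW t_gt0)//.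
have [->|/w_support xy] := eqVneq (w x y) 0.
  by rewrite normr0 mulr_ge0// invr_ge0 exprn_ge0// ltW.
by rewrite indicE mem_set// normr1 mulr1.
Qed.

Definition kernel_int (f : 'rV[R]_n -> R) (x : 'rV[R]_n) : R :=
  \int[lam]_y (w x y * f y).

Lemma measurable_kernel_int f : measurable_fun setT f ->
  measurable_fun setT (kernel_int f).
Proof.
move=> mf; apply: (@measurable_Rintegral_snd _ _ _ _ _ lam
  (fun z => w z.1 z.2 * f z.2)).
by apply: measurable_funM => //; exact: measurableT_comp.
Qed.

Lemma kernel_intD f g x : L2fun lam f -> L2fun lam g ->
  kernel_int (fun y => f y + g y) x = kernel_int f x + kernel_int g x.
Proof.
move=> Lf Lg; rewrite /kernel_int -RintegralD//; last 2 first.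
- exact: L2fun_mul (kernel_L2fun x) Lf.
- exact: L2fun_mul (kernel_L2fun x) Lg.
by apply: eq_Rintegral => y _; rewrite mulrDr.
Qed.

Section cells.
Variables (a : 'rV[R]_n) (h : R) (g : 'rV[R]_n -> R).
Hypothesis h_gt0 : 0 < h.
Hypothesis Lg : L2fun lam g.
Local Notation cell := (cell_of (grid_index a h)).

(* As g has mean zero on cells, w x may be replaced by its difference with its
   value at the corner of the cell, which is at most h / t times the size of w. *)
Lemma kernel_int_mean_zero : h <= 2 * t ->
  (forall x, \int[lam]_(y in cell x) g y = 0) ->
  (\int[lam]_x (kernel_int g x ^+ 2)%:E <=
   ((n%:R * 6 ^+ n * (h / t)) ^+ 2)%:E * \int[lam]_x (g x ^+ 2)%:E)%E.
Proof.
move=> ht g0.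
(* The Lipschitz bound at distance [h], the largest coordinate distance from a point to the corner
   of its cell. *)
pose k := h * (n%:R * t ^- n.+1).
have k0 : 0 <= k by rewrite !mulr_ge0 ?invr_ge0 ?exprn_ge0 ?(ltW t_gt0) ?(ltW h_gt0).
have -> : (n%:R * 6 ^+ n * (h / t)) ^+ 2 = k ^+ 2 * (6 * t) ^+ (2 * n).
  rewrite [(2 * n)%N]mulnC exprM -exprMn; congr (_ ^+ 2).
  rewrite /k exprMn exprS; field.
  by rewrite !gt_eqF// exprn_gt0.
apply: integral_sqr_le_cubes => //.
- by rewrite mulr_ge0// ltW.
- by apply: measurable_kernel_int; case: Lg.
move=> x; pose psi y := w x (grid_corner a h y).
have cell_near (y : 'rV[R]_n) i : `|y ord0 i - grid_corner a h y ord0 i| <= h.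
  have : cell y y by [].
  rewrite grid_cellE// => /(_ i) /andP[y1 y2]; rewrite !mxE in y1 y2 *.
  by rewrite ler_norml; apply/andP; split; lra.
(* Sidelength 6 t is sup-norm radius 3 t: the radius t of the support, plus the displacement
   [h <= 2 * t] to the corner. *)
have supp y : w x y - psi y != 0 -> cube x (6 * t) y.
  have tt := t_gt0; have hh := h_gt0.
  have [w0|/w_support xy _ i] := eqVneq (w x y) 0; last by apply: le_trans (xy i) _; lra.
  rewrite w0 sub0r oppr_eq0 => /w_support xy i.
  have := xy i; have := cell_near y i; rewrite !ler_norml => /andP[? ?] /andP[? ?].
  by apply/andP; split; lra.
have mdiff : measurable_fun setT psi.
  apply: (cell_constant_measurable (p := grid_index a h)).
    by move=> y; exact: measurable_grid_cell.
  by move=> y z yz; rewrite /psi (grid_corner_const yz).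
have psi_const y z : grid_index a h y = grid_index a h z -> psi y = psi z.
  by move=> yz; rewrite /psi (grid_corner_const yz).
have bound y : `|w x y - psi y| <= k * \1_(cube x (6 * t)) y.
  have [->|/supp xy] := eqVneq (w x y - psi y) 0; first by rewrite normr0 mulr_ge0.
  rewrite indicE mem_set// mulr1; apply: w_lipschitz => i; exact: cell_near.
have c6 : (lam (cube x (6 * t)) < +oo)%E by apply: cube_lty; rewrite mulr_ge0// ltW.
have Ld : L2fun lam (fun y => w x y - psi y).
  apply: (@L2fun_le _ _ _ _ _ (fun y => k * \1_(cube x (6 * t)) y)).
  - by apply: measurable_funB => //; case: (kernel_L2fun x).
  - by apply: L2funZ; apply: L2fun_indic => //; exact: measurable_cube.
  - by move=> y; rewrite [leRHS]ger0_norm// mulr_ge0.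
have Lpsi : L2fun lam psi.
  have := L2funB (kernel_L2fun x) Ld.
  by under eq_fun do rewrite opprB addrC subrK.
have -> : kernel_int g x = \int[lam]_y ((w x y - psi y) * g y).
  under [RHS]eq_Rintegral do rewrite mulrBl.
  rewrite RintegralB//; last 2 first.
  - exact: L2fun_mul (kernel_L2fun x) Lg.
  - exact: L2fun_mul Lpsi Lg.
  rewrite [X in _ - X](integral_cell_constant_mul (p := grid_index a h) (v := h ^+ n))//.
  - by rewrite subr0.
  - by move=> y; exact: measurable_grid_cell.
  - by move=> y; exact: lebesgue_grid_cell.
have iabs : lam.-integrable (cube x (6 * t)) (EFin \o (fun y => `|g y|)).
  by apply: integrable_norm; apply: L2fun_integrable => //; exact: measurable_cube.
apply: le_trans (le_normr_Rintegral measurableT (L2fun_mul Ld Lg)) _.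
rewrite -RintegralZl//; last exact: measurable_cube.
rewrite [leRHS]Rintegral_mkcond; apply: le_Rintegral => //.
- by apply: integrable_norm; exact: L2fun_mul Ld Lg.
- apply: eq_integrable ((integrable_mkcond _ (measurable_cube x (6 * t))).1
    (integrableZl (measurable_cube x (6 * t)) k iabs)) => //.
  by move=> y _; rewrite /= !patchE; case: ifP.
move=> y _; rewrite patchE normrM; have := bound y; rewrite indicE.
case: ifPn => _; first by rewrite mulr1 => /ler_wpM2r; apply.
by rewrite mulr0 => h0; apply: mulr_le0_ge0.
Qed.

(* The integrand w x y * (g y - g x) vanishes unless y lies in another cell than
   x, which puts x within t of the boundary of its cell. *)
Lemma kernel_int_cell_constant : t <= h ->
  (forall x y, grid_index a h x = grid_index a h y -> g x = g y) ->
  (\int[lam]_x ((kernel_int g x - (\int[lam]_y w x y) * g x) ^+ 2)%:E <=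
   (8 * n%:R * 4 ^+ n * (t / h))%:E * \int[lam]_x (g x ^+ 2)%:E)%E.
Proof.
move=> th cg.
have tt := t_gt0.
(* Besides locating the error, [D] is symmetric in its two points, so the contributions of g(x) and
   g(y) can be exchanged by [integral_sections_sym]. *)
pose D := [set z : 'rV[R]_n * 'rV[R]_n |
  cube z.1 (2 * t) z.2 /\ grid_index a h z.2 <> grid_index a h z.1].
have mcell x : measurable (cell x) by exact: measurable_grid_cell.
have mD : measurable D.
  have -> : D = [set z : 'rV[R]_n * 'rV[R]_n | cube z.1 (2 * t) z.2] `\`
      [set z : 'rV[R]_n * 'rV[R]_n | grid_index a h z.2 = grid_index a h z.1].
    by apply/seteqP; split.
  apply: measurableD; first exact: measurable_cube_rel.
  (* There are countably many indices, so the pairs lying in a common cell form a countable union of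
     measurable rectangles. *)
  have -> : [set z : 'rV[R]_n * 'rV[R]_n | grid_index a h z.2 = grid_index a h z.1] =
      \bigcup_k ([set x : 'rV[R]_n | pickle (grid_index a h x) = k] `*`
                 [set y : 'rV[R]_n | pickle (grid_index a h y) = k]).
    apply/seteqP; split => [[x y]/= xy|[x y] [k _ [/= <-]]].
      by exists (pickle (grid_index a h x)) => //; rewrite /= xy.
    by move/(pcan_inj (@pickleK _)).
  apply: bigcup_measurable => k _; apply: measurableX;
    by apply: (saturated_measurable (p := grid_index a h)) => // x y /= ->.
have sD x y : D (x, y) -> D (y, x).
  by move=> [/= /cube_sym xy ne]; split=> // /esym.
have xDc x : xsection D x `<=` cube x (2 * t).
  by move=> y /xsectionP[].
have mxD x : measurable (xsection D x) by exact: measurable_xsection.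
have t20 : 0 <= 2 * t by rewrite mulr_ge0// ltW.
have muD x : (lam (xsection D x) <= ((2 * t) ^+ n * \1_(boundary_layer a h t) x)%:E)%E.
  have [xB|xB] := pselect (boundary_layer a h t x).
    rewrite indicE mem_set// mulr1 -(lebesgue_cube x t20).
    by apply: le_measure; rewrite ?inE//; exact: measurable_cube.
  rewrite (_ : xsection D x = set0) ?measure0 ?lee_fin ?mulr_ge0 ?exprn_ge0//.
  apply/seteqP; split => // y /xsectionP[/= xy ne]; apply: xB.
  exact: boundary_layerP xy ne.
have Doo x : (lam (xsection D x) < +oo)%E.
  by apply: le_lt_trans (muD x) _; rewrite ltry.
have Dle x : (lam (xsection D x) <= ((2 * t) ^+ n)%:E)%E.
  apply: le_trans (muD x) _; rewrite lee_fin; apply: ler_piMr; first exact: exprn_ge0.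
  by rewrite indicE lern1 leq_b1.
have mg : measurable_fun setT g by case: Lg.
have mg2 : measurable_fun setT (fun x => (g x ^+ 2)%:E).
  by apply/measurable_EFinP/measurable_funX.
have g20 x : (0 <= (g x ^+ 2)%:E)%E by rewrite lee_fin sqr_ge0.
pose S x := kernel_int g x - (\int[lam]_y w x y) * g x.
have mS : measurable_fun setT S.
  apply: measurable_funB; first exact: measurable_kernel_int.
  apply: measurable_funM => //.
  exact: (measurable_Rintegral_snd lam w_measurable).
have tn0 : 0 <= t ^- n by rewrite invr_ge0 exprn_ge0// ltW.
have wint x : lam.-integrable setT (EFin \o w x).
  have := L2fun_mul (kernel_L2fun x) (L2fun_indic (measurable_cube x (2 * t)) (cube_lty x t20)).
  apply: eq_integrable => // y _; rewrite /= indicE.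
  have [->|/w_support xy] := eqVneq (w x y) 0; first by rewrite mul0r.
  by rewrite mem_set// mulr1.
have Sx x : ((S x ^+ 2)%:E <= (t ^- n ^+ 2)%:E * (lam (xsection D x) *
    (2%:E * (g x ^+ 2)%:E * lam (xsection D x) + 2%:E * \int[lam]_(y in xsection D x) (g y ^+ 2)%:E)))%E.
  (* Subtracting the constant [g x] on the section only keeps [f] square-integrable over the whole
     space. *)
  pose f y := g y - g x * \1_(xsection D x) y.
  have Lf : L2fun lam f.
    apply: (L2funB Lg); apply: L2funZ; exact: (L2fun_indic (mxD x) (Doo x)).
  have -> : S x = \int[lam]_(y in xsection D x) (w x y * f y).
    rewrite /S /kernel_int mulrC -RintegralZl// -RintegralB//; last 2 first.
    - exact: L2fun_mul (kernel_L2fun x) Lg.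
    - exact: (integrableZl measurableT (g x) (wint x)).
    rewrite [RHS]Rintegral_mkcond; apply: eq_Rintegral => y _; rewrite patchE /f indicE.
    case: (boolP (y \in xsection D x)) => yD /=; first by ring.
    have [->|/w_support xy] := eqVneq (w x y) 0; first by rewrite mulr0 mul0r subrr.
    rewrite (cg y x); first by rewrite mulrC subrr.
    apply: contrapT => ne; move/negP: yD; apply; rewrite inE; apply/xsectionP; split => //.
  have iwf : lam.-integrable (xsection D x) (EFin \o (fun y => w x y * f y)).
    exact: integrableS (L2fun_mul (kernel_L2fun x) Lf).
  have iaf : lam.-integrable (xsection D x) (EFin \o (fun y => `|f y|)).
    apply: integrable_norm; exact: (L2fun_integrable (mxD x) (Doo x) Lf).
  have h1 : `|\int[lam]_(y in xsection D x) (w x y * f y)| <=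
      t ^- n * \int[lam]_(y in xsection D x) `|f y|.
    apply: le_trans (le_normr_Rintegral (mxD x) iwf) _.
    rewrite -RintegralZl//; apply: le_Rintegral => //.
    - exact: (integrable_norm iwf).
    - exact: (integrableZl (mxD x) (t ^- n) iaf).
    by move=> y _; rewrite normrM ler_wpM2r.
  apply: (@le_trans _ _ ((t ^- n ^+ 2)%:E * ((\int[lam]_(y in xsection D x) `|f y|) ^+ 2)%:E)%E).
    rewrite -EFinM lee_fin -exprMn -[leLHS]real_normK ?num_real// ler_sqr ?nnegrE//.
    by rewrite mulr_ge0//; exact: Rintegral_ge0.
  rewrite lee_wpmul2l ?lee_fin ?exprn_ge0//.
  apply: le_trans (cauchy_schwarz_set (mxD x) (Doo x) Lf) _.
  rewrite lee_wpmul2l//.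
  have -> : (2%:E * (g x ^+ 2)%:E * lam (xsection D x) + 2%:E * \int[lam]_(y in xsection D x) (g y ^+ 2)%:E
      = \int[lam]_(y in xsection D x) (2%:E * (g x ^+ 2)%:E + 2%:E * (g y ^+ 2)%:E))%E.
    have c2 : (0 <= 2%:E * (g x ^+ 2)%:E)%E by rewrite -EFinM lee_fin mulr_ge0// sqr_ge0.
    rewrite ge0_integralD//; last 2 first.
    - by move=> y _; rewrite -EFinM lee_fin mulr_ge0// sqr_ge0.
    - by apply: measurable_funeM; exact: measurable_funTS.
    congr (_ + _)%E; first by rewrite (integral_cst lam (mxD x) (2%:E * (g x ^+ 2)%:E)%E).
    by rewrite ge0_integralZl//; exact: measurable_funTS.
  apply: ge0_le_integral => //.
  - by move=> y _; rewrite lee_fin sqr_ge0.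
  - by apply/measurable_EFinP/measurable_funX/measurable_funTS; case: Lf.
  - apply: emeasurable_funD => //.
    by apply: measurable_funeM; exact: measurable_funTS.
  move=> y yD; rewrite -!EFinM -EFinD lee_fin /f indicE mem_set// mulr1.
  by have := sqr_ge0 (g y + g x); nra.
have mlD : measurable_fun setT (fun x => lam (xsection D x)).
  exact: measurable_fun_xsection.
have mI := measurable_integral_xsection lam mD mg2 g20.
(* Since (g y - g x)^2 <= 2 (g y)^2 + 2 (g x)^2, the double integral splits into two terms, and by
   the symmetry of [D] both equal 2 [A]. *)
pose A := (\int[lam]_x ((g x ^+ 2)%:E * lam (xsection D x)))%E.
have gD0 x : (0 <= (g x ^+ 2)%:E * lam (xsection D x))%E by rewrite mule_ge0.
have mgD : measurable_fun setT (fun x => (g x ^+ 2)%:E * lam (xsection D x))%E.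
  exact: emeasurable_funM.
have SA : (\int[lam]_x (S x ^+ 2)%:E <= (4 * (t ^- n ^+ 2 * (2 * t) ^+ n))%:E * A)%E.
  have -> : ((4 * (t ^- n ^+ 2 * (2 * t) ^+ n))%:E * A =
      \int[lam]_x ((t ^- n ^+ 2 * (2 * t) ^+ n)%:E *
       (2%:E * ((g x ^+ 2)%:E * lam (xsection D x)) +
        2%:E * \int[lam]_(y in xsection D x) (g y ^+ 2)%:E)))%E.
    rewrite ge0_integralZl ?lee_fin ?mulr_ge0 ?exprn_ge0//; last 2 first.
    - by apply: emeasurable_funD; exact: measurable_funeM.
    - by move=> x _; rewrite adde_ge0// mule_ge0//; exact: integral_ge0.
    rewrite ge0_integralD//; last 4 first.
    - by move=> x _; rewrite mule_ge0.
    - exact: measurable_funeM.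
    - by move=> x _; rewrite mule_ge0//; exact: integral_ge0.
    - exact: measurable_funeM.
    rewrite !ge0_integralZl//; last by move=> x _; exact: integral_ge0.
    rewrite integral_sections_sym// -/A -ge0_muleDl ?lee_fin// -EFinD muleA -EFinM.
    by congr (_%:E * _)%E; ring.
  apply: ge0_le_integral => //.
  - by move=> x _; rewrite lee_fin sqr_ge0.
  - exact/measurable_EFinP/measurable_funX.
  - by apply: measurable_funeM; apply: emeasurable_funD; exact: measurable_funeM.
  move=> x _; apply: le_trans (Sx x) _.
  rewrite [(t ^- n ^+ 2 * (2 * t) ^+ n)%:E]EFinM -[leRHS]muleA lee_wpmul2l ?lee_fin ?exprn_ge0//.
  rewrite -[(2%:E * _ * _)%E]muleA lee_wpmul2r//.
  by rewrite adde_ge0// !mule_ge0//; exact: integral_ge0.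
have c0 : 0 <= (2 * t) ^+ n * (2 * n%:R * (t / h)).
  by rewrite !mulr_ge0 ?exprn_ge0 ?invr_ge0// ltW.
(* On a cell [g] is constant and [lam (xsection D x)] is at most (2 t)^n on the boundary layer and 0
   elsewhere, so only the volume of the layer enters. *)
have AB : (A <= ((2 * t) ^+ n * (2 * n%:R * (t / h)))%:E * \int[lam]_x (g x ^+ 2)%:E)%E.
  rewrite -ge0_integralZl//.
  apply: (ge0_le_integral_saturated (p := grid_index a h)) => //.
  - exact: measurable_funeM.
  - by move=> x; rewrite mule_ge0.
  move=> x _; have [mL leL] := measure_boundary_layer a x h_gt0 (ltW t_gt0) th.
  set L := _ `&` _ in mL leL.
  apply: (@le_trans _ _ (\int[lam]_(y in cell x) ((g x ^+ 2 * (2 * t) ^+ n)%:E * (\1_L y)%:E)))%E.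
    apply: ge0_le_integral => //.
    - exact: measurable_funTS.
    - by apply: measurable_funeM; apply/measurable_EFinP; exact: measurable_indic.
    move=> y yx; rewrite (cg y x)// [(g x ^+ 2 * _)%:E]EFinM -muleA lee_wpmul2l//.
    apply: le_trans (muD y) _; rewrite -EFinM lee_fin; apply: ler_wpM2l; first exact: exprn_ge0.
    rewrite !indicE; have [yB|yB] := boolP (y \in boundary_layer a h t); last by rewrite ler0n.
    by rewrite mem_set//; split => //; rewrite inE in yB.
  have cc : (0 <= (g x ^+ 2 * (2 * t) ^+ n)%:E)%E.
    by rewrite lee_fin mulr_ge0 ?sqr_ge0 ?exprn_ge0.
  have m1 : measurable_fun (cell x) (fun y => (\1_L y)%:E : \bar R).
    by apply/measurable_EFinP; exact: measurable_indic.
  have l0 y : cell x y -> (0 <= (\1_L y)%:E :> \bar R)%E by rewrite lee_fin.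
  rewrite [leLHS]ge0_integralZl//.
  rewrite integral_indic// setIidl; last exact: subIsetl.
  apply: (@le_trans _ _ ((g x ^+ 2 * (2 * t) ^+ n)%:E * (2 * n%:R * (t / h) * h ^+ n)%:E)%E).
    exact: (lee_wpmul2l cc leL).
  rewrite (eq_integral (cst ((2 * t) ^+ n * (2 * n%:R * (t / h)) * g x ^+ 2)%:E)); last first.
    by move=> y; rewrite inE => yx; rewrite (cg y x)// -EFinM.
  rewrite integral_cst// [X in (_ <= _ * X)%E](lebesgue_grid_cell a x h_gt0) -!EFinM lee_fin le_eqVlt; apply/orP; left.
  by apply/eqP; ring.
apply: le_trans SA _.
apply: (@le_trans _ _ ((4 * (t ^- n ^+ 2 * (2 * t) ^+ n))%:E *
  (((2 * t) ^+ n * (2 * n%:R * (t / h)))%:E * \int[lam]_x (g x ^+ 2)%:E))%E).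
  by rewrite lee_wpmul2l// lee_fin !mulr_ge0 ?exprn_ge0.
rewrite muleA -EFinM (_ : 4 * _ * _ = 8 * n%:R * 4 ^+ n * (t / h))//.
rewrite exprMn (_ : 4 ^+ n = 2 ^+ n * 2 ^+ n); last by rewrite -exprMn; congr (_ ^+ _); ring.
by field; rewrite !gt_eqF ?exprn_gt0.
Qed.

End cells.
End kernel_estimates.

(** * The dyadic square function *)

(* The distance |i - k|, as one of the two truncated differences vanishes. *)
Definition dist_nat (i k : nat) : nat := ((i - k) + (k - i))%N.

Lemma sum_geometric_dist_le (R : realType) (q : R) (m k : nat) : 0 <= q -> q < 1 ->
  (1 - q) * (\sum_(i < m) q ^+ dist_nat i k) <= 2.
Proof.
move=> q0 q1.
(* Sharpened for the induction on [m]: up to [i = k] the terms increase and the last one governs the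
   sum; beyond it they decrease, and the tail not yet summed is subtracted from 2. *)
suff : (1 - q) * (\sum_(i < m) q ^+ dist_nat i k) <=
    if (m <= k.+1)%N then q ^+ (k.+1 - m) else 2 - q ^+ (m - k).
  move=> /le_trans; apply; case: ifP => _.
    by apply: (@le_trans _ _ 1); [apply: exprn_ile1 => //; exact: ltW|lra].
  by rewrite gerBl exprn_ge0.
elim: m => [|m IHm]; first by rewrite big_ord0 mulr0 exprn_ge0.
rewrite big_ord_recr/= mulrDr; move: IHm; rewrite /dist_nat.
have [mk|km] := leqP m k.
  rewrite (leqW mk) ltnS mk (_ : (m - k = 0)%N) ?add0n; last by apply/eqP; rewrite subn_eq0.
  rewrite subSS (subSn mk) exprS => IH.
  by apply: le_trans (lerD IH (lexx _)) _; rewrite le_eqVlt; apply/orP; left; apply/eqP; ring.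
rewrite ltnS [(m <= k)%N]leqNgt km /= (_ : (k - m = 0)%N) ?addn0; last first.
  by apply/eqP; rewrite subn_eq0 ltnW.
rewrite (subSn (ltnW km)) exprS.
have [mk1|mk1] := leqP m k.+1.
  have -> : m = k.+1 by apply/eqP; rewrite eqn_leq mk1.
  by rewrite subnn expr0 subSnn expr1 => IH; nra.
move=> IH; apply: le_trans (lerD IH (lexx _)) _.
by rewrite le_eqVlt; apply/orP; left; apply/eqP; ring.
Qed.

(** Cauchy-Schwarz with weights, again by positivity of a quadratic, here the sum of the (b i - u s
    i)^2 / s i. *)
Lemma sqr_sum_le_weighted (R : realType) (m : nat) (b s : 'I_m -> R) :
  (forall i, 0 < s i) ->
  (\sum_i b i) ^+ 2 <= (\sum_i s i) * (\sum_i b i ^+ 2 / s i).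
Proof.
move=> s0; set S := \sum_i b i; set W := \sum_i s i; set Q := \sum_i _ / _.
have W0 : 0 <= W by apply: sumr_ge0 => i _; exact: ltW.
have key u : 0 <= Q - 2 * u * S + u ^+ 2 * W.
  rewrite /Q /S /W !mulr_sumr -sumrB -big_split/=; apply: sumr_ge0 => i _.
  rewrite (_ : _ + _ = (b i - u * s i) ^+ 2 / s i).
    by rewrite divr_ge0 ?sqr_ge0// ltW.
  by field; rewrite gt_eqF.
have [W00|Wn0] := eqVneq W 0.
  have S0 : S = 0.
    rewrite /S big1// => i _.
    have : s i <= W by rewrite /W (bigD1 i)//= lerDl sumr_ge0// => j _; exact: ltW.
    by rewrite W00 leNgt s0.
  by rewrite S0 W00 mul0r expr0n.
have Wp : 0 < W by rewrite lt_neqAle eq_sym Wn0.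
have := key (S / W).
rewrite (_ : Q - _ + _ = (W * Q - S ^+ 2) / W); last by field.
by rewrite pmulr_lge0 ?invr_gt0// subr_ge0.
Qed.

(** Telescoping phrased without subtraction, so that it applies to integrals with values in the
    extended reals. *)
Lemma sum_of_increments (V : nmodType) (A B : nat -> V) F N :
  A 0 = B 0 -> (forall m, (m < N)%N -> B m.+1 = B m + A m.+1) ->
  F = B N + A N.+1 -> \sum_(i < N.+2) A i = F.
Proof.
move=> P0 P ->; rewrite big_ord_recr/=; congr (_ + _).
have : (N <= N)%N by [].
elim: {-2}N => [_|m IHm mN]; first by rewrite big_ord_recr/= big_ord0 add0r P0.
by rewrite big_ord_recr/= IHm ?(ltnW mN)// -P.
Qed.

Section square_function.
Variables (R : realType) (n : nat).
Local Notation lam := (lebesgue_rV R n).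

(* cube x (2 * t) is the closed sup-norm ball of radius t about x, and the factor
   n%:R bounds an increment of sup-norm r by n partial derivatives. *)
Record is_kernel (t : R) (w : 'rV[R]_n -> 'rV[R]_n -> R) : Prop := IsKernel {
  kernel_gt0 : 0 < t ;
  kernel_measurable :
    measurable_fun setT (fun z : 'rV[R]_n * 'rV[R]_n => w z.1 z.2) ;
  kernel_support : forall x y, w x y != 0 -> cube x (2 * t) y ;
  kernel_size : forall x y, `|w x y| <= t ^- n ;
  kernel_lipschitz : forall (x y y' : 'rV[R]_n) (r : R),
    (forall i, `|y ord0 i - y' ord0 i| <= r) ->
    `|w x y - w x y'| <= r * (n%:R * t ^- n.+1) }.

Variables (a : 'rV[R]_n) (l : R).
Hypothesis l_gt0 : 0 < l.

Definition scale (k : nat) : R := l / 2 ^+ k.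
Definition dyadic_index (k : nat) := @grid_index R n a (scale k).
Definition dyadic_average (k : nat) := average lam (dyadic_index k) (scale k ^+ n).
Local Notation cell k := (cell_of (dyadic_index k)).
Local Notation E := dyadic_average.

Lemma scale_gt0 k : 0 < scale k.
Proof. by rewrite divr_gt0// exprn_gt0. Qed.

Lemma scaleD k m : scale k = 2 ^+ m * scale (k + m).
Proof. by rewrite /scale exprD; field; rewrite !expf_neq0. Qed.

Lemma scale_le k m : (k <= m)%N -> scale m <= scale k.
Proof.
move=> km; rewrite -(subnKC km) [leRHS](scaleD k (m - k)).
by rewrite ler_peMl ?exprn_ege1 ?ler1n// ltW// scale_gt0.
Qed.

Lemma measurable_dyadic_cell k x : measurable (cell k x).
Proof. by apply: measurable_grid_cell; exact: scale_gt0. Qed.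

Lemma lebesgue_dyadic_cell k x : lam (cell k x) = (scale k ^+ n)%:E.
Proof. by apply: lebesgue_grid_cell; exact: scale_gt0. Qed.

Lemma dyadic_refine k m x y : (k <= m)%N ->
  dyadic_index m x = dyadic_index m y -> dyadic_index k x = dyadic_index k y.
Proof.
move=> km; rewrite /dyadic_index (_ : scale k = (2 ^ (m - k))%:R * scale m).
  by apply: grid_index_coarsen; rewrite ?expn_gt0// scale_gt0.
by rewrite (scaleD k (m - k)) subnKC// natrX.
Qed.

Lemma scale_n_gt0 k : 0 < scale k ^+ n.
Proof. by rewrite exprn_gt0// scale_gt0. Qed.

Local Notation mcell := (measurable_dyadic_cell).
Local Notation vcell := (lebesgue_dyadic_cell).

Lemma L2fun_dyadic_average k f : L2fun lam f -> L2fun lam (E k f).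
Proof. exact: (L2fun_average (scale_n_gt0 k) (mcell k) (vcell k)). Qed.

Lemma dyadic_average_constant k f x y :
  dyadic_index k x = dyadic_index k y -> E k f x = E k f y.
Proof. exact: average_constant. Qed.

Lemma dyadic_average_sub k f x : L2fun lam f ->
  \int[lam]_(y in cell k x) (f y - E k f y) = 0.
Proof. exact: (integral_sub_average (scale_n_gt0 k) (mcell k) (vcell k)). Qed.

Lemma dyadic_average_coarse_eq0 k m g x : (k <= m)%N -> L2fun lam g ->
  (forall x, \int[lam]_(y in cell m x) g y = 0) -> E k g x = 0.
Proof.
move=> km Lg g0.
apply: (average_coarse_eq0 (mcell m) (vcell m) (vcell k) _ _ Lg g0) => y z.
exact: dyadic_refine.
Qed.

Lemma dyadic_average_tower k m f x : (k <= m)%N -> L2fun lam f ->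
  E k (E m f) x = E k f x.
Proof.
move=> km Lf; have LE := L2fun_dyadic_average m Lf.
have H : E k (fun y => f y - E m f y) x = 0.
  apply: (dyadic_average_coarse_eq0 _ km (L2funB Lf LE)) => y.
  exact: dyadic_average_sub.
move: H; rewrite /dyadic_average (averageB (mcell k) (vcell k))// => /eqP.
by rewrite subr_eq0 => /eqP ->.
Qed.

Section pieces.
Variables (N : nat) (f : 'rV[R]_n -> R).
Hypothesis Lf : L2fun lam f.

(* Martingale decomposition of f: E_0 f, the differences E_(j+1) f - E_j f for
   j < N, and the remainder f - E_N f. *)
Definition piece (i : nat) : 'rV[R]_n -> R :=
  if i is j.+1 then fun x => (if (j < N)%N then E j.+1 f else f) x - E j f x
  else E 0 f.

Lemma L2fun_piece i : L2fun lam (piece i).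
Proof.
case: i => [|j]; first exact: L2fun_dyadic_average.
rewrite /piece; case: ifP => _; apply: L2funB => //; exact: L2fun_dyadic_average.
Qed.

Lemma sum_piece x : \sum_(i < N.+2) piece i x = f x.
Proof.
have H m : (m <= N)%N -> \sum_(i < m.+1) piece i x = E m f x.
  elim: m => [_|m IHm mN]; first by rewrite big_ord_recr/= big_ord0 add0r.
  by rewrite big_ord_recr/= IHm ?(ltnW mN)// mN addrC subrK.
by rewrite big_ord_recr/= H// ltnn addrC subrK.
Qed.

Lemma piece_mean_zero j x : (j <= N)%N ->
  \int[lam]_(y in cell j x) piece j.+1 y = 0.
Proof.
move=> jN; rewrite /piece; case: ifP => _; last exact: dyadic_average_sub.
have LE := L2fun_dyadic_average j.+1 Lf.
rewrite -[RHS](dyadic_average_sub j x LE).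
by apply: eq_Rintegral => y _; rewrite dyadic_average_tower.
Qed.

Lemma piece_constant i x y : (i <= N)%N ->
  dyadic_index i x = dyadic_index i y -> piece i x = piece i y.
Proof.
case: i => [_|j jN] xy; first exact: dyadic_average_constant.
rewrite /piece jN (dyadic_average_constant _ xy); congr (_ - _).
by apply: dyadic_average_constant; exact: dyadic_refine xy.
Qed.

(** Pythagoras at each refinement: by the tower property the coarse average of E_(m+1) f is E_m f,
    and the identities telescope. *)
Lemma sum_sqr_piece :
  (\sum_(i < N.+2) \int[lam]_x (piece i x ^+ 2)%:E = \int[lam]_x (f x ^+ 2)%:E)%E.
Proof.
apply: (@sum_of_increments _ (fun i => \int[lam]_x (piece i x ^+ 2)%:E)%E
  (fun m => \int[lam]_x (E m f x ^+ 2)%:E)%E) => [//|m mN|].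
  have LE := L2fun_dyadic_average m.+1 Lf.
  rewrite (integral_sqr_average (scale_n_gt0 m) (mcell m) (vcell m) LE) /piece mN.
  by apply: (f_equal2 adde); apply: eq_integral => x _;
    rewrite -[average _ _ _ _ x]/(E m _ x) dyadic_average_tower.
by rewrite (integral_sqr_average (scale_n_gt0 N) (mcell N) (vcell N) Lf) /piece ltnn.
Qed.

End pieces.

Section kernel_piece.
Variables (N k : nat) (f : 'rV[R]_n -> R) (t : R) (w : 'rV[R]_n -> 'rV[R]_n -> R).
Hypothesis Lf : L2fun lam f.
Hypothesis kN : (k <= N)%N.
Hypothesis t_scale : scale k.+1 < t <= scale k.
Hypothesis kw : is_kernel t w.

(** The error U_t g - gamma_t E_k g of replacing the operator by multiplication with its symbol. *)
Definition kernel_defect (g : 'rV[R]_n -> R) (x : 'rV[R]_n) : R :=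
  kernel_int w g x - (\int[lam]_y w x y) * E k g x.

Lemma measurable_kernel_defect g : L2fun lam g ->
  measurable_fun setT (kernel_defect g).
Proof.
move=> Lg; apply: measurable_funB.
  by apply: measurable_kernel_int; [exact: kernel_measurable kw|case: Lg].
apply: measurable_funM; last by case: (L2fun_dyadic_average k Lg).
exact: (measurable_Rintegral_snd lam (kernel_measurable kw)).
Qed.

Lemma kernel_defectD g1 g2 x : L2fun lam g1 -> L2fun lam g2 ->
  kernel_defect (fun y => g1 y + g2 y) x = kernel_defect g1 x + kernel_defect g2 x.
Proof.
move=> L1 L2; rewrite /kernel_defect.
rewrite (kernel_intD (kernel_gt0 kw) (kernel_measurable kw) (kernel_support kw)
  (kernel_size kw))//.
rewrite {1}/dyadic_average (averageD (mcell k) (vcell k))//.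
by rewrite /dyadic_average; ring.
Qed.

Lemma L2fun_sum_pieces m : L2fun lam (fun y => \sum_(i < m) piece N f i y).
Proof.
elim: m => [|m IHm].
  under eq_fun do rewrite big_ord0.
  split => //; under eq_integral do rewrite expr0n.
  by rewrite integral0 ltry.
under eq_fun do rewrite big_ord_recr/=.
by apply: L2funD => //; exact: L2fun_piece.
Qed.

Lemma kernel_defect_sum x :
  kernel_defect f x = \sum_(i < N.+2) kernel_defect (piece N f i) x.
Proof.
suff H m : kernel_defect (fun y => \sum_(i < m) piece N f i y) x =
    \sum_(i < m) kernel_defect (piece N f i) x.
  by rewrite -H; congr kernel_defect; apply/funext => y; rewrite sum_piece.
elim: m => [|m IHm].
  rewrite big_ord0 (_ : (fun y => _) = fun=> 0); last first.
    by apply/funext => y; rewrite big_ord0.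
  rewrite /kernel_defect /kernel_int /dyadic_average /average.
  under eq_Rintegral do rewrite mulr0.
  by rewrite !Rintegral_cst ?mul0r ?mulr0 ?subr0//; exact: mcell.
rewrite big_ord_recr/= -IHm -kernel_defectD.
- by congr kernel_defect; apply/funext => y; rewrite big_ord_recr.
- exact: L2fun_sum_pieces.
- exact: L2fun_piece.
Qed.

(** One constant for both kernel estimates; the factors 16 leave room for the comparison of [t] with
    [scale k] and for the shift of index in the mean-zero pieces. *)
Definition piece_const : R := 16 * (n%:R * 6 ^+ n) ^+ 2 + 16 * n%:R * 4 ^+ n.

(** For [i <= k] the average E_k fixes the piece, so the defect is the one of
    [kernel_int_cell_constant]; for [i > k] it annihilates the piece, and [kernel_int_mean_zero]
    bounds what remains. *)
Lemma kernel_defect_piece i : (i < N.+2)%N ->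
  (\int[lam]_x (kernel_defect (piece N f i) x ^+ 2)%:E <=
   (piece_const * (1 / 2) ^+ dist_nat i k)%:E * \int[lam]_x (piece N f i x ^+ 2)%:E)%E.
Proof.
move=> iN; have t0 := kernel_gt0 kw; have /andP[t1 t2] := t_scale.
have Lp := L2fun_piece N Lf i.
have int0 : (0 <= \int[lam]_x (piece N f i x ^+ 2)%:E)%E.
  by apply: integral_ge0 => x _; rewrite lee_fin sqr_ge0.
have nn0 : 0 <= (n%:R * 6 ^+ n : R) ^+ 2 by exact: sqr_ge0.
have n40 : 0 <= n%:R * 4 ^+ n :> R by rewrite mulr_ge0// exprn_ge0.
have [ik|ki] := leqP i k.
  have ci : forall x y, dyadic_index i x = dyadic_index i y -> piece N f i x = piece N f i y.
    by move=> x y; apply: piece_constant; exact: leq_trans ik kN.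
  have th : t <= scale i by apply: le_trans t2 _; exact: scale_le.
  have := kernel_int_cell_constant t0 (kernel_measurable kw) (kernel_support kw)
    (kernel_size kw) (scale_gt0 i) Lp th ci.
  have -> : (\int[lam]_x ((kernel_int w (piece N f i) x -
      (\int[lam]_y w x y) * piece N f i x) ^+ 2)%:E)%E =
      (\int[lam]_x (kernel_defect (piece N f i) x ^+ 2)%:E)%E.
    apply: eq_integral => x _; rewrite /kernel_defect.
    rewrite [E k _ x](average_cell_constant (scale_n_gt0 k) (mcell k) (vcell k))// => y z yz.
    by apply: ci; exact: dyadic_refine yz.
  move=> /le_trans; apply; apply: lee_wpmul2r => //.
  rewrite lee_fin; have -> : dist_nat i k = (k - i)%N.
    by rewrite /dist_nat (eqP ik) add0n.
  have ti : t / scale i <= (1 / 2) ^+ (k - i).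
    rewrite ler_pdivrMr ?scale_gt0//; apply: le_trans t2 _.
    rewrite [scale i](scaleD i (k - i)) subnKC// mulrA -exprMn.
    by rewrite (_ : 1 / 2 * 2 = 1) ?expr1n ?mul1r//; field.
  rewrite /piece_const; set r := _ ^+ (k - i) in ti *.
  apply: (@le_trans _ _ (8 * n%:R * 4 ^+ n * r)).
    by rewrite ler_wpM2l// -mulrA mulr_ge0.
  have r0 : 0 <= r by rewrite exprn_ge0.
  by rewrite ler_wpM2r//; lra.
case: i iN Lp int0 ki => // j jN Lp int0; rewrite ltnS => kj.
have mz x : \int[lam]_(y in cell j x) piece N f j.+1 y = 0 by exact: piece_mean_zero.
have jk : scale j <= scale k by exact: scale_le.
have t2k : scale k <= 2 * t.
  by have := scaleD k 1; rewrite addn1 expr1 => ->; lra.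
have := kernel_int_mean_zero t0 (kernel_measurable kw) (kernel_support kw)
  (kernel_size kw) (kernel_lipschitz kw) (scale_gt0 j) Lp (le_trans jk t2k) mz.
have -> : (\int[lam]_x (kernel_int w (piece N f j.+1) x ^+ 2)%:E)%E =
    (\int[lam]_x (kernel_defect (piece N f j.+1) x ^+ 2)%:E)%E.
  apply: eq_integral => x _; rewrite /kernel_defect.
  by rewrite (dyadic_average_coarse_eq0 x kj Lp mz) mulr0 subr0.
move=> /le_trans; apply; apply: lee_wpmul2r => //.
(* The piece of index [j.+1] has mean zero on cells of scale [j], so the decay available is one step
   short of the distance; the constant pays for it. *)
rewrite lee_fin; have -> : dist_nat j.+1 k = (j - k).+1.
  by rewrite /dist_nat subSn// (_ : (k - j.+1 = 0)%N) ?addn0//; apply/eqP; rewrite subn_eq0 (leq_trans kj).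
pose r : R := (1 / 2) ^+ (j - k).
have r0 : 0 <= r by rewrite exprn_ge0.
have r1 : r <= 1 by rewrite exprn_ile1//; lra.
have tj : scale j / t <= 2 * r.
  rewrite ler_pdivrMr//; apply: (@le_trans _ _ (scale k * r)).
    rewrite (scaleD k (j - k)) subnKC// mulrC mulrA -exprMn.
    by rewrite (_ : 1 / 2 * 2 = 1) ?expr1n ?mul1r//; field.
  by rewrite mulrC [2 * r]mulrC -mulrA ler_wpM2l.
rewrite exprMn (_ : _ ^+ (j - k).+1 = r / 2); last by rewrite exprS /r; field.
have st0 : 0 <= scale j / t by rewrite divr_ge0// ltW// scale_gt0.
have sq : (scale j / t) ^+ 2 <= 4 * r.
  apply: (@le_trans _ _ ((2 * r) ^+ 2)); first by rewrite ler_sqr ?nnegrE// mulr_ge0.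
  by nra.
apply: (@le_trans _ _ ((n%:R * 6 ^+ n) ^+ 2 * (4 * r))); first by rewrite ler_wpM2l.
by rewrite /piece_const; have := mulr_ge0 nn0 r0; have := mulr_ge0 n40 r0; nra.
Qed.

End kernel_piece.

(** The bounds [B] are chosen before [t] and [w], so they are uniform over a band and serve the real
    and the imaginary part of the kernel at once. *)
Lemma dyadic_square_function (N : nat) (f : 'rV[R]_n -> R) : L2fun lam f ->
  exists B : nat -> R, [/\ forall k, 0 <= B k,
    \sum_(k < N) B k <= 48 * piece_const * fine (\int[lam]_x (f x ^+ 2)%:E) &
    forall k t w, (k <= N)%N -> scale k.+1 < t <= scale k -> is_kernel t w ->
      (\int[lam]_x (kernel_defect k w f x ^+ 2)%:E <= (B k)%:E)%E].
Proof.
move=> Lf.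
pose G i := fine (\int[lam]_x (piece N f i x ^+ 2)%:E).
have GE i : (\int[lam]_x (piece N f i x ^+ 2)%:E)%E = (G i)%:E.
  rewrite fineK// ge0_fin_numE; first exact: (L2fun_piece N Lf i).2.
  by apply: integral_ge0 => x _; rewrite lee_fin sqr_ge0.
have G0 i : 0 <= G i.
  by apply: fine_ge0; apply: integral_ge0 => x _; rewrite lee_fin sqr_ge0.
have c0 : 0 <= piece_const.
  by rewrite /piece_const addr_ge0 ?mulr_ge0 ?sqr_ge0 ?exprn_ge0.
(* 8 = 2 / (1 - 3/4) bounds the total of the weights [s] used below; the powers of 2/3 sum over [k]
   to at most 6 = 2 / (1 - 2/3), whence 48 = 8 * 6. *)
exists (fun k => \sum_(i < N.+2) 8 * piece_const * (2 / 3) ^+ dist_nat i k * G i); split.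
- by move=> k; apply: sumr_ge0 => i _; rewrite !mulr_ge0// exprn_ge0.
- rewrite exchange_big/= (_ : fine _ = \sum_(i < N.+2) G i); last first.
    by rewrite -(sum_sqr_piece N Lf) (eq_bigr (fun i : 'I_N.+2 => (G i)%:E)) ?sumEFin.
  rewrite mulr_sumr; apply: ler_sum => i _; rewrite -mulr_suml ler_wpM2r//.
  rewrite -mulr_sumr (eq_bigr (fun k : 'I_N => (2 / 3) ^+ dist_nat k i)); last first.
    by move=> k _; rewrite /dist_nat addnC.
  have q0 : 0 <= 2 / 3 :> R by lra.
  have q1 : 2 / 3 < 1 :> R by lra.
  have := sum_geometric_dist_le N i q0 q1.
  by set Z := \sum_(_ < _) _ => hZ; nra.
move=> k t w kN tk kw.
have Lp i := L2fun_piece N Lf i.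
have md i := measurable_kernel_defect k kw (Lp i).
have md2 i (r : R) : measurable_fun setT
    (fun x => r%:E * (kernel_defect k w (piece N f i) x ^+ 2)%:E)%E.
  by apply: measurable_funeM; apply/measurable_EFinP/measurable_funX.
(* Cauchy-Schwarz with weights s i: 1/2 = (2/3) * (3/4) splits the decay between
   the sum over i, taken here, and the sum over k. *)
pose s i : R := (3 / 4) ^+ dist_nat i k.
have s0 i : 0 < s i by rewrite exprn_gt0//; lra.
apply: (@le_trans _ _ (\int[lam]_x (\sum_(i < N.+2) (8 / s i)%:E *
    (kernel_defect k w (piece N f i) x ^+ 2)%:E))%E).
  apply: ge0_le_integral => //.
  - by move=> x _; rewrite lee_fin sqr_ge0.
  - by apply/measurable_EFinP/measurable_funX; exact: (measurable_kernel_defect k kw Lf).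
  - by apply: emeasurable_sum => i; exact: md2.
  move=> x _; rewrite (kernel_defect_sum N k Lf kw).
  rewrite (eq_bigr (fun i : 'I_N.+2 =>
    ((8 / s i) * kernel_defect k w (piece N f i) x ^+ 2)%:E)) ?sumEFin ?lee_fin//.
  apply: le_trans (sqr_sum_le_weighted _ (fun i : 'I_N.+2 => s0 i)) _.
  rewrite [leRHS](eq_bigr (fun i : 'I_N.+2 => 8 * (kernel_defect k w (piece N f i) x ^+ 2 / s i))); last first.
    by move=> i _; rewrite mulrAC mulrA.
  rewrite -mulr_sumr ler_wpM2r//.
    by apply: sumr_ge0 => i _; rewrite divr_ge0 ?sqr_ge0// ltW.
  have q0 : 0 <= 3 / 4 :> R by lra.
  have q1 : 3 / 4 < 1 :> R by lra.
  have := sum_geometric_dist_le N.+2 k q0 q1.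
  by rewrite /s; set Z := \sum_(_ < _) _ => hZ; lra.
rewrite ge0_integral_sum//; last first.
  by move=> i x _; rewrite -EFinM lee_fin mulr_ge0 ?sqr_ge0// divr_ge0// ltW.
rewrite -sumEFin; apply: lee_sum => i _.
rewrite ge0_integralZl//; last 3 first.
- by apply/measurable_EFinP/measurable_funX.
- by move=> x _; rewrite lee_fin sqr_ge0.
- by rewrite lee_fin divr_ge0// ltW.
have := kernel_defect_piece Lf kN tk kw (ltn_ord i); rewrite GE -EFinM => h.
apply: (@le_trans _ _ ((8 / s i)%:E * (piece_const * (1 / 2) ^+ dist_nat i k * G i)%:E)%E).
  by apply: lee_wpmul2l => //; rewrite lee_fin divr_ge0// ltW.
rewrite -EFinM lee_fin le_eqVlt; apply/orP; left; apply/eqP.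
rewrite (_ : 2 / 3 = (1 / 2) * (3 / 4)^-1); last by field.
rewrite [(1 / 2 / (3 / 4)) ^+ _]expr_div_n -/(s i); move: ((1 / 2) ^+ _) => u; field.
by rewrite gt_eqF.
Qed.

End square_function.

(** * The stopping-time step *)

Section fubini_domains.
Context d1 d2 (T1 : measurableType d1) (T2 : measurableType d2) (R : realType).
Variables (m1 : {sigma_finite_measure set T1 -> \bar R})
          (m2 : {sigma_finite_measure set T2 -> \bar R}).
Variables (F : T1 * T2 -> \bar R) (D1 : set T1) (D2 : set T2).
Hypothesis mF : measurable_fun setT F.
Hypothesis F0 : forall x y, D2 y -> (0 <= F (x, y))%E.
Hypothesis mD1 : measurable D1.
Hypothesis mD2 : measurable D2.

(** Positivity is required over [D2] only, because the densities carry the factor 1 / t, negative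
    for t < 0; restricting [F] brings Tonelli back. *)
Lemma measurable_integral_domain :
  measurable_fun setT (fun x => \int[m2]_(y in D2) F (x, y))%E.
Proof.
have := measurable_fun_fubini_tonelli_F (m2 := m2) (F \_ (setT `*` D2)).
rewrite /fubini_F; under [X in _ -> _ -> measurable_fun _ X]eq_fun => x.
  rewrite (_ : (\int[m2]_y _)%E = (\int[m2]_(y in D2) F (x, y))%E); first by over.
  rewrite [RHS]integral_mkcond; apply: eq_integral => y _.
  rewrite !patchE (_ : ((x, y) \in setT `*` D2) = (y \in D2))//.
  by apply/idP/idP; rewrite !inE//= => -[].
apply.
- by apply/(measurable_restrictT _ (measurableX measurableT mD2)); exact: measurable_funTS.
- by move=> [x y]; rewrite patchE; case: ifPn => //; rewrite inE => -[_ /F0].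
Qed.

Lemma fubini_tonelli_domains :
  (\int[m1]_(x in D1) \int[m2]_(y in D2) F (x, y) =
   \int[m2]_(y in D2) \int[m1]_(x in D1) F (x, y))%E.
Proof.
pose f := F \_ (D1 `*` D2).
have mf : measurable_fun setT f.
  by apply/(measurable_restrictT _ (measurableX mD1 mD2)); exact: measurable_funTS.
have f0 z : (0 <= f z)%E.
  by case: z => x y; rewrite /f patchE; case: ifPn => //; rewrite inE => -[_ /F0].
have := fubini_tonelli (m1 := m1) (m2 := m2) f mf f0.
have fE x y : f (x, y) = if x \in D1 then if y \in D2 then F (x, y) else 0%E else 0%E.
  rewrite /f patchE (_ : ((x, y) \in D1 `*` D2) = (x \in D1) && (y \in D2)).
    by case: (x \in D1); case: (y \in D2).
  by apply/idP/andP; rewrite !inE.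
move=> H.
transitivity (\int[m1]_x \int[m2]_y f (x, y))%E.
  rewrite [LHS]integral_mkcond; apply: eq_integral => x _; rewrite patchE.
  case: (boolP (x \in D1)) => xD; last first.
    by rewrite (eq_integral (cst 0%E)) ?integral0// => y _; rewrite fE (negbTE xD).
  rewrite integral_mkcond; apply: eq_integral => y _.
  by rewrite patchE fE xD.
rewrite H [RHS]integral_mkcond; apply: eq_integral => y _; rewrite patchE.
case: (boolP (y \in D2)) => yD; last first.
  by rewrite (eq_integral (cst 0%E)) ?integral0// => x _; rewrite fE (negbTE yD); case: ifP.
rewrite [RHS]integral_mkcond; apply: eq_integral => x _.
by rewrite patchE fE yD.
Qed.

End fubini_domains.

Lemma measurable_invr (R : realType) : measurable_fun [set: R] (@GRing.inv R).
Proof.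
rewrite -(setvU [set 0 : R]); apply/measurable_funU => //.
  exact: measurableC.
split; last exact: measurable_fun_set1.
apply: open_continuous_measurable_fun; first by apply: closed_openC; exact: closed_eq.
by move=> x; rewrite inE/= => /eqP x0; exact: inv_continuous.
Qed.

Lemma lee_trans_regroup (R : realDomainType) (T S k I B k' I' : \bar R) :
  (T <= S + (k + I))%E -> (I <= B + (k' + I'))%E ->
  (T <= (S + B) + ((k + k') + I'))%E.
Proof.
move=> /le_trans h /leeD2l-/(_ (S + k)%E); rewrite addeA => h'; apply: h.
by rewrite addeA (le_trans h')// (addeAC S k B) -!addeA.
Qed.

Lemma scale0 (R : realType) (l : R) : scale l 0 = l.
Proof. by rewrite /scale expr0 divr1. Qed.

Lemma sum_bands (R : realType) (l : R) (m : nat) (f : R -> \bar R) :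
  0 < l -> measurable_fun setT f -> (forall t, 0 < t -> (0 <= f t)%E) ->
  (\sum_(j < m) \int[@lebesgue_measure R]_(t in `]scale l j.+1, scale l j]) f t =
   \int[@lebesgue_measure R]_(t in `]scale l m, l]) f t)%E.
Proof.
move=> l0 mf f0; elim: m => [|m IHm].
  by rewrite big_ord0 scale0 set_itvoc0 integral_set0.
rewrite big_ord_recr/= IHm addeC.
have sl : scale l m <= l by rewrite -[leRHS]scale0; exact: scale_le.
have sm : scale l m.+1 <= scale l m by exact: scale_le.
have sE : `]scale l m.+1, l]%classic =
    `]scale l m.+1, scale l m]%classic `|` `]scale l m, l]%classic.
  by rewrite -(@itv_bndbnd_setU _ _ (BRight _) (BRight (scale l m)) (BRight l)) ?bnd_simp.
rewrite sE ge0_integral_setU//.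
- exact: measurable_funTS.
- move=> t; rewrite -sE/= in_itv/= => /andP[+ _]; move=> /(lt_trans (scale_gt0 l0 _)).
  exact: f0.
- apply/disj_setPS => t/= []; rewrite !in_itv/= => /andP[_ ts] /andP[st _].
  by move: st; rewrite ltNge ts.
Qed.

(* With gamma = gu + i gv and B = P + i S, the hypothesis gives |B| > 1/2, hence
   |gamma|^2 <= 4 |gamma B|^2 with gamma B = U b - (U b - gamma B). *)
Lemma symbol_sqr_algebra (R : realFieldType) (e1 e2 P S gu gv up uq vp vq : R) :
  e1 ^+ 2 + e2 ^+ 2 = 1 -> 1 / 2 < e1 * P + e2 * S ->
  gu ^+ 2 + gv ^+ 2 <=
  8 * ((up - vq) ^+ 2 + (uq + vp) ^+ 2) +
  16 * ((up - gu * P) ^+ 2 + (vq - gv * S) ^+ 2 +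
        ((uq - gu * S) ^+ 2 + (vp - gv * P) ^+ 2)).
Proof.
move=> e_unit h.
have PS : 1 / 4 <= P ^+ 2 + S ^+ 2.
  have h1 : (e1 * P + e2 * S) ^+ 2 <= P ^+ 2 + S ^+ 2.
    rewrite -[leRHS]mul1r -e_unit.
    rewrite [leRHS](_ : _ = (e1 * P + e2 * S) ^+ 2 + (e1 * S - e2 * P) ^+ 2); last by ring.
    by rewrite lerDl sqr_ge0.
  by move: h h1; set z := e1 * P + _ => h h1; nra.
have g0 : 0 <= gu ^+ 2 + gv ^+ 2 by rewrite addr_ge0// sqr_ge0.
have h2 : gu ^+ 2 + gv ^+ 2 <= 4 * ((gu ^+ 2 + gv ^+ 2) * (P ^+ 2 + S ^+ 2)).
  by move: g0; set z := gu ^+ 2 + _ => g0; nra.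
apply: le_trans h2 _.
rewrite (_ : (gu ^+ 2 + gv ^+ 2) * _ = (gu * P - gv * S) ^+ 2 + (gu * S + gv * P) ^+ 2); last by ring.
(* Multiplied by the 4 of [h2], the coefficients 2 and 4 become the 8 and 16 of the conclusion. *)
have key (X c c' : R) : (X - c + c') ^+ 2 <= 2 * X ^+ 2 + 4 * c ^+ 2 + 4 * c' ^+ 2.
  by have := sqr_ge0 (X + c - c'); have := sqr_ge0 (c + c'); nra.
have k1 := key (up - vq) (up - gu * P) (vq - gv * S).
have k2 := key (uq + vp) (uq - gu * S) (- (vp - gv * P)).
rewrite (_ : up - vq - _ + _ = gu * P - gv * S) in k1; last by ring.
rewrite (_ : uq + vp - _ + _ = gu * S + gv * P) in k2; last by ring.
rewrite sqrrN in k2; lra.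
Qed.

Section local_tb.
Variables (R : realType) (n : nat).
Variables (u v : R -> 'rV[R]_n -> 'rV[R]_n -> R).
Local Notation lam := (lebesgue_rV R n).
Local Notation leb := (@lebesgue_measure R).
Hypothesis u_measurable : measurable_fun setT
  (fun z : R * ('rV[R]_n * 'rV[R]_n) => u z.1 z.2.1 z.2.2).
Hypothesis v_measurable : measurable_fun setT
  (fun z : R * ('rV[R]_n * 'rV[R]_n) => v z.1 z.2.1 z.2.2).
Hypothesis u_kernel : forall t, 0 < t -> is_kernel t (u t).
Hypothesis v_kernel : forall t, 0 < t -> is_kernel t (v t).

(* With U_t = u t + i v t, these are |U_t 1|^2 and |U_t (p + i q)|^2. *)
Definition symbol_sqr (x : 'rV[R]_n) (t : R) : R :=
  (\int[lam]_y u t x y) ^+ 2 + (\int[lam]_y v t x y) ^+ 2.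

Definition image_sqr (p q : 'rV[R]_n -> R) (x : 'rV[R]_n) (t : R) : R :=
  (kernel_int (u t) p x - kernel_int (v t) q x) ^+ 2 +
  (kernel_int (u t) q x + kernel_int (v t) p x) ^+ 2.

Definition band (l : R) (j : nat) : set R := `]scale l j.+1, scale l j].

Definition band_energy (l : R) (j : nat) (x : 'rV[R]_n) : \bar R :=
  (\int[leb]_(t in band l j) (symbol_sqr x t / t)%:E)%E.

Lemma measurable_kernel_int_joint (w : R -> 'rV[R]_n -> 'rV[R]_n -> R) f :
  measurable_fun setT (fun z : R * ('rV[R]_n * 'rV[R]_n) => w z.1 z.2.1 z.2.2) ->
  measurable_fun setT f ->
  measurable_fun setT (fun z : 'rV[R]_n * R => kernel_int (w z.2) f z.1).
Proof.
move=> mw mf.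
apply: (@measurable_Rintegral_snd _ _ _ _ _ lam
  (fun z : ('rV[R]_n * R) * 'rV[R]_n => w z.1.2 z.1.1 z.2 * f z.2)).
apply: measurable_funM; last exact: measurableT_comp.
apply: (measurableT_comp mw (g := fun z : ('rV[R]_n * R) * 'rV[R]_n => (z.1.2, (z.1.1, z.2)))).
apply: measurable_fun_pair; first exact: measurableT_comp.
by apply: measurable_fun_pair => //; exact: measurableT_comp.
Qed.

Lemma measurable_symbol_joint (w : R -> 'rV[R]_n -> 'rV[R]_n -> R) :
  measurable_fun setT (fun z : R * ('rV[R]_n * 'rV[R]_n) => w z.1 z.2.1 z.2.2) ->
  measurable_fun setT (fun z : 'rV[R]_n * R => \int[lam]_y w z.2 z.1 y).
Proof.
move=> mw; have := measurable_kernel_int_joint mw (f := fun=> 1) (measurable_cst _).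
rewrite /kernel_int; apply: eq_measurable_fun => z _.
by apply: eq_Rintegral => y _; rewrite mulr1.
Qed.

Lemma measurable_inv_snd : measurable_fun setT (fun z : 'rV[R]_n * R => z.2^-1).
Proof. exact: (measurableT_comp (@measurable_invr R) measurable_snd). Qed.

Lemma measurable_symbol_sqr :
  measurable_fun setT (fun z : 'rV[R]_n * R => (symbol_sqr z.1 z.2 / z.2)%:E).
Proof.
apply/measurable_EFinP; apply: measurable_funM; last exact: measurable_inv_snd.
by apply: measurable_funD; apply: measurable_funX; exact: measurable_symbol_joint.
Qed.

Lemma measurable_image_sqr p q : measurable_fun setT p -> measurable_fun setT q ->
  measurable_fun setT (fun z : 'rV[R]_n * R => (image_sqr p q z.1 z.2 / z.2)%:E).
Proof.
move=> mp mq.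
apply/measurable_EFinP; apply: measurable_funM; last exact: measurable_inv_snd.
by apply: measurable_funD; apply: measurable_funX;
  [apply: measurable_funB|apply: measurable_funD]; exact: measurable_kernel_int_joint.
Qed.

Lemma band_gt0 l j t : 0 < l -> band l j t -> 0 < t.
Proof.
move=> l0; rewrite /band/= in_itv/= => /andP[+ _]; apply: lt_trans.
exact: scale_gt0.
Qed.

Lemma measurable_band l j : measurable (band l j).
Proof. exact: measurable_itv. Qed.

Lemma symbol_sqr_ge0 x t : 0 <= symbol_sqr x t.
Proof. by rewrite addr_ge0// sqr_ge0. Qed.

Lemma image_sqr_ge0 p q x t : 0 <= image_sqr p q x t.
Proof. by rewrite addr_ge0// sqr_ge0. Qed.

Lemma band_energy_ge0 l j x : 0 < l -> (0 <= band_energy l j x)%E.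
Proof.
move=> l0; apply: integral_ge0 => t /(band_gt0 l0) t0.
by rewrite lee_fin divr_ge0 ?symbol_sqr_ge0// ltW.
Qed.

Section one_cell.
Variables (C l : R) (a x0 : 'rV[R]_n) (p q : 'rV[R]_n -> R) (e1 e2 : R) (N : nat) (K : R).
Hypothesis C_gt0 : 0 < C.
Hypothesis l_gt0 : 0 < l.
Hypothesis Lp : L2fun lam p.
Hypothesis Lq : L2fun lam q.
Hypothesis e_unit : e1 ^+ 2 + e2 ^+ 2 = 1.
Hypothesis K_ge0 : 0 <= K.
Local Notation idx := (dyadic_index a l).
Local Notation E := (dyadic_average a l).
Local Notation Q := (cell_of (idx 0) x0).
Local Notation mcell := (measurable_dyadic_cell a l_gt0).
Local Notation vcell := (lebesgue_dyadic_cell a l_gt0).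

(* The real part of conj e * b, for e = e1 + i e2 and b = p + i q. *)
Let r x := e1 * p x + e2 * q x.

Let Lr : L2fun lam r. Proof. by apply: L2funD; exact: L2funZ. Qed.

Hypothesis pq_norm : fine (\int[lam]_x (p x ^+ 2)%:E) + fine (\int[lam]_x (q x ^+ 2)%:E)
  <= C * l ^+ n.
Hypothesis r_mean : l ^+ n <= \int[lam]_(x in Q) r x.
Hypothesis image_bound :
  (\int[lam]_(x in Q) \int[leb]_(t in `]0%R, l]) (image_sqr p q x t / t)%:E
     <= (C * l ^+ n)%:E)%E.

(** The part of Q covered by no stopped cell of scale [m] or coarser. *)
Definition good (m : nat) : set 'rV[R]_n :=
  [set x | Q x /\ forall i, (i <= m)%N -> 1 / 2 < E i r x].

Definition tail (m : nat) (x : 'rV[R]_n) : \bar R :=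
  (\sum_(m <= j < N) band_energy l j x)%E.

(* The induction hypothesis on the number of scales. *)
Hypothesis finer_cells : forall m x, (m < N)%N ->
  (\int[lam]_(y in cell_of (idx m.+1) x) tail m.+1 y <= (K * scale l m.+1 ^+ n)%:E)%E.

Lemma good_saturated m x y : idx m x = idx m y -> good m x -> good m y.
Proof.
move=> xy [Qx gx]; split=> [|i im].
  by rewrite /cell_of/= -(dyadic_refine l_gt0 (leq0n m) xy).
by rewrite -(dyadic_average_constant _ (dyadic_refine l_gt0 im xy)) gx.
Qed.

Lemma measurable_good m : measurable (good m).
Proof. exact: (saturated_measurable (mcell m) (@good_saturated m)). Qed.

Lemma good_sub m : good m `<=` Q. Proof. by move=> x []. Qed.

Lemma goodS m : good m.+1 `<=` good m.
Proof. by move=> x [Qx gx]; split=> // i im; apply: gx; exact: leqW. Qed.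

(** The union of the cells that stop at scale [m.+1], not at scale [m]. *)
Let bad m := good m `\` good m.+1.

Let mbad m : measurable (bad m).
Proof. by apply: measurableD; exact: measurable_good. Qed.

Let bad_saturated m x y : idx m.+1 x = idx m.+1 y -> bad m x -> bad m y.
Proof.
move=> xy [gx ngx]; split.
  by apply: good_saturated gx; exact: (dyadic_refine l_gt0 (leqnSn m)).
by apply: contra_not ngx; apply: good_saturated.
Qed.

Let mQ : measurable Q. Proof. exact: mcell. Qed.
Let Qvol : lam Q = (l ^+ n)%:E.
Proof. by rewrite vcell scale0. Qed.
Let subQ_oo A : measurable A -> A `<=` Q -> (lam A < +oo)%E.
Proof.
move=> mA AQ; apply: le_lt_trans (_ : (lam A <= lam Q)%E) _.
  by apply: le_measure; rewrite ?inE.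
by rewrite Qvol ltry.
Qed.

Let alpha m := fine (lam (good m)).
Let beta m := fine (lam (bad m)).

Let alphaE m : lam (good m) = (alpha m)%:E.
Proof.
rewrite fineK// ge0_fin_numE//; apply: subQ_oo; first exact: measurable_good.
exact: good_sub.
Qed.

Let betaE m : lam (bad m) = (beta m)%:E.
Proof.
rewrite fineK// ge0_fin_numE//; apply: subQ_oo; first exact: mbad.
by move=> x [/good_sub].
Qed.

Let good_split m : good m = good m.+1 `|` bad m.
Proof. by rewrite setDUK//; exact: goodS. Qed.

Let good_disj m : good m.+1 `&` bad m = set0.
Proof. by rewrite /bad setDE setICA setICr setI0. Qed.

Let alphaS m : alpha m = alpha m.+1 + beta m.
Proof.
have : lam (good m) = (lam (good m.+1) + lam (bad m))%E.
  by rewrite {1}good_split measureU//; exact: measurable_good.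
by rewrite !alphaE betaE -EFinD => -[->].
Qed.

Let beta_ge0 m : 0 <= beta m. Proof. exact: fine_ge0. Qed.
Let alpha_ge0 m : 0 <= alpha m. Proof. exact: fine_ge0. Qed.

Let average_r0 x : Q x -> 1 <= E 0 r x.
Proof.
move=> Qx; rewrite /dyadic_average /average scale0 ler_pdivlMr ?exprn_gt0// mul1r.
by rewrite (_ : cell_of _ x = Q)// /cell_of (Qx : idx 0 x = idx 0 x0).
Qed.

Let good0 : good 0 = Q.
Proof.
apply/seteqP; split=> x; first exact: good_sub.
move=> Qx; split=> // i; rewrite leqn0 => /eqP ->.
by have := average_r0 Qx; lra.
Qed.

Let sum_beta m : \sum_(j < m) beta j + alpha m = l ^+ n.
Proof.
elim: m => [|m <-]; last by rewrite big_ord_recr/= (alphaS m); ring.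
by rewrite big_ord0 add0r /alpha good0 Qvol.
Qed.

Let rho m := \int[lam]_(x in good m) r x.

Let int_r A : measurable A -> A `<=` Q -> lam.-integrable A (EFin \o r).
Proof. by move=> mA AQ; apply: L2fun_integrable => //; exact: subQ_oo. Qed.

(** [bad m] is a union of cells of scale [m.+1], so [r] may be replaced by its average at that
    scale, which is at most 1/2 there by the stopping rule. *)
Let bad_mean m : \int[lam]_(x in bad m) r x <= 1 / 2 * beta m.
Proof.
have bQ : bad m `<=` Q by move=> x [/good_sub].
have boo := subQ_oo (mbad m) bQ.
have LE := L2fun_dyadic_average a l_gt0 m.+1 Lr.
have iE : lam.-integrable (bad m) (EFin \o E m.+1 r) by exact: L2fun_integrable.
have -> : \int[lam]_(x in bad m) r x = \int[lam]_(x in bad m) E m.+1 r x.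
  apply/eqP; rewrite -subr_eq0 -RintegralB//; last exact: int_r.
  rewrite Rintegral_mkcond; apply/eqP.
  rewrite -[RHS](integral_cell_constant_mul (mcell m.+1) (vcell m.+1)
    (psi := \1_(bad m)) (g := fun x => r x - E m.+1 r x)).
  - by apply: eq_Rintegral => x _; rewrite patchE indicE; case: ifP; rewrite ?mul1r ?mul0r.
  - exact: L2fun_indic.
  - exact: L2funB.
  - move=> x y xy; rewrite !indicE; congr (nat_of_bool _)%:R.
    by apply/idP/idP; rewrite !inE; apply: bad_saturated.
  - by move=> x; exact: dyadic_average_sub.
rewrite -[leRHS](Rintegral_cst lam (mbad m)).
apply: le_Rintegral => //; first exact: integrable_cst_set.
move=> x [[Qx gx] ngx]; rewrite leNgt; apply/negP => h; apply: ngx; split=> // i.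
by rewrite leq_eqVlt => /orP[/eqP -> //|]; rewrite ltnS; exact: gx.
Qed.

Let rho_step m : rho m <= 1 / 2 * beta m + rho m.+1.
Proof.
rewrite /rho {1}good_split Rintegral_setU//.
- by rewrite addrC lerD2r bad_mean.
- exact: measurable_good.
- by rewrite -good_split; apply: int_r; [exact: measurable_good|exact: good_sub].
- by apply/disj_setPS; rewrite good_disj.
Qed.

Let rho_sum m : rho 0 <= 1 / 2 * \sum_(j < m) beta j + rho m.
Proof.
elim: m => [|m IHm]; first by rewrite big_ord0 mulr0 add0r.
by rewrite big_ord_recr/=; have := rho_step m; lra.
Qed.

Let r_sqr_le x : r x ^+ 2 <= p x ^+ 2 + q x ^+ 2.
Proof.
rewrite -[leRHS]mul1r -e_unit.
rewrite (_ : _ * _ = r x ^+ 2 + (e1 * q x - e2 * p x) ^+ 2); last by rewrite /r; ring.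
by rewrite lerDl sqr_ge0.
Qed.

Let int_sqr f : L2fun lam f -> lam.-integrable setT (EFin \o (fun x => f x ^+ 2)).
Proof. exact: L2fun_sqr. Qed.

(* AM-GM: r <= r^2 / (4 C) + C. *)
Let rho_le m : rho m <= l ^+ n / 4 + C * alpha m.
Proof.
have mg := measurable_good m.
have goo := subQ_oo mg (@good_sub m).
have isq : lam.-integrable (good m) (EFin \o (fun x => r x ^+ 2)).
  by apply: integrableS (int_sqr Lr).
have isq4 : lam.-integrable (good m) (EFin \o (fun x => (4 * C)^-1 * r x ^+ 2)).
  exact: (integrableZl mg (4 * C)^-1 isq).
have icst := integrable_cst_set C mg goo.
apply: (@le_trans _ _ (\int[lam]_(x in good m) ((4 * C)^-1 * r x ^+ 2 + C))).
  apply: le_Rintegral => //.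
  - by apply: int_r => //; exact: good_sub.
  - exact: (integrableD mg isq4 icst).
  move=> x _; have C0 := C_gt0.
  rewrite -(ler_pM2l (_ : 0 < 4 * C)) ?mulr_gt0//.
  rewrite [leRHS](_ : _ = r x ^+ 2 + 4 * C * C); last by field; rewrite gt_eqF.
  by have := sqr_ge0 (r x - 2 * C); nra.
rewrite RintegralD// RintegralZl// (Rintegral_cst lam mg) -/(alpha m) lerD2r.
rewrite mulrC ler_pdivrMr; last by rewrite mulr_gt0.
rewrite (_ : _ / 4 * _ = C * l ^+ n); last by field.
apply: le_trans pq_norm.
apply: (@le_trans _ _ (\int[lam]_x (p x ^+ 2 + q x ^+ 2))); last first.
  by rewrite RintegralD//; exact: int_sqr.
rewrite Rintegral_mkcond; apply: le_Rintegral => //.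
- apply: eq_integrable ((integrable_mkcond _ mg).1 isq) => // x _.
  by rewrite /= !patchE; case: ifP.
- exact: (integrableD measurableT (int_sqr Lp) (int_sqr Lq)).
move=> x _; rewrite patchE; case: ifP => _; first exact: r_sqr_le.
by rewrite addr_ge0// sqr_ge0.
Qed.

Let sum_beta_le : \sum_(j < N) beta j <= (1 - (4 * C)^-1) * l ^+ n.
Proof.
have h1 := sum_beta N; have h2 := rho_sum N; have h3 := rho_le N.
have h4 : l ^+ n <= rho 0 by rewrite /rho good0.
have b0 : 0 <= \sum_(j < N) beta j by apply: sumr_ge0.
have C0 := C_gt0; have C40 : 0 < 4 * C by lra.
have a0 := alpha_ge0 N.
rewrite -(ler_pM2l C40) mulrA mulrBr divff ?gt_eqF// mulr1.
move: h1 h2 h3 h4 a0; move: (rho 0) (rho N) (alpha N) (\sum_(_ < _) _) (l ^+ n) b0.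
move=> r0 rN al S L S0 h1 h2 h3 h4 a0; have -> : S = L - al by rewrite -h1 addrK.
(* With S = L - al, the chain L <= rho 0 <= S / 2 + L / 4 + C al leaves at least the fraction 1 / (4
   C) of Q unstopped. *)
have : L / 4 <= C * al by lra.
lra.
Qed.

Let mband j : measurable_fun setT (band_energy l j).
Proof.
apply: (measurable_integral_domain leb measurable_symbol_sqr) => [x t|].
  by move=> /(band_gt0 l_gt0)/ltW t0; rewrite lee_fin divr_ge0// symbol_sqr_ge0.
exact: measurable_band.
Qed.

Let band0 j x : (0 <= band_energy l j x)%E.
Proof. exact: band_energy_ge0. Qed.

Let tail_ge0 m x : (0 <= tail m x)%E.
Proof. by apply: sume_ge0 => j _. Qed.

Let mtail m : measurable_fun setT (tail m).
Proof. by apply: emeasurable_sum. Qed.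

Let tailE m x : (m < N)%N -> tail m x = (band_energy l m x + tail m.+1 x)%E.
Proof. by move=> mN; rewrite /tail big_ltn. Qed.

(** Once a cell has stopped, all its finer scales are charged to the induction hypothesis, at the
    price of [K] times its volume; elsewhere one more band is split off. *)
Let tail_step m : (m < N)%N ->
  (\int[lam]_(x in good m) tail m x <= \int[lam]_(x in good m) band_energy l m x +
     ((K * beta m)%:E + \int[lam]_(x in good m.+1) tail m.+1 x))%E.
Proof.
move=> mN; have mg := measurable_good m.
under eq_integral do rewrite tailE//.
rewrite ge0_integralD//; do ?exact: measurable_funTS.
apply: leeD => //; rewrite {1}good_split ge0_integral_setU//; last 3 first.
- exact: measurable_good.
- exact: measurable_funTS.
- by apply/disj_setPS; rewrite good_disj.
rewrite addeC; apply: leeD => //.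
apply: (@le_trans _ _ (\int[lam]_(x in bad m) cst K%:E x)%E); last first.
  by rewrite (integral_cst lam (mbad m)) [X in (_ * X <= _)%E]betaE.
apply: (ge0_le_integral_saturated (mcell m.+1) (B := bad m) (f := tail m.+1) (g := cst K%:E)) => //.
- exact: bad_saturated.
- move=> x _; apply: le_trans (finer_cells _ mN) _.
  by rewrite (integral_cst lam (mcell m.+1 x)) [X in (_ <= _ * X)%E]vcell.
Qed.

Let tail_sum m : (m <= N)%N ->
  (\int[lam]_(x in Q) tail 0 x <=
   \sum_(j < m) \int[lam]_(x in good j) band_energy l j x +
     ((K * \sum_(j < m) beta j)%:E + \int[lam]_(x in good m) tail m x))%E.
Proof.
elim: m => [_|m IHm mN]; first by rewrite !big_ord0 mulr0 !add0e good0.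
rewrite !big_ord_recr/= mulrDr EFinD.
exact: lee_trans_regroup (IHm (ltnW mN)) (tail_step mN).
Qed.

Let defects j (x : 'rV[R]_n) (t : R) : R :=
  kernel_defect a l j (u t) p x ^+ 2 + kernel_defect a l j (v t) q x ^+ 2 +
  (kernel_defect a l j (u t) q x ^+ 2 + kernel_defect a l j (v t) p x ^+ 2).

Let defects_ge0 j x t : 0 <= defects j x t.
Proof. by rewrite !addr_ge0// sqr_ge0. Qed.

Let symbol_sqr_le j x t : 1 / 2 < E j r x ->
  symbol_sqr x t <= 8 * image_sqr p q x t + 16 * defects j x t.
Proof.
have -> : E j r x = e1 * E j p x + e2 * E j q x.
  rewrite /r /dyadic_average (averageD (mcell j) (vcell j)); do ?exact: L2funZ.
  by rewrite !(averageZ (mcell j) (vcell j)).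
rewrite /symbol_sqr /image_sqr /defects /kernel_defect.
move: (E j p x) (E j q x) (\int[lam]_y u t x y) (\int[lam]_y v t x y)
  (kernel_int (u t) p x) (kernel_int (u t) q x) (kernel_int (v t) p x) (kernel_int (v t) q x).
move=> P S gu gv up uq vp vq h.
exact: symbol_sqr_algebra h.
Qed.

Let mdefects j : measurable_fun setT
  (fun z : 'rV[R]_n * R => (defects j z.1 z.2 / z.2)%:E).
Proof.
have mp : measurable_fun setT p by case: Lp.
have mq : measurable_fun setT q by case: Lq.
have md w f : measurable_fun setT (fun z : R * ('rV[R]_n * 'rV[R]_n) => w z.1 z.2.1 z.2.2) ->
    L2fun lam f -> measurable_fun setT
    (fun z : 'rV[R]_n * R => kernel_defect a l j (w z.2) f z.1).
  move=> mw Lf; apply: measurable_funB.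
    by apply: measurable_kernel_int_joint => //; case: Lf.
  apply: measurable_funM; first exact: measurable_symbol_joint.
  by apply: measurableT_comp => //; case: (L2fun_dyadic_average a l_gt0 j Lf).
apply/measurable_EFinP; apply: measurable_funM; last exact: measurable_inv_snd.
by apply: measurable_funD; apply: measurable_funD; apply: measurable_funX; exact: md.
Qed.

(** In the defect term [good j] is enlarged to the whole space and t is moved outside by Tonelli,
    since [dyadic_square_function] bounds the defects at a fixed t over all x. *)
Let good_energy_le j :
  (\int[lam]_(x in good j) band_energy l j x <=
   8%:E * (\int[lam]_(x in Q) \int[leb]_(t in band l j) (image_sqr p q x t / t)%:E) +
   16%:E * (\int[leb]_(t in band l j) \int[lam]_x (defects j x t / t)%:E))%E.
Proof.
have mg := measurable_good j.
have mp : measurable_fun setT p by case: Lp.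
have mq : measurable_fun setT q by case: Lq.
have mb := measurable_band l j.
have i0 x t : band l j t -> (0 <= (image_sqr p q x t / t)%:E)%E.
  by move=> /(band_gt0 l_gt0)/ltW t0; rewrite lee_fin divr_ge0// image_sqr_ge0.
have d0 x t : band l j t -> (0 <= (defects j x t / t)%:E)%E.
  by move=> /(band_gt0 l_gt0)/ltW t0; rewrite lee_fin divr_ge0.
have mi := measurable_image_sqr mp mq.
have mI := measurable_integral_domain leb mi i0 mb.
have mD := measurable_integral_domain leb (mdefects j) d0 mb.
have I0 x : (0 <= \int[leb]_(t in band l j) (image_sqr p q x t / t)%:E)%E.
  by apply: integral_ge0 => t; exact: i0.
have D0 x : (0 <= \int[leb]_(t in band l j) (defects j x t / t)%:E)%E.
  by apply: integral_ge0 => t; exact: d0.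
have mi1 x : measurable_fun (band l j) (fun t => (image_sqr p q x t / t)%:E).
  by apply: measurable_funTS; exact: (measurableT_comp mi (pair1_measurable x)).
have md1 x : measurable_fun (band l j) (fun t => (defects j x t / t)%:E).
  by apply: measurable_funTS; exact: (measurableT_comp (mdefects j) (pair1_measurable x)).
apply: (@le_trans _ _ (\int[lam]_(x in good j)
   (8%:E * (\int[leb]_(t in band l j) (image_sqr p q x t / t)%:E) +
    16%:E * (\int[leb]_(t in band l j) (defects j x t / t)%:E)))%E).
  apply: ge0_le_integral => //.
  - exact: measurable_funTS.
  - by apply: measurable_funTS; apply: emeasurable_funD; exact: measurable_funeM.
  move=> x gx.
  have i0x t : band l j t -> (0 <= (image_sqr p q x t / t)%:E)%E by exact: i0.
  have d0x t : band l j t -> (0 <= (defects j x t / t)%:E)%E by exact: d0.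
  have mi1x := mi1 x; have md1x := md1 x.
  rewrite -!ge0_integralZl//.
  have i8 t : band l j t -> (0 <= 8%:E * (image_sqr p q x t / t)%:E)%E.
    by move=> tb; rewrite mule_ge0// i0x.
  have d16 t : band l j t -> (0 <= 16%:E * (defects j x t / t)%:E)%E.
    by move=> tb; rewrite mule_ge0// d0x.
  have mi8 := measurable_funeM 8%:E mi1x; have md16 := measurable_funeM 16%:E md1x.
  rewrite -ge0_integralD//.
  apply: ge0_le_integral => //.
  - by move=> t /(band_gt0 l_gt0)/ltW t0; rewrite lee_fin divr_ge0// symbol_sqr_ge0.
  - by apply: measurable_funTS; exact: (measurableT_comp measurable_symbol_sqr (pair1_measurable x)).
  - by apply: emeasurable_funD; exact: measurable_funeM.
  move=> t /(band_gt0 l_gt0)/ltW t0; rewrite -!EFinM -EFinD lee_fin !mulrA -mulrDl.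
  by rewrite ler_wpM2r ?invr_ge0//; apply: symbol_sqr_le; case: gx => _; exact.
rewrite ge0_integralD//; last 4 first.
- by move=> x _; rewrite mule_ge0.
- by apply: measurable_funTS; exact: measurable_funeM.
- by move=> x _; rewrite mule_ge0.
- by apply: measurable_funTS; exact: measurable_funeM.
rewrite !ge0_integralZl//; do ?exact: measurable_funTS.
apply: leeD; apply: lee_wpmul2l => //.
  apply: ge0_subset_integral => //; last exact: good_sub.
  exact: measurable_funTS.
rewrite -(fubini_tonelli_domains lam leb (mdefects j))//.
apply: ge0_subset_integral => //.
Qed.

Let image_energy_le :
  (\sum_(j < N) \int[lam]_(x in Q) \int[leb]_(t in band l j) (image_sqr p q x t / t)%:E
    <= (C * l ^+ n)%:E)%E.
Proof.
apply: le_trans image_bound.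
have mp : measurable_fun setT p by case: Lp.
have mq : measurable_fun setT q by case: Lq.
have mi := measurable_image_sqr mp mq.
have i0 x t : 0 < t -> (0 <= (image_sqr p q x t / t)%:E)%E.
  by move=> /ltW t0; rewrite lee_fin divr_ge0// image_sqr_ge0.
rewrite -ge0_integral_sum//; last 2 first.
- move=> j; apply: measurable_funTS; apply: (measurable_integral_domain leb mi).
    by move=> x t /(band_gt0 l_gt0); exact: i0.
  exact: measurable_band.
- by move=> j x _; apply: integral_ge0 => t /(band_gt0 l_gt0); exact: i0.
have mD (D : set R) : measurable D -> (forall t, D t -> 0 < t) ->
    measurable_fun Q (fun x => \int[leb]_(t in D) (image_sqr p q x t / t)%:E)%E.
  move=> mD D0; apply: measurable_funTS; apply: (measurable_integral_domain leb mi) => //.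
  by move=> x t /D0; exact: i0.
have pos a' t : 0 <= a' -> `]a', l]%classic t -> 0 < t.
  by move=> a0; rewrite /= in_itv/= => /andP[+ _]; exact: le_lt_trans.
under eq_integral => x _.
  rewrite (sum_bands N l_gt0)//; last 2 first.
  - exact: (measurableT_comp mi (pair1_measurable x)).
  - by move=> t; exact: i0.
  over.
apply: ge0_le_integral => //.
- by move=> x _; apply: integral_ge0 => t /(pos _ _ (ltW (scale_gt0 l_gt0 _))); exact: i0.
- by apply: mD => // t; exact: (pos _ _ (ltW (scale_gt0 l_gt0 _))).
- by apply: mD => // t; exact: pos.
move=> x _; apply: ge0_subset_integral => //.
- by apply: measurable_funTS; exact: (measurableT_comp mi (pair1_measurable x)).
- by move=> t /(pos _ _ (lexx _)); exact: i0.
move=> t; rewrite /= !in_itv/= => /andP[ts ->]; rewrite andbT.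
by apply: lt_trans ts; exact: scale_gt0.
Qed.

Let defect_energy_le :
  (\sum_(j < N) \int[leb]_(t in band l j) \int[lam]_x (defects j x t / t)%:E
    <= (96 * piece_const R n * C * l ^+ n)%:E)%E.
Proof.
have c0 : 0 <= piece_const R n.
  by rewrite /piece_const addr_ge0 ?mulr_ge0 ?sqr_ge0 ?exprn_ge0.
have [B1 [B10 B1s B1k]] := dyadic_square_function a l_gt0 N Lp.
have [B2 [B20 B2s B2k]] := dyadic_square_function a l_gt0 N Lq.
apply: (@le_trans _ _ (\sum_(j < N) (2 * (B1 j + B2 j))%:E)%E); last first.
  rewrite sumEFin lee_fin -mulr_sumr big_split/=.
  have := ler_wpM2l c0 pq_norm.
  by move: B1s B2s; move: (fine _) (fine _) => P S *; nra.
apply: lee_sum => j _.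
have jN : (j <= N)%N by exact: ltnW.
have s1 := scale_gt0 l_gt0 j.+1.
have mb := measurable_band l j.
have d0 x t : band l j t -> (0 <= (defects j x t / t)%:E)%E.
  by move=> /(band_gt0 l_gt0)/ltW t0; rewrite lee_fin divr_ge0.
(* On the band 1 / t is at most 1 / [scale l j.+1], and the band has length [scale l j.+1]:
   integration against dt / t costs no constant. *)
apply: (@le_trans _ _ (\int[leb]_(t in band l j) cst (2 * (B1 j + B2 j) / scale l j.+1)%:E t)%E).
  apply: ge0_le_integral => //.
  - by move=> t tb; apply: integral_ge0 => x _; exact: d0.
  - have mF : measurable_fun setT
        (fun z : R * 'rV[R]_n => (defects j z.2 z.1 / z.1)%:E).
      apply: (measurableT_comp (mdefects j) (g := fun z : R * 'rV[R]_n => (z.2, z.1))).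
      exact: measurable_fun_pair.
    pose F := (fun z : R * 'rV[R]_n => (defects j z.2 z.1 / z.1)%:E) \_ (band l j `*` setT).
    have mF' : measurable_fun setT F.
      by apply/(measurable_restrictT _ (measurableX mb measurableT)); exact: measurable_funTS.
    have F0 z : (0 <= F z)%E.
      by case: z => t x; rewrite /F patchE; case: ifPn => //; rewrite inE => -[/d0].
    have := measurable_fun_fubini_tonelli_F (m2 := lam) F mF' F0.
    move=> /(measurable_funS measurableT (@subsetT _ (band l j))).
    apply: eq_measurable_fun => t; rewrite inE => tb; apply: eq_integral => x _.
    by rewrite /F patchE mem_set.
  move=> t tb; have t0 := band_gt0 l_gt0 tb.
  have tb' : scale l j.+1 < t <= scale l j by move: tb; rewrite /band/= in_itv.
  have ku := u_kernel t0; have kv := v_kernel t0.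
  have md f w : L2fun lam f -> is_kernel t w ->
      measurable_fun setT (fun x => (kernel_defect a l j w f x ^+ 2)%:E).
    move=> Lf kw; apply/measurable_EFinP/measurable_funX.
    exact: (measurable_kernel_defect _ l_gt0 j kw Lf).
  have sq0 f w x : (0 <= (kernel_defect a l j w f x ^+ 2)%:E)%E.
    by rewrite lee_fin sqr_ge0.
  have mpu := md p _ Lp ku; have mpv := md p _ Lp kv.
  have mqu := md q _ Lq ku; have mqv := md q _ Lq kv.
  have -> : (\int[lam]_x (defects j x t / t)%:E =
     (t^-1)%:E * ((\int[lam]_x (kernel_defect a l j (u t) p x ^+ 2)%:E +
                   \int[lam]_x (kernel_defect a l j (v t) q x ^+ 2)%:E) +
                  (\int[lam]_x (kernel_defect a l j (u t) q x ^+ 2)%:E +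
                   \int[lam]_x (kernel_defect a l j (v t) p x ^+ 2)%:E)))%E.
    rewrite -!ge0_integralD//; last 4 first.
    - by move=> x _; rewrite adde_ge0.
    - exact: emeasurable_funD.
    - by move=> x _; rewrite adde_ge0.
    - exact: emeasurable_funD.
    rewrite -ge0_integralZl//; last 3 first.
    - by apply: emeasurable_funD; exact: emeasurable_funD.
    - by move=> x _; rewrite !adde_ge0.
    - by rewrite lee_fin invr_ge0 ltW.
    by apply: eq_integral => x _; rewrite -!EFinD -EFinM mulrC.
  have b1u := B1k j t _ jN tb' ku; have b1v := B1k j t _ jN tb' kv.
  have b2u := B2k j t _ jN tb' ku; have b2v := B2k j t _ jN tb' kv.
  apply: (@le_trans _ _ ((t^-1)%:E * (((B1 j)%:E + (B2 j)%:E) + ((B2 j)%:E + (B1 j)%:E)))%E).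
    apply: lee_wpmul2l; first by rewrite lee_fin invr_ge0 ltW.
    exact: (leeD (leeD b1u b2v) (leeD b2u b1v)).
  rewrite -!EFinD -EFinM lee_fin mulrC.
  rewrite (_ : _ + _ = 2 * (B1 j + B2 j)); last by ring.
  apply: ler_wpM2l; first by rewrite mulr_ge0// addr_ge0.
  by rewrite lef_pV2 ?posrE//; case/andP: tb' => /ltW.
rewrite (integral_cst leb mb).
have sd : scale l j = 2 * scale l j.+1.
  by have := scaleD l j 1; rewrite addn1 expr1.
have bandE : lebesgue_measure (band l j : set R) = (scale l j.+1)%:E.
  rewrite /band lebesgue_measure_itv/= lte_fin sd ifT; last by lra.
  by rewrite -EFinD; congr EFin; ring.
rewrite [X in (_ * X <= _)%E]bandE.
by rewrite -EFinM lee_fin divfK// gt_eqF.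
Qed.

(** Here the recursion closes. With A = 8 C + 1536 [piece_const] C, where 1536 = 16 * 96, the
    threshold on [K] says A <= K / (4 C), that is A + (1 - 1/(4C)) K <= K. *)
Lemma cell_energy_le : 4 * C * (8 * C + 1536 * piece_const R n * C) <= K ->
  (\int[lam]_(x in Q) tail 0 x <= (K * l ^+ n)%:E)%E.
Proof.
move=> hK; apply: le_trans (tail_sum (leqnn N)) _.
have -> : (\int[lam]_(x in good N) tail N x = 0)%E.
  under eq_integral do rewrite /tail big_geq//.
  by rewrite integral0.
rewrite adde0.
apply: (@le_trans _ _ (((8 * C + 1536 * piece_const R n * C) * l ^+ n)%:E +
    (K * ((1 - (4 * C)^-1) * l ^+ n))%:E)%E); last first.
  rewrite -EFinD lee_fin.
  have C0 := C_gt0; have L0 : 0 <= l ^+ n by rewrite exprn_ge0// ltW.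
  rewrite mulrA -mulrDl ler_wpM2r// mulrBr mulr1.
  have C40 : 0 < 4 * C by lra.
  have : 8 * C + 1536 * piece_const R n * C <= K / (4 * C).
    by rewrite ler_pdivlMr// mulrC.
  lra.
apply: leeD; last by rewrite lee_fin ler_wpM2l.
apply: (@le_trans _ _ (\sum_(j < N) (
   8%:E * (\int[lam]_(x in Q) \int[leb]_(t in band l j) (image_sqr p q x t / t)%:E) +
   16%:E * (\int[leb]_(t in band l j) \int[lam]_x (defects j x t / t)%:E)))%E).
  by apply: lee_sum => j _; exact: good_energy_le.
rewrite big_split/=.
have mp : measurable_fun setT p by case: Lp.
have mq : measurable_fun setT q by case: Lq.
have i0 x t : 0 < t -> (0 <= (image_sqr p q x t / t)%:E)%E.
  by move=> /ltW t0; rewrite lee_fin divr_ge0// image_sqr_ge0.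
have d0 j x t : 0 < t -> (0 <= (defects j x t / t)%:E)%E.
  by move=> /ltW t0; rewrite lee_fin divr_ge0.
rewrite -!ge0_sume_distrr; last 2 first.
- move=> j _; apply: integral_ge0 => t /(band_gt0 l_gt0) t0.
  by apply: integral_ge0 => x _; exact: d0.
- move=> j _; apply: integral_ge0 => x _.
  by apply: integral_ge0 => t /(band_gt0 l_gt0) t0; exact: i0.
have h1 := lee_wpmul2l (ltac:(by rewrite lee_fin) : (0 <= 8%:E :> \bar R)%E) image_energy_le.
have h2 := lee_wpmul2l (ltac:(by rewrite lee_fin) : (0 <= 16%:E :> \bar R)%E) defect_energy_le.
apply: le_trans (leeD h1 h2) _.
by rewrite -!EFinM -EFinD lee_fin le_eqVlt; apply/orP; left; apply/eqP; ring.
Qed.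

End one_cell.

End local_tb.

(** * Energy over dyadic cells and cubes *)

Lemma scale_scale (R : realType) (l : R) k j : scale (scale l k) j = scale l (k + j).
Proof. by rewrite /scale exprD; field; rewrite !expf_neq0. Qed.

(** Test functions are given on closed cubes, the stopping time runs in half-open cells; this
    transfers integrals from one to the other. *)
Lemma grid_cell_cube (R : realType) (n : nat) (a : 'rV[R]_n) (l : R) (x : 'rV[R]_n) :
  0 < l -> let c := grid_corner a l x + const_mx (l / 2) in
  cell_of (grid_index a l) x `<=` cube c l /\
  lebesgue_rV R n (cube c l `\` cell_of (grid_index a l) x) = 0%E.
Proof.
move=> l0 c; rewrite grid_cellE// cubeE /c.
set b := grid_corner a l x.
have -> : b + const_mx (l / 2) - const_mx (l / 2) = b by rewrite addrK.
have -> : b + const_mx (l / 2) + const_mx (l / 2) = b + const_mx l.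
  by apply/rowP => i; rewrite !mxE; field.
split; first exact: rV_cobox_sub.
by apply: lebesgue_rV_faces => i; rewrite !mxE; lra.
Qed.

Lemma bigcup_bands (R : realType) (l : R) : 0 < l ->
  \bigcup_j band l j = `]0, l]%classic.
Proof.
move=> l0; apply/seteqP; split => t.
  move=> [j _]; rewrite /band/= !in_itv/= => /andP[t1 t2]; apply/andP; split.
    by apply: lt_trans t1; exact: scale_gt0.
  by apply: le_trans t2 _; rewrite -[leRHS]scale0; exact: scale_le.
rewrite /= in_itv/= => /andP[t0 tl].
have ex : exists N, scale l N < t.
  have lt0 : 0 <= l / t by rewrite divr_ge0// ltW.
  exists (Num.Def.archi_bound (l / t)); rewrite /scale ltr_pdivrMr ?exprn_gt0//.
  rewrite mulrC -ltr_pdivrMr//; apply: lt_le_trans (archi_boundP lt0) _.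
  by rewrite -natrX ler_nat ltnW// ltn_expl.
(* The least N with [scale l N < t] is positive because [t <= l], and its predecessor is the band of
   [t]. *)
case: (ex_minnP ex) => -[|N]; first by rewrite scale0 ltNge tl.
move=> Nt Nmin; exists N => //; rewrite /band/= in_itv/= Nt leNgt/=.
by apply/negP => /Nmin; rewrite ltnn.
Qed.

Lemma trivIset_bands (R : realType) (l : R) : 0 < l -> trivIset setT (band l).
Proof.
move=> l0; apply/trivIsetP => i j _ _.
wlog ij : i j / (i < j)%N.
  move=> H ne; have := ne; rewrite neq_ltn => /orP[ij|ji]; first exact: H.
  by rewrite setIC; apply: H => //; rewrite eq_sym.
move=> _; apply/seteqP; split=> // t [] /=; rewrite /band/= !in_itv/= => /andP[t1 _] /andP[_ t2].
have := lt_le_trans t1 (le_trans t2 (scale_le l0 ij)).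
by rewrite ltxx.
Qed.

Section local_tb_conclusion.
Variables (R : realType) (n : nat).
Variables (u v : R -> 'rV[R]_n -> 'rV[R]_n -> R).
Local Notation lam := (lebesgue_rV R n).
Local Notation leb := (@lebesgue_measure R).
Hypothesis u_measurable : measurable_fun setT
  (fun z : R * ('rV[R]_n * 'rV[R]_n) => u z.1 z.2.1 z.2.2).
Hypothesis v_measurable : measurable_fun setT
  (fun z : R * ('rV[R]_n * 'rV[R]_n) => v z.1 z.2.1 z.2.2).
Hypothesis u_kernel : forall t, 0 < t -> is_kernel t (u t).
Hypothesis v_kernel : forall t, 0 < t -> is_kernel t (v t).
Variable C : R.
Hypothesis C_gt0 : 0 < C.
Hypothesis test_functions : forall (c : 'rV[R]_n) (l : R), 0 < l ->
  exists p q : 'rV[R]_n -> R, [/\ L2fun lam p, L2fun lam q,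
    fine (\int[lam]_x (p x ^+ 2)%:E) + fine (\int[lam]_x (q x ^+ 2)%:E) <= C * l ^+ n,
    (l ^+ n) ^+ 2 <= (\int[lam]_(x in cube c l) p x) ^+ 2 +
                     (\int[lam]_(x in cube c l) q x) ^+ 2 &
    (\int[lam]_(x in cube c l) \int[leb]_(t in `]0%R, l])
       (image_sqr u v p q x t / t)%:E <= (C * l ^+ n)%:E)%E].

Definition carleson_const : R := 4 * C * (8 * C + 1536 * piece_const R n * C).

Let K_ge0 : 0 <= carleson_const.
Proof.
have c0 : 0 <= piece_const R n.
  by rewrite /piece_const addr_ge0 ?mulr_ge0 ?sqr_ge0 ?exprn_ge0.
have C0 := C_gt0; have cC := mulr_ge0 c0 (ltW C0).
by rewrite /carleson_const; apply: mulr_ge0; lra.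
Qed.

Let image_ge0 p q x t : 0 < t -> (0 <= (image_sqr u v p q x t / t)%:E)%E.
Proof. by move=> /ltW t0; rewrite lee_fin divr_ge0// image_sqr_ge0. Qed.

Let symbol_ge0 x t : 0 < t -> (0 <= (symbol_sqr u v x t / t)%:E)%E.
Proof. by move=> /ltW t0; rewrite lee_fin divr_ge0// symbol_sqr_ge0. Qed.

(** Strong induction on the number of scales, with the sidelength generalized because the hypothesis
    is used on all the smaller cells of the same grid. *)
Lemma dyadic_energy_le (N : nat) (a : 'rV[R]_n) (l : R) x : 0 < l ->
  (\int[lam]_(y in cell_of (dyadic_index a l 0) x) tail u v l N 0 y <=
   (carleson_const * l ^+ n)%:E)%E.
Proof.
elim/ltn_ind: N a l x => N IH a l x l0.
have idx0 : dyadic_index a l 0 = grid_index a l by rewrite /dyadic_index scale0.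
have [] := grid_cell_cube a x l0; set c := _ + _; set Q := cell_of _ _ => Qc Qc0.
have [p [q [Lp Lq pq_le pq_mean im]]] := test_functions c l0.
have mQ : measurable Q by exact: measurable_grid_cell.
have Qoo : (lam Q < +oo)%E by rewrite /Q lebesgue_grid_cell// ltry.
have mc : measurable (cube c l) by exact: measurable_cube.
have cell_cube f : L2fun lam f ->
    \int[lam]_(x in cube c l) f x = \int[lam]_(x in Q) f x.
  move=> Lf; rewrite /Rintegral; congr fine.
  rewrite (negligible_integral (measurableD mc mQ) mc _ Qc0).
    by rewrite setDD setIidr.
  by apply: L2fun_integrable => //; exact: (cube_lty _ (ltW l0)).
rewrite !cell_cube// in pq_mean.
move: pq_mean; set P := \int[lam]_(x in Q) p x; set S := \int[lam]_(x in Q) q x => pq_mean.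
(* [rho] is the modulus of the integral of b over Q, and e = (P + i S) / rho is its phase; the
   integral of Re (conj e * b) is then [rho], at least the volume of Q. *)
pose rho := Num.sqrt (P ^+ 2 + S ^+ 2).
have ln0 : 0 < l ^+ n by rewrite exprn_gt0.
have rho_sqr : rho ^+ 2 = P ^+ 2 + S ^+ 2 by rewrite sqr_sqrtr// addr_ge0// sqr_ge0.
have rho_ge : l ^+ n <= rho.
  by rewrite -ler_sqr ?nnegrE ?sqrtr_ge0 ?(ltW ln0)// rho_sqr.
have rho_gt0 : 0 < rho by exact: lt_le_trans rho_ge.
have e_unit : (P / rho) ^+ 2 + (S / rho) ^+ 2 = 1.
  by rewrite !expr_div_n -mulrDl -rho_sqr divff// expf_neq0// gt_eqF.
apply: (cell_energy_le u_measurable v_measurable u_kernel v_kernel C_gt0 l0 Lp Lq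
  e_unit K_ge0 pq_le) => //; rewrite ?idx0.
- have iQ f (k : R) : L2fun lam f -> lam.-integrable Q (EFin \o (fun x => k * f x)).
    by move=> Lf; apply: (L2fun_integrable mQ Qoo); exact: L2funZ.
  have iQ1 f : L2fun lam f -> lam.-integrable Q (EFin \o f).
    exact: (L2fun_integrable mQ Qoo).
  rewrite RintegralD//; do ?exact: iQ.
  rewrite !RintegralZl//; do ?exact: iQ1.
  by rewrite -/P -/S [P / rho * P]mulrAC [S / rho * S]mulrAC -mulrDl -!expr2 -rho_sqr expr2 mulfK// gt_eqF.
- apply: le_trans im; apply: ge0_subset_integral => //.
    apply: measurable_funTS; apply: (measurable_integral_domain leb
      (measurable_image_sqr u_measurable v_measurable Lp.1 Lq.1)) => //.
    by move=> y t; rewrite /= in_itv/= => /andP[/image_ge0].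
  by move=> y _; apply: integral_ge0 => t; rewrite /= in_itv/= => /andP[/image_ge0].
move=> m y mN.
(* A cell of scale [m.+1] is a top cell of the grid of side [scale l m.+1], with [N - m.+1] scales
   left; shifting the summation index identifies the two tails. *)
have Nm : (N - m.+1 < N)%N by rewrite ltn_subrL (leq_ltn_trans _ mN).
have := IH _ Nm a _ y (scale_gt0 l0 m.+1).
rewrite (_ : dyadic_index a (scale l m.+1) 0 = dyadic_index a l m.+1); last first.
  by rewrite /dyadic_index scale0.
rewrite (eq_integral (tail u v l N m.+1))// => z _.
rewrite /tail -[in RHS](add0n m.+1) big_addn; apply: eq_bigr => j _.
by rewrite /band_energy /band !scale_scale addnS [(m.+1 + j)%N]addnC.
Qed.

Lemma cube_energy_le (c : 'rV[R]_n) (l : R) : 0 < l ->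
  (\int[lam]_(x in cube c l) \int[leb]_(t in `]0%R, l]) (symbol_sqr u v x t / t)%:E
    <= (carleson_const * l ^+ n)%:E)%E.
Proof.
(* With the grid based at the lower corner of the cube, the cell of [a] is the cube up to a null
   set. *)
move=> l0; pose a := c - const_mx (l / 2).
have ca : grid_corner a l a = a.
  by apply/rowP => i; rewrite mxE /grid_index ffunE subrr mul0r floor0 mul0r addr0.
have [] := grid_cell_cube a a l0; rewrite ca subrK; set Q := cell_of _ _ => Qc Qc0.
have mQ : measurable Q by exact: measurable_grid_cell.
have mc : measurable (cube c l) by exact: measurable_cube.
have ms := measurable_symbol_sqr u_measurable v_measurable.
have mb j : measurable_fun setT (band_energy u v l j).
  apply: (measurable_integral_domain leb ms) => [x t|]; last exact: measurable_band.
  by move=> /(band_gt0 l0); exact: symbol_ge0.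
rewrite (ge0_negligible_integral (measurableD mc mQ) mc _ _ Qc0); last 2 first.
- apply: measurable_funTS; apply: (measurable_integral_domain leb ms) => //.
  by move=> y t; rewrite /= in_itv/= => /andP[/symbol_ge0].
- by move=> y _; apply: integral_ge0 => t; rewrite /= in_itv/= => /andP[/symbol_ge0].
rewrite setDD setIidr//.
rewrite (eq_integral (fun x => \sum_(j <oo) band_energy u v l j x)%E); last first.
  move=> x _; rewrite -bigcup_bands// ge0_integral_bigcup//.
  - by move=> j; exact: measurable_band.
  - by apply: measurable_funTS; exact: (measurableT_comp ms (pair1_measurable x)).
  - by move=> t [j _ /(band_gt0 l0)]; exact: symbol_ge0.
  - exact: trivIset_bands.
rewrite integral_nneseries//; last 2 first.
- by move=> j; exact: measurable_funTS.
- by move=> j x _; exact: band_energy_ge0.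
(* The bound of [dyadic_energy_le] does not depend on [N], so it passes to the limit of the partial
   sums. *)
apply: lime_le.
  by apply: is_cvg_nneseries => j _ _; apply: integral_ge0 => x _; exact: band_energy_ge0.
apply: nearW => N.
have := dyadic_energy_le N a a l0.
rewrite (_ : dyadic_index a l 0 = grid_index a l); last by rewrite /dyadic_index scale0.
rewrite -/Q /tail ge0_integral_sum//.
- by move=> j; exact: measurable_funTS.
- by move=> j x _; exact: band_energy_ge0.
Qed.

End local_tb_conclusion.

(** * Regularity of locally finite measures on the half-space *)

Section half_space_topology.
Variables (R : realType) (n : nat).

(** The sigma-algebra is generated by coordinates; open sets belong to it because boxes with
    rational centres and radii 1 / (k + 1) form a countable base. *)
Lemma measurable_open_prod (V : set ('rV[R]_n * R)) : open V -> measurable V.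
Proof.
move=> oV.
pose box (w : 'rV[rat]_n * rat * nat) : set ('rV[R]_n * R) :=
  [set x : 'rV[R]_n | forall i, ball (ratr (w.1.1 ord0 i) : R) w.2.+1%:R^-1 (x ord0 i)]
  `*` ball (ratr w.1.2 : R) w.2.+1%:R^-1.
have mbox w : measurable (box w).
  apply: measurableX; last exact: measurable_ball.
  rewrite (_ : mkset _ = \bigcap_(i in [set: 'I_n])
      ((fun x : 'rV[R]_n => x ord0 i) @^-1`
        ball (ratr (w.1.1 ord0 i) : R) w.2.+1%:R^-1)).
    apply: fin_bigcap_measurable => [|i _]; first exact: finite_finset.
    rewrite -[X in measurable X]setTI; apply: measurable_coor => //.
    exact: measurable_ball.
  by apply/seteqP; split => x /= Hx i => [_|]; exact: Hx.
have -> : V = \bigcup_(w : 'rV[rat]_n * rat * nat)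
    (if `[< box w `<=` V >] then box w else set0).
  apply/seteqP; split => [z Oz|z [w _]]; last first.
    by case: asboolP => // + bz; exact.
  have [e /= e0 eO] : exists2 e : R, 0 < e & ball z e `<=` V.
    by move: oV; rewrite openE => /(_ _ Oz)/nbhs_ballP.
  (* Two points of a box of radius 1 / (k + 1) are within 2 / (k + 1), so a box of this radius
     through [z] stays in the ball of radius [e]. *)
  have [k ke] : exists k : nat, 2 * k.+1%:R^-1 < e.
    have e20 : 0 < e / 2 by rewrite divr_gt0.
    have [k _ /(_ k (leqnn k)) /= ke] := near_infty_natSinv_lt (PosNum e20).
    by exists k; move: ke => /=; rewrite ltr_pdivlMr// mulrC.
  have k0 : 0 < k.+1%:R^-1 :> R by rewrite invr_gt0.
  have rat_near (a : R) : exists q : rat, ball (ratr q : R) k.+1%:R^-1 a.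
    have : a - k.+1%:R^-1 < a by rewrite ltrBlDr ltrDl.
    move=> /rat_in_itvoo[q]; rewrite in_itv/= => /andP[q1 q2].
    exists q; rewrite /ball/= ltr_norml ltrBrDr addrC q1/=.
    by rewrite ltrBlDr (lt_trans q2)// ltrDr.
  have [q qz] := choice (fun i => rat_near (z.1 ord0 i)).
  have [r rz] := rat_near z.2.
  exists ((\row_i q i, r), k) => //; case: asboolP => [_|].
    by split=> //= i; rewrite mxE.
  case=> y [/= y1 y2]; apply: eO; apply: (@le_ball _ _ _ (2 * k.+1%:R^-1)).
    exact: ltW.
  rewrite mulr_natl mulr2n; split.
    split=> [|i j]; first by rewrite addr_gt0.
    rewrite ord1; apply: ball_triangle (ball_sym (qz j)) _.
    by have := y1 j; rewrite mxE.
  exact: ball_triangle (ball_sym rz) y2.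
apply: countable_bigcupT_measurable => [|w]; first exact: countableP.
by case: asboolP.
Qed.

Lemma measurable_closed_prod (F : set ('rV[R]_n * R)) :
  closed F -> measurable F.
Proof.
by move=> cF; rewrite -[F]setCK; apply: measurableC;
  apply: measurable_open_prod; exact: closed_openC.
Qed.

End half_space_topology.

Lemma finite_measure_vanish d (T : measurableType d) (R : realType)
    (mu : {measure set T -> \bar R}) (D : (set T)^nat) (e : R) :
  (mu setT < +oo)%E -> (forall k, measurable (D k)) ->
  {homo D : i j / (i <= j)%N >-> (j <= i)%O} -> \bigcap_k D k = set0 ->
  0 < e -> exists k, (mu (D k) <= e%:E)%E.
Proof.
move=> muoo mD ndD D0 e0.
have : (mu \o D) x @[x --> \oo] --> mu (\bigcap_k D k).
  apply: nonincreasing_cvg_mu => //; last by rewrite D0.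
  by apply: le_lt_trans muoo; apply: le_measure => //; rewrite inE.
rewrite D0 measure0 => muD; apply: contrapT => /forallNP H.
suff : (e%:E <= 0)%E by rewrite lee_fin leNgt e0.
rewrite -(cvg_lim _ muD)//; apply: lime_ge; first by apply/cvg_ex; exists 0%E.
by apply: nearW => k /=; apply/ltW; rewrite ltNge; apply/negP; exact: H.
Qed.

Section finite_regularity.
Variables (R : realType) (n : nat).
Variable mu : {measure set ('rV[R]_n * R) -> \bar R}.
Hypothesis muoo : (mu setT < +oo)%E.

(** The two-sided form is symmetric under complement, so the approximable sets form a sigma-algebra
    and only generators remain to be checked. *)
Definition approximable (A : set ('rV[R]_n * R)) : Prop :=
  forall e : R, 0 < e -> exists F V : set ('rV[R]_n * R),
    [/\ closed F, open V, F `<=` A, A `<=` V & (mu (V `\` F) <= e%:E)%E].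

Lemma approximable0 : approximable set0.
Proof.
move=> e e0; exists set0, set0; split=> //; first exact: closed0.
by rewrite set0D measure0 lee_fin ltW.
Qed.

Lemma approximableC A : approximable A -> approximable (~` A).
Proof.
move=> aA e e0; have [F [V [cF oV FA AV FVe]]] := aA e e0.
exists (~` V), (~` F); split.
- exact: open_closedC.
- exact: closed_openC.
- exact: subsetC.
- exact: subsetC.
- by rewrite setDE setCK setIC -setDE.
Qed.

Lemma approximable_bigcup (A : (set ('rV[R]_n * R))^nat) :
  (forall k, approximable (A k)) -> approximable (\bigcup_k A k).
Proof.
move=> aA e e0.
have e20 : 0 < e / 2 by rewrite divr_gt0.
have ek0 k : 0 < e / 2 / (2 ^ k.+1)%:R.
  by rewrite divr_gt0// ltr0n expn_gt0.
have [F HF] := choice (fun k => aA k _ (ek0 k)).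
have [V HV] := choice HF.
have cF k : closed (F k) by have [] := HV k.
have oV k : open (V k) by have [] := HV k.
have mF k : measurable (F k) by exact: measurable_closed_prod.
have mV k : measurable (V k) by exact: measurable_open_prod.
(* An infinite union of closed sets need not be closed, so the union is cut at [m]; [D m] is what
   the cut loses, and it vanishes because the measure is finite. The two errors share e equally. *)
pose D m := \bigcup_k F k `\` \bigcup_(k in `I_m) F k.
have mD m : measurable (D m).
  apply: measurableD; first exact: bigcupT_measurable.
  exact: bigcup_measurable.
have [m mDe] : exists m, (mu (D m) <= (e / 2)%:E)%E.
  apply: finite_measure_vanish => //.
  - move=> i j ij; apply/subsetPset; apply: setDS => x [k /= ki Fx].
    by exists k => //=; exact: leq_trans ij.
  - rewrite -subset0 => x Dx; have [[k _ Fkx] _] := Dx 0%N I.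
    by have [_] := Dx k.+1 I; apply; exists k => /=.
exists (\bigcup_(k in `I_m) F k), (\bigcup_k V k); split.
- by apply: closed_bigcup => //; exact: finite_II.
- exact: bigcup_open.
- by move=> x [k _ Fx]; exists k => //; have [_ _ + _ _] := HV k; exact.
- by move=> x [k _ Ax]; exists k => //; have [_ _ _ + _] := HV k; exact.
have mOF : measurable (\bigcup_k (V k `\` F k)).
  by apply: bigcupT_measurable => k; exact: measurableD.
apply: (@le_trans _ _ (mu (\bigcup_k (V k `\` F k) `|` D m))).
  apply: le_measure; rewrite ?inE.
  - apply: measurableD; first exact: bigcupT_measurable.
    exact: bigcup_measurable.
  - exact: measurableU.
  - move=> x [[k _ Ox] nF]; have [[j _ Fx]|nFx] := pselect ((\bigcup_k F k) x).
      by right; split => //; exists j.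
    by left; exists k => //; split => // Fx; apply: nFx; exists k.
apply: (le_trans (measureU2 _ mOF (mD m))).
rewrite [e in X in (_ <= X)%E]splitr EFinD; apply: leeD => //.
apply: le_trans (epsilon_trick0 xpredT (ltW e20)).
apply: (@le_trans _ _ (\sum_(0 <= k <oo) mu (V k `\` F k))%E).
  by apply: measure_sigma_subadditive => // k; exact: measurableD.
by apply: lee_nneseries => // k _; have [] := HV k.
Qed.

(** Open half-lines generate the Borel sets; their preimages are open and are exhausted from inside
    by those of closed half-lines. *)
Lemma approximable_preimage (f : 'rV[R]_n * R -> R) (B : set R) :
  continuous f -> measurable B -> approximable (f @^-1` B).
Proof.
move=> cf mB.
have {}mB : (@RGenInftyO.G R).-sigma.-measurable B.
  by rewrite -RGenInftyO.measurableE.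
have sigA : sigma_algebra [set: R] [set B | approximable (f @^-1` B)].
  split => /=.
  - exact: approximable0.
  - by move=> C aC; rewrite setTD preimage_setC; exact: approximableC.
  - by move=> C aC; rewrite preimage_bigcup; exact: approximable_bigcup.
apply: (smallest_sub sigA _ mB) => _ [x ->] /= e e0.
have oV : open (f @^-1` `]-oo, x[).
  by apply: open_comp => [z _|]; [exact: cf|exact: lray_open].
pose F k := f @^-1` `]-oo, x - k.+1%:R^-1].
have cF k : closed (F k).
  by apply: preimage_closed => [z _|]; [exact: cf|exact: lray_closed].
have [k ke] : exists k, (mu (f @^-1` `]-oo, x[ `\` F k) <= e%:E)%E.
  apply: finite_measure_vanish => //.
  - move=> k; apply: measurableD; first exact: measurable_open_prod.
    exact: measurable_closed_prod.
  - move=> i j ij; apply/subsetPset; apply: setDS => z; rewrite /F /= !in_itv/=.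
    move=> /le_trans; apply; rewrite lerD2l lerN2 lef_pV2 ?posrE// ler_nat.
    by rewrite ltnS.
  - rewrite -subset0 => z Dz; have [+ _] := Dz 0%N I.
    rewrite /= in_itv/= => fzx.
    have xfz0 : 0 < x - f z by rewrite subr_gt0.
    have [k _ /(_ k (leqnn k)) /= kz] := near_infty_natSinv_lt (PosNum xfz0).
    have [_] := Dz k I; apply; rewrite /F/= in_itv/=.
    by rewrite lerBrDr -lerBrDl ltW.
exists (F k), (f @^-1` `]-oo, x[); split => //.
move=> z; rewrite /F/= !in_itv/= => /le_lt_trans; apply.
by rewrite ltrBlDr ltrDl invr_gt0.
Qed.

Lemma approximable_measurable A : measurable A -> approximable A.
Proof.
have sigA : sigma_algebra [set: 'rV[R]_n * R] [set A | approximable A].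
  split => /=.
  - exact: approximable0.
  - by move=> C aC; rewrite setTD; exact: approximableC.
  - by move=> C aC; exact: approximable_bigcup.
move=> mA; apply: (smallest_sub sigA _ mA) => _ [] [B mB <-]; rewrite setTI.
  have sigB : sigma_algebra [set: 'rV[R]_n]
      [set B : set 'rV[R]_n | approximable (fst @^-1` B)].
    split => /=.
    - exact: approximable0.
    - by move=> C aC; rewrite setTD preimage_setC; exact: approximableC.
    - by move=> C aC; rewrite preimage_bigcup; exact: approximable_bigcup.
  apply: (smallest_sub sigB _ mB) => C.
  rewrite -bigcup_seq/= => -[i _ [D mD <-]] /=; rewrite setTI.
  apply: (@approximable_preimage (fun z => z.1 ord0 i)) => // z.
  apply: (@continuous_comp _ _ _ fst (fun x : 'rV[R]_n => x ord0 i)).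
    exact: cvg_fst.
  exact: coord_continuous.
by apply: approximable_preimage => // z; exact: cvg_snd.
Qed.

End finite_regularity.

Section half_space_regularity.
Variables (R : realType) (n : nat).
Variable mu : {measure set ('rV[R]_n * R) -> \bar R}.
Hypothesis mu_box : forall (c : 'rV[R]_n) (l : R), 0 < l ->
  (mu (carleson_box c l) < +oo)%E.

(** Open sets bounded in every direction and away from t = 0: each sits in a Carleson box, hence has
    finite measure, and its closed subsets are compact. *)
Definition exhaust (j : nat) : set ('rV[R]_n * R) :=
  ball (0 : 'rV[R]_n) (j.+1%:R : R) `*` `]j.+1%:R^-1, j.+1%:R[.

Lemma exhaust_open j : open (exhaust j).
Proof.
rewrite (_ : exhaust j = fst @^-1` ball (0 : 'rV[R]_n) (j.+1%:R : R) `&`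
    snd @^-1` `]j.+1%:R^-1, j.+1%:R[)//.
apply: openI; apply: open_comp => //.
- by move=> z _; exact: cvg_fst.
- exact: ball_open.
by move=> z _; exact: cvg_snd.
Qed.

Lemma measurable_exhaust j : measurable (exhaust j).
Proof. by apply: measurable_open_prod; exact: exhaust_open. Qed.

Lemma exhaust_lty j : (mu (exhaust j) < +oo)%E.
Proof.
have j0 : 0 < 2 * j.+1%:R :> R by rewrite mulr_gt0.
apply: le_lt_trans (mu_box 0 j0); apply: le_measure; rewrite ?inE.
- exact: measurable_exhaust.
- by apply: measurableX; [exact: measurable_cube|exact: measurable_itv].
- move=> [x t] [/= [_ xj]]; rewrite !in_itv/= => /andP[jt tj]; split => /=.
    move=> i; have := xj ord0 i; rewrite /ball/= mxE sub0r normrN subr0.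
    by move=> /ltW/le_trans; apply; rewrite mulrC mulKf.
  rewrite in_itv/=; apply/andP; split; first by apply: lt_trans jt; rewrite invr_gt0.
  apply: (le_trans (ltW tj)); rewrite mulr_natl mulr2n lerDl; exact: ler0n.
Qed.

Lemma exhaust_homo i j : (i <= j)%N -> exhaust i `<=` exhaust j.
Proof.
move=> ij [x t] [/= xi]; rewrite in_itv/= => /andP[it ti]; split => /=.
  by apply: (le_ball _ xi); rewrite ler_nat.
rewrite in_itv/=; apply/andP; split.
  by apply: le_lt_trans it; rewrite lef_pV2 ?posrE// ler_nat.
by apply: (lt_le_trans ti); rewrite ler_nat.
Qed.

Lemma bigcup_exhaust : \bigcup_j exhaust j = @upper_half_space R n.
Proof.
apply/seteqP; split => [[x t] [j _ [/= _]]|[x t] /= t0].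
  rewrite in_itv/= => /andP[jt _]; apply: lt_trans jt.
  by rewrite invr_gt0.
rewrite /upper_half_space/= in t0.
pose r := \sum_i `|x ord0 i| + t + t^-1.
have r0 : 0 <= r.
  by rewrite addr_ge0 ?invr_ge0 ?addr_ge0 ?sumr_ge0// ltW.
have rj : r < (Num.bound r).+1%:R.
  rewrite (lt_le_trans (archi_boundP r0))// ler_nat; exact: leqnSn.
exists (Num.bound r) => //; split => /=.
  split=> // i k; rewrite ord1 /ball/= mxE sub0r normrN.
  apply: le_lt_trans rj; rewrite /r (bigD1 k)//= -!addrA lerDl.
  by rewrite addr_ge0 ?sumr_ge0// addr_ge0 ?invr_ge0 // ltW.
have s0 : 0 <= \sum_i `|x ord0 i| by rewrite sumr_ge0.
have ti0 : 0 < t^-1 by rewrite invr_gt0.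
rewrite in_itv/=; apply/andP; split.
  rewrite invf_plt ?posrE//; apply: le_lt_trans rj; rewrite /r.
  by rewrite lerDr addr_ge0// ltW.
by apply: le_lt_trans rj; rewrite /r -addrA addrCA lerDl addr_ge0// ltW.
Qed.

Lemma closed_exhaust_compact j (F : set ('rV[R]_n * R)) :
  closed F -> F `<=` exhaust j -> compact F.
Proof.
move=> cF Fj.
have cx : compact
    [set x : 'rV[R]_n | forall i, `[- j.+1%:R, j.+1%:R]%classic (x ord0 i)].
  have ci (i : 'I_n) : compact `[- j.+1%:R, j.+1%:R : R].
    exact: segment_compact.
  exact: rV_compact ci.
have ct : compact `[j.+1%:R^-1, j.+1%:R : R] by exact: segment_compact.
apply: subclosed_compact cF (compact_setX cx ct) _ => -[x t] /Fj[[/= _ xj]].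
rewrite !in_itv/= => /andP[/ltW jt /ltW tj].
split => /=; last by rewrite jt.
move=> i; have := xj ord0 i; rewrite /ball/= mxE sub0r normrN => /ltW.
by rewrite ler_norml in_itv.
Qed.

(** The finite case is applied to [mu] restricted to [exhaust j]. *)
Lemma exhaust_approximable j (A : set ('rV[R]_n * R)) (e : R) :
  measurable A -> 0 < e ->
  exists F V : set ('rV[R]_n * R), [/\ closed F, open V, F `<=` A, A `<=` V &
    (mu ((V `\` F) `&` exhaust j) <= e%:E)%E].
Proof.
move=> mA; have mj := measurable_exhaust j.
pose nu : {measure set ('rV[R]_n * R) -> \bar R} := mrestr mu mj.
have nuoo : (nu setT < +oo)%E.
  by rewrite /nu/= /mrestr setTI; exact: exhaust_lty.
exact: (approximable_measurable nuoo mA).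
Qed.

Lemma half_space_regular : regular_on_half_space mu.
Proof.
move=> A mA AH; split; apply/eqP; rewrite eq_le; apply/andP; split.
- apply: le_ereal_inf_tmp => _ [V [oV [AV _]] <-].
  by apply: le_measure; rewrite ?inE//; exact: measurable_open_prod.
- apply/lee_addgt0Pr => e e0.
  have ej0 j : 0 < e / (2 ^ j.+1)%:R by rewrite divr_gt0// ltr0n expn_gt0.
  have [F HF] := choice (fun j => exhaust_approximable j mA (ej0 j)).
  have [V HV] := choice HF.
  have cF j : closed (F j) by have [] := HV j.
  have oV j : open (V j) by have [] := HV j.
  have FA j : F j `<=` A by have [] := HV j.
  have AV j : A `<=` V j by have [] := HV j.
  have mF j : measurable (F j) by exact: measurable_closed_prod.
  have mV j : measurable (V j) by exact: measurable_open_prod.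
  have mE j : measurable ((V j `\` F j) `&` exhaust j).
    by apply: measurableI; [exact: measurableD|exact: measurable_exhaust].
  (* Cutting [V j] down to [exhaust j] keeps [W] in the half-space and makes the errors e / 2^(j+1)
     summable. Measures are only added, so an infinite [mu A] is harmless. *)
  pose W := \bigcup_j (V j `&` exhaust j).
  have oW : open W.
    by apply: bigcup_open => j _; apply: openI => //; exact: exhaust_open.
  have mW : measurable W by exact: measurable_open_prod.
  apply: (@le_trans _ _ (mu W)).
    apply: ereal_inf_lbound; exists W => //; split => //; split.
      move=> z Az; have : (\bigcup_j exhaust j) z.
        by rewrite bigcup_exhaust; exact: AH.
      by case=> j _ jz; exists j => //; split => //; exact: AV.
    by rewrite -bigcup_exhaust => z [j _ [_ jz]]; exists j.
  have mU : measurable (\bigcup_j ((V j `\` F j) `&` exhaust j)).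
    exact: bigcupT_measurable.
  apply: (@le_trans _ _
      (mu (A `|` \bigcup_j ((V j `\` F j) `&` exhaust j)))).
    apply: le_measure; rewrite ?inE//; first exact: measurableU.
    move=> z [j _ [Vz jz]]; have [Az|nAz] := pselect (A z); first by left.
    by right; exists j => //; split => //; split => // /FA.
  apply: (le_trans (measureU2 _ mA mU)); apply: leeD => //.
  apply: le_trans (epsilon_trick0 xpredT (ltW e0)).
  apply: (@le_trans _ _
      (\sum_(0 <= j <oo) mu ((V j `\` F j) `&` exhaust j))%E).
    exact: measure_sigma_subadditive.
  by apply: lee_nneseries => // j _; have [] := HV j.
- have AE : \bigcup_j (A `&` exhaust j) = A.
    by rewrite -setI_bigcupr bigcup_exhaust setIidl.
  have mAj j : measurable (A `&` exhaust j).
    by apply: measurableI => //; exact: measurable_exhaust.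
  have : (mu \o (fun j => A `&` exhaust j)) x @[x --> \oo] -->
      mu (\bigcup_j (A `&` exhaust j)).
    apply: nondecreasing_cvg_mu => //; first by rewrite AE.
    by move=> i j ij; apply/subsetPset; apply: setIS; exact: exhaust_homo.
  (* Continuity from below reduces inner regularity to [A] inside one [exhaust j], where the
     approximating closed sets are compact. *)
  rewrite AE => muA; rewrite -(cvg_lim _ muA)//.
  apply: lime_le; first by apply/cvg_ex; exists (mu A).
  apply: nearW => j /=; apply/lee_addgt0Pr => e e0.
  have [F [V [cF oV FA AV FVe]]] := exhaust_approximable j (mAj j) e0.
  have mF : measurable F by exact: measurable_closed_prod.
  have mV : measurable V by exact: measurable_open_prod.
  have mE : measurable ((V `\` F) `&` exhaust j).
    by apply: measurableI; [exact: measurableD|exact: measurable_exhaust].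
  apply: (@le_trans _ _ (mu (F `|` ((V `\` F) `&` exhaust j)))).
    apply: le_measure; rewrite ?inE//; first exact: measurableU.
    move=> z [Az jz]; have [Fz|nFz] := pselect (F z); first by left.
    by right; split => //; split => //; exact: AV.
  apply: (le_trans (measureU2 _ mF mE)); apply: leeD => //.
  apply: ereal_sup_ubound; exists F => //; split; last by move=> z /FA[].
  by apply: (@closed_exhaust_compact j) => // z /FA[].
- apply: ge_ereal_sup => _ [K [cK KA] <-].
  apply: le_measure; rewrite ?inE//; apply: measurable_closed_prod.
  exact: (compact_closed (@norm_hausdorff R ('rV[R]_n * R)%type) cK).
Qed.

End half_space_regularity.

(** * Real and imaginary parts of the kernel *)

Section gradient_lipschitz.
Variables (R : realType) (n : nat).

Lemma is_derive_segment (f : 'rV[R]_n -> R) (y h : 'rV[R]_n) (s : R) :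
  (forall z, differentiable f z) ->
  is_derive s (1 : R) (fun s => f (y + s *: h) : R) ('d f (y + s *: h) h).
Proof.
move=> df.
have dL : is_diff s (fun s : R => y + s *: h) (0 + fun t : R => t *: h).
  by apply: is_diffD.
have df' := df (y + s *: h).
have dc : is_diff s (f \o (fun s : R => y + s *: h))
    ('d f (y + s *: h) \o (0 + fun t : R => t *: h)).
  by apply: is_diff_comp.
apply: DeriveDef; first by apply: diff_derivable; have [] := dc.
rewrite deriveE; last by have [] := dc.
by have [_ ->] := dc; rewrite /= add0r scale1r.
Qed.

(** Mean value theorem on the segment from y' to y; each of the n coordinates of the increment
    contributes at most [r * M]. *)
Lemma gradient_lipschitz (f : 'rV[R]_n -> R) (M r : R) (y y' : 'rV[R]_n) :
  (forall z, differentiable f z) ->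
  (forall z i, `|'D_(delta_mx ord0 i) f z| <= M) ->
  (forall i, `|y ord0 i - y' ord0 i| <= r) ->
  `|f y - f y'| <= r * (n%:R * M).
Proof.
move=> df Df yr; pose h := y - y'.
have dg s := is_derive_segment y' h s df.
have cg : {within `[0, 1 : R], continuous (fun s => f (y' + s *: h))}.
  apply: continuous_subspaceT => s; apply: differentiable_continuous.
  by apply/derivable1_diffP; have [] := dg s.
have [s _] := MVT_segment ler01 (fun s _ => dg s) cg.
rewrite scale0r addr0 scale1r subr0 mulr1 [y' + h]addrC subrK => ->.
rewrite [X in 'd f _ X](row_sum_delta h) linear_sum.
apply: (le_trans (ler_norm_sum _ _ _)).
have -> : r * (n%:R * M) = \sum_(i < n) r * M.
  by rewrite [LHS]mulrCA sumr_const card_ord mulr_natl.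
apply: ler_sum => i _; rewrite linearZ /= normrM ler_pM//.
  by rewrite !mxE; exact: yr.
by rewrite -deriveE.
Qed.

End gradient_lipschitz.

Lemma density_measure d (T : measurableType d) (R : realType)
    (m : {measure set T -> \bar R}) (D : set T) (g : T -> \bar R) :
  measurable D -> measurable_fun D g -> (forall z, D z -> (0 <= g z)%E) ->
  exists mu : {measure set T -> \bar R},
    forall A, mu A = (\int[m]_(z in A `&` D) g z)%E.
Proof.
move=> mD mg g0.
pose nu (A : set T) := (\int[m]_(z in A `&` D) g z)%E.
have nu0 : nu set0 = 0%E by rewrite /nu set0I integral_set0.
have nu_ge0 A : (0 <= nu A)%E by apply: integral_ge0 => z [_ /g0].
have nu_sigma : semi_sigma_additive nu.
  move=> F mF tF mUF; rewrite /nu setI_bigcupl ge0_integral_bigcup.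
  - apply: is_cvg_nneseries => k _ _; exact: nu_ge0.
  - by move=> k; exact: measurableI.
  - rewrite -setI_bigcupl; by apply: (measurable_funS mD _ mg); exact: subIsetr.
  - by move=> z [k _ [_ /g0]].
  - apply/trivIsetP => i j _ _ ij; move/trivIsetP : tF => /(_ i j I I ij).
    by rewrite setIACA => ->; rewrite set0I.
pose M := isMeasure.Build d T R nu nu0 nu_ge0 nu_sigma.
by exists (HB.pack_for {measure set T -> \bar R} nu M).
Qed.

Section complex_components.
Variable R : realType.

Lemma normc_sqr (z : R[i]) :
  normc z ^+ 2 = complex.Re z ^+ 2 + complex.Im z ^+ 2.
Proof. by case: z => a b /=; rewrite sqr_sqrtr// addr_ge0// sqr_ge0. Qed.

Lemma normc_nonneg (z : R[i]) : 0 <= normc z.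
Proof. by case: z => a b; exact: sqrtr_ge0. Qed.

Lemma norm_Re_le (z : R[i]) : `|complex.Re z| <= normc z.
Proof.
by case: z => a b /=; rewrite -sqrtr_sqr ler_wsqrtr// lerDl sqr_ge0.
Qed.

Lemma norm_Im_le (z : R[i]) : `|complex.Im z| <= normc z.
Proof.
by case: z => a b /=; rewrite -sqrtr_sqr ler_wsqrtr// lerDr sqr_ge0.
Qed.

Lemma le_sqrt_sum_sqr n (a : 'I_n -> R) (i : 'I_n) :
  `|a i| <= Num.sqrt (\sum_j a j ^+ 2).
Proof.
rewrite -sqrtr_sqr ler_wsqrtr// (bigD1 i)//= lerDl.
by apply: sumr_ge0 => j _; exact: sqr_ge0.
Qed.

Lemma norm_partial_le n (f : 'rV[R]_n -> R[i]) (y : 'rV[R]_n) (i : 'I_n) :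
  `|'D_(delta_mx ord0 i) (fun z => complex.Re (f z) : R) y|
    <= norm_gradient f y /\
  `|'D_(delta_mx ord0 i) (fun z => complex.Im (f z) : R) y|
    <= norm_gradient f y.
Proof.
have := le_sqrt_sum_sqr (fun i => normc (cpartial f i y)) i.
rewrite ger0_norm ?normc_nonneg// => fi; split.
  exact: le_trans (norm_Re_le (cpartial f i y)) fi.
exact: le_trans (norm_Im_le (cpartial f i y)) fi.
Qed.

Lemma le_enorm n (x : 'rV[R]_n) (i : 'I_n) : `|x ord0 i| <= enorm x.
Proof. exact: (le_sqrt_sum_sqr (fun i => x ord0 i)). Qed.

End complex_components.

Section kernel_components.
Variables (R : realType) (n : nat) (U : R -> 'rV[R]_n -> 'rV[R]_n -> R[i]).
Hypothesis U_measurable : cmeasurable_fun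
  [set z : R * ('rV[R]_n * 'rV[R]_n) | 0 < z.1] (fun z => U z.1 z.2.1 z.2.2).
Hypothesis U_support : forall (t : R) (x y : 'rV[R]_n), 0 < t ->
  U t x y != 0 -> enorm (x - y) <= t.
Hypothesis U_size : forall (t : R) (x y : 'rV[R]_n), 0 < t ->
  normc (U t x y) <= t ^- n.
Hypothesis U_differentiable : forall (t : R) (x y : 'rV[R]_n), 0 < t ->
  cdifferentiable (U t x) y.
Hypothesis U_gradient : forall (t : R) (x y : 'rV[R]_n), 0 < t ->
  norm_gradient (U t x) y <= t ^- n.+1.
Local Notation lam := (lebesgue_rV R n).

(** The kernel is controlled for t > 0 only; the value 0 elsewhere makes each component jointly
    measurable on the whole space. *)
Definition part (pr : R[i] -> R) (t : R) (x y : 'rV[R]_n) : R :=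
  if 0 < t then pr (U t x y) else 0.

Lemma measurable_part (pr : R[i] -> R) :
  measurable_fun [set z : R * ('rV[R]_n * 'rV[R]_n) | 0 < z.1]
    (fun z => pr (U z.1 z.2.1 z.2.2)) ->
  measurable_fun setT
    (fun z : R * ('rV[R]_n * 'rV[R]_n) => part pr z.1 z.2.1 z.2.2).
Proof.
have mD : measurable [set z : R * ('rV[R]_n * 'rV[R]_n) | 0 < z.1].
  rewrite (_ : mkset _ = fst @^-1` `]0, +oo[%classic).
    rewrite -[X in measurable X]setTI; exact: measurable_fst.
  by apply/seteqP; split => z /=; rewrite in_itv/= andbT.
move=> /(measurable_restrictT _ mD); congr measurable_fun.
apply/funext => z; rewrite patchE /part.
case: ifPn => [/set_mem/= ->//|]; rewrite notin_setE/=.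
by move/negP/negbTE => ->.
Qed.

Lemma part_is_kernel (pr : R[i] -> R) (t : R) : 0 < t ->
  measurable_fun setT
    (fun z : R * ('rV[R]_n * 'rV[R]_n) => part pr z.1 z.2.1 z.2.2) ->
  pr 0 = 0 -> (forall z, `|pr z| <= normc z) ->
  (forall x y, differentiable (fun z => pr (U t x z) : R) y) ->
  (forall x y i, `|'D_(delta_mx ord0 i) (fun z => pr (U t x z) : R) y|
    <= norm_gradient (U t x) y) ->
  is_kernel t (part pr t).
Proof.
move=> t0 mpr pr0 prn dpr Dpr; split => //.
- have : measurable_fun [set: 'rV[R]_n * 'rV[R]_n]
      (fun z => (t, z) : R * ('rV[R]_n * 'rV[R]_n)).
    exact: pair1_measurable.
  by move=> /(measurableT_comp mpr).
- move=> x y; rewrite /part t0 => prU i.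
  have Uxy : U t x y != 0 by apply: contra_neq prU => ->.
  rewrite mulrC mulKf// distrC.
  have := le_trans (le_enorm (x - y) i) (U_support t0 Uxy).
  by rewrite !mxE.
- by move=> x y; rewrite /part t0; exact: le_trans (prn _) (U_size _ _ t0).
- move=> x y y' r yr; rewrite /part t0.
  apply: (gradient_lipschitz (dpr x) _ yr) => z i.
  exact: le_trans (Dpr x z i) (U_gradient _ _ t0).
Qed.

Let u := part (@complex.Re R).
Let v := part (@complex.Im R).

Lemma Re_part_measurable : measurable_fun setT
  (fun z : R * ('rV[R]_n * 'rV[R]_n) => u z.1 z.2.1 z.2.2).
Proof. by apply: measurable_part; have [] := U_measurable. Qed.

Lemma Im_part_measurable : measurable_fun setT
  (fun z : R * ('rV[R]_n * 'rV[R]_n) => v z.1 z.2.1 z.2.2).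
Proof. by apply: measurable_part; have [] := U_measurable. Qed.

Lemma Re_part_kernel t : 0 < t -> is_kernel t (u t).
Proof.
move=> t0; apply: part_is_kernel => //.
- exact: Re_part_measurable.
- exact: norm_Re_le.
- by move=> x y; have [] := U_differentiable x y t0.
- by move=> x y i; have [] := norm_partial_le (U t x) y i.
Qed.

Lemma Im_part_kernel t : 0 < t -> is_kernel t (v t).
Proof.
move=> t0; apply: part_is_kernel => //.
- exact: Im_part_measurable.
- exact: norm_Im_le.
- by move=> x y; have [] := U_differentiable x y t0.
- by move=> x y i; have [] := norm_partial_le (U t x) y i.
Qed.

Lemma kernel_op_one t x : 0 < t ->
  normc (kernel_op U t setT (fun=> 1) x) ^+ 2 = symbol_sqr u v x t.
Proof.
move=> t0; rewrite normc_sqr /symbol_sqr /=; congr (_ ^+ 2 + _ ^+ 2).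
  by apply: eq_Rintegral => y _; rewrite mulr1 /u /part t0.
by apply: eq_Rintegral => y _; rewrite mulr1 /v /part t0.
Qed.

(** Extending b by 0 trades the domain [D] for the whole space, and the two squares are those of the
    real and imaginary parts of (u + i v)(p + i q). Square-integrability allows the integrals to be
    split. *)
Lemma kernel_op_restrict (D : set 'rV[R]_n) (b : 'rV[R]_n -> R[i]) t x :
  0 < t -> measurable D ->
  L2fun lam ((fun y => complex.Re (b y) : R) \_ D) ->
  L2fun lam ((fun y => complex.Im (b y) : R) \_ D) ->
  normc (kernel_op U t D b x) ^+ 2 =
  image_sqr u v ((fun y => complex.Re (b y) : R) \_ D)
    ((fun y => complex.Im (b y) : R) \_ D) x t.
Proof.
set p := _ \_ D; set q := _ \_ D => t0 mD Lp Lq.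
have Lk (w : 'rV[R]_n -> 'rV[R]_n -> R) : is_kernel t w -> L2fun lam (w x).
  by case=> w0 mw ws wS _; exact: (kernel_L2fun w0 mw ws wS x).
have Lu := Lk _ (Re_part_kernel t0); have Lv := Lk _ (Im_part_kernel t0).
rewrite normc_sqr /image_sqr /kernel_int /=.
rewrite -RintegralB//; [|exact: L2fun_mul|exact: L2fun_mul].
rewrite -RintegralD//; [|exact: L2fun_mul|exact: L2fun_mul].
congr (_ ^+ 2 + _ ^+ 2); rewrite [LHS]Rintegral_mkcond; apply: eq_Rintegral => y _;
  rewrite /p /q /u /v /part t0 !patchE; case: ifP => _;
  rewrite ?mulr0 ?addr0 ?subr0//; case: (U t x y) (b y) => a1 a2 [b1 b2] //=.
Qed.

End kernel_components.

(** * From the kernel estimates to the measure *)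

Lemma integral_setX_ge0 d1 d2 (T1 : measurableType d1) (T2 : measurableType d2)
    (R : realType) (m1 : {sigma_finite_measure set T1 -> \bar R})
    (m2 : {sigma_finite_measure set T2 -> \bar R}) (F : T1 * T2 -> \bar R)
    (D1 : set T1) (D2 : set T2) :
  measurable D1 -> measurable D2 -> measurable_fun setT F ->
  (forall z, (D1 `*` D2) z -> (0 <= F z)%E) ->
  (\int[m1 \x m2]_(z in D1 `*` D2) F z =
   \int[m1]_(x in D1) \int[m2]_(y in D2) F (x, y))%E.
Proof.
move=> mD1 mD2 mF F0; rewrite integral_mkcond fubini_tonelli1.
- rewrite [RHS]integral_mkcond; apply: eq_integral => x _.
  rewrite /fubini_F patchE; case: ifPn => [|] xD1.
    rewrite [RHS]integral_mkcond; apply: eq_integral => y _.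
    rewrite !patchE; congr (if _ then _ else _).
    by apply/idP/idP; rewrite !inE; [case|move=> ?; split => //; exact: set_mem].
  apply: integral0_eq => y _; rewrite patchE ifF//.
  by apply/negbTE; apply: contra xD1; rewrite !inE => -[].
- apply/(measurable_restrictT _ (measurableX mD1 mD2)).
  by apply: (measurable_funS measurableT _ mF).
- move=> z; rewrite patchE; case: ifPn => // /set_mem; exact: F0.
Qed.

(* The Lebesgue measure of the library lives on the alias measurableTypeR R of R,
   which has the same measurable sets but another display. *)
Lemma measure_unalias (R : realType) (n : nat)
    (mu : {measure set ('rV[R]_n * measurableTypeR R) -> \bar R}) :
  exists nu : {measure set ('rV[R]_n * R) -> \bar R}, forall A, nu A = mu A.
Proof.
pose M := isMeasure.Build _ [the measurableType _ of ('rV[R]_n * R)%type] R mu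
  (measure0 mu) (@measure_ge0 _ _ _ mu) (@measure_semi_sigma_additive _ _ _ mu).
by exists (HB.pack_for {measure set ('rV[R]_n * R) -> \bar R}
  (mu : set ('rV[R]_n * R) -> \bar R) M).
Qed.

Section test_functions.
Variables (R : realType) (n : nat) (b : 'rV[R]_n -> R[i]).
Variables (c : 'rV[R]_n) (l K : R).
Hypothesis l_gt0 : 0 < l.
Hypothesis b_measurable : cmeasurable_fun (cube c (3 * l)) b.
Local Notation lam := (lebesgue_rV R n).
Hypothesis b_L2 :
  (\int[lam]_(x in cube c (3 * l)) (normc (b x) ^+ 2)%:E <= K%:E)%E.

Definition re_patch := (fun y => complex.Re (b y) : R) \_ (cube c (3 * l)).
Definition im_patch := (fun y => complex.Im (b y) : R) \_ (cube c (3 * l)).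

Let mQ3 : measurable (cube c (3 * l)).
Proof. exact: measurable_cube. Qed.

Let m_re : measurable_fun setT re_patch.
Proof. by apply/(measurable_restrictT _ mQ3); have [] := b_measurable. Qed.

Let m_im : measurable_fun setT im_patch.
Proof. by apply/(measurable_restrictT _ mQ3); have [] := b_measurable. Qed.

Let m_sqr (f : 'rV[R]_n -> R) : measurable_fun setT f ->
  measurable_fun setT (fun x => (f x ^+ 2)%:E).
Proof. by move=> mf; apply/measurable_EFinP; exact: measurable_funX. Qed.

Let sum_sqr : (\int[lam]_x (re_patch x ^+ 2)%:E +
  \int[lam]_x (im_patch x ^+ 2)%:E <= K%:E)%E.
Proof.
rewrite -ge0_integralD//; last first.
- exact: m_sqr.
- by move=> x _; rewrite lee_fin sqr_ge0.
- exact: m_sqr.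
- by move=> x _; rewrite lee_fin sqr_ge0.
rewrite (_ : (\int[lam]_x _)%E =
  (\int[lam]_(x in cube c (3 * l)) (normc (b x) ^+ 2)%:E)%E)//.
rewrite [RHS]integral_mkcond; apply: eq_integral => x _.
rewrite patchE /re_patch /im_patch !patchE; case: ifP => _.
  by rewrite normc_sqr EFinD.
by rewrite expr0n/= adde0.
Qed.

Lemma L2fun_re_patch : L2fun lam re_patch.
Proof.
split=> //; apply: le_lt_trans (ltry K); apply: le_trans sum_sqr.
by rewrite leeDl// integral_ge0// => x _; rewrite lee_fin sqr_ge0.
Qed.

Lemma L2fun_im_patch : L2fun lam im_patch.
Proof.
split=> //; apply: le_lt_trans (ltry K); apply: le_trans sum_sqr.
by rewrite leeDr// integral_ge0// => x _; rewrite lee_fin sqr_ge0.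
Qed.

Lemma patch_L2_le : fine (\int[lam]_x (re_patch x ^+ 2)%:E) +
  fine (\int[lam]_x (im_patch x ^+ 2)%:E) <= K.
Proof.
have fin (f : 'rV[R]_n -> R) : L2fun lam f ->
    (\int[lam]_x (f x ^+ 2)%:E)%E \is a fin_num.
  case=> _ foo; rewrite ge0_fin_numE// integral_ge0// => x _.
  by rewrite lee_fin sqr_ge0.
rewrite -fineD; [|exact/fin/L2fun_re_patch|exact/fin/L2fun_im_patch].
rewrite -lee_fin fineK// fin_numD; apply/andP; split; apply: fin.
  exact: L2fun_re_patch.
exact: L2fun_im_patch.
Qed.

Lemma integral_patch :
  normc (cintegral lam (cube c l) b) ^+ 2 =
  (\int[lam]_(x in cube c l) re_patch x) ^+ 2 +
  (\int[lam]_(x in cube c l) im_patch x) ^+ 2.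
Proof.
have sub x : cube c l x -> x \in cube c (3 * l).
  move=> xQ; rewrite inE => i; apply: (le_trans (xQ i)).
  by rewrite ler_pM2r ?invr_gt0// ler_peMl// ?ler1n// ltW.
rewrite normc_sqr /=; congr (_ ^+ 2 + _ ^+ 2); apply: eq_Rintegral => x;
  by rewrite inE => /sub xQ3; rewrite /re_patch /im_patch patchE xQ3.
Qed.

End test_functions.

Theorem theorem30 (R : realType) (n : nat) (hn : (1 <= n)%N)
    (U : R -> 'rV[R]_n -> 'rV[R]_n -> R[i])
    (U_measurable : cmeasurable_fun
      [set z : R * ('rV[R]_n * 'rV[R]_n) | 0 < z.1]
      (fun z => U z.1 z.2.1 z.2.2))
    (U_bounded : uniformly_bounded_L2 U)
    (U_support : forall (t : R) (x y : 'rV[R]_n), 0 < t ->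
      U t x y != 0 -> enorm (x - y) <= t)
    (U_size : forall (t : R) (x y : 'rV[R]_n), 0 < t ->
      normc (U t x y) <= t ^- n)
    (U_differentiable : forall (t : R) (x y : 'rV[R]_n), 0 < t ->
      cdifferentiable (U t x) y)
    (U_gradient : forall (t : R) (x y : 'rV[R]_n), 0 < t ->
      norm_gradient (U t x) y <= t ^- n.+1)
    (C : R)
    (b_exists : forall (c : 'rV[R]_n) (l : R), 0 < l ->
      let Q := cube c l in
      let Q3 := cube c (3 * l) in
      exists b : 'rV[R]_n -> R[i],
        [/\ cmeasurable_fun Q3 b,
            (\int[lebesgue_rV R n]_(x in Q3) (normc (b x) ^+ 2)%:E
              <= C%:E * lebesgue_rV R n Q)%E,
            (lebesgue_rV R n Q
              <= (normc (cintegral (lebesgue_rV R n) Q b))%:E)%E &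
            (\int[lebesgue_rV R n]_(x in Q)
               \int[@lebesgue_measure R]_(t in `]0%R, l])
                 (normc (kernel_op U t Q3 b x) ^+ 2 / t)%:E
              <= C%:E * lebesgue_rV R n Q)%E]) :
  exists mu : {measure set ('rV[R]_n * R) -> \bar R},
    has_density_dxdt_over_t mu
      (fun x t => normc (kernel_op U t setT (fun=> 1) x) ^+ 2) /\
    carleson_measure mu.
Proof.
pose u := part U (@complex.Re R); pose v := part U (@complex.Im R).
have mu_ := Re_part_measurable U_measurable.
have mv_ := Im_part_measurable U_measurable.
have ku := Re_part_kernel U_measurable U_support U_size U_differentiable
  U_gradient.
have kv := Im_part_kernel U_measurable U_support U_size U_differentiable
  U_gradient.
(* The stopping argument divides by the constant, so [C] is enlarged to a positive one; the bounds
   on the test functions persist. *)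
pose C0 := Num.max C 1.
have C0_gt0 : 0 < C0 by rewrite lt_max ltr01 orbT.
have CC0 (l : R) : 0 < l -> C * l ^+ n <= C0 * l ^+ n.
  by move=> l0; rewrite ler_pM2r ?exprn_gt0// le_max lexx.
have energy := cube_energy_le mu_ mv_ ku kv C0_gt0.
have {}energy : forall (c : 'rV[R]_n) (l : R), 0 < l ->
  (\int[lebesgue_rV R n]_(x in cube c l)
    \int[@lebesgue_measure R]_(t in `]0%R, l]) (symbol_sqr u v x t / t)%:E
    <= (carleson_const n C0 * l ^+ n)%:E)%E.
  apply: energy => c l l0.
  have := b_exists c l l0; cbv zeta; rewrite lebesgue_cube ?ltW// -EFinM.
  move=> [b [mb b2 bint Ub]].
  exists (re_patch b c l), (im_patch b c l); split.
  - exact: L2fun_re_patch mb b2.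
  - exact: L2fun_im_patch mb b2.
  - exact: le_trans (patch_L2_le mb b2) (CC0 _ l0).
  - rewrite -integral_patch// ler_sqr ?nnegrE ?normc_nonneg//.
    by rewrite exprn_ge0// ltW.
  - apply: (@le_trans _ _ (C * l ^+ n)%:E); last first.
      by rewrite lee_fin; exact: CC0.
    apply: le_trans Ub; rewrite le_eqVlt; apply/orP; left; apply/eqP.
    apply: eq_integral => x _; apply: eq_integral => t.
    rewrite inE/= in_itv/= => /andP[t0 _].
    rewrite (kernel_op_restrict U_measurable U_support U_size
      U_differentiable U_gradient x t0)//.
    + exact: measurable_cube.
    + exact: L2fun_re_patch mb b2.
    + exact: L2fun_im_patch mb b2.
pose D := @upper_half_space R n.
have mD : measurable D.
  rewrite (_ : D = [set: 'rV[R]_n * R] `&` snd @^-1` `]0, +oo[%classic).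
    exact: measurable_snd.
  by apply/seteqP; split => z /=; rewrite in_itv/= andbT => // -[].
pose g (z : 'rV[R]_n * R) : \bar R := (symbol_sqr u v z.1 z.2 / z.2)%:E.
have mg : measurable_fun setT g := measurable_symbol_sqr mu_ mv_.
have g0 z : D z -> (0 <= g z)%E.
  by move=> z0; rewrite lee_fin divr_ge0 ?symbol_sqr_ge0// ltW.
have [mu muE] : exists mu : {measure set ('rV[R]_n * R) -> \bar R}, forall A,
    mu A = (\int[lebesgue_rV R n \x @lebesgue_measure R]_(z in A `&` D) g z)%E.
  have [nu nuE] := density_measure (lebesgue_rV R n \x @lebesgue_measure R)%E
    mD (measurable_funS measurableT (@subsetT _ D) mg) g0.
  by have [mu muE] := measure_unalias nu; exists mu => A; rewrite muE nuE.
have boxD c l : carleson_box c l `<=` D.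
  by move=> [x t] [_ /=]; rewrite in_itv/= => /andP[].
have mu_box (c : 'rV[R]_n) (l : R) : 0 < l ->
    (mu (carleson_box c l) <= (carleson_const n C0 * l ^+ n)%:E)%E.
  move=> l0; rewrite muE setIidl//; apply: le_trans (energy c l l0).
  rewrite /carleson_box integral_setX_ge0//.
  - exact: measurable_cube.
  - by move=> z /boxD; exact: g0.
exists mu; split.
  move=> A mA; rewrite muE; apply: eq_integral => -[x t].
  by rewrite inE => -[_ /= t0]; rewrite kernel_op_one.
split.
- by rewrite muE setICl integral_set0.
- by apply: half_space_regular => c l l0; exact: le_lt_trans (mu_box c l l0) (ltry _).
- apply: le_lt_trans (ltry (carleson_const n C0)).
  apply: ge_ereal_sup => _ [c [l [l0 ->]]].
  have -> : fine (lebesgue_rV R n (cube c l)) = l ^+ n.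
    by rewrite lebesgue_cube ?ltW.
  rewrite lee_pdivrMr ?exprn_gt0//.
  by rewrite -EFinM; exact: mu_box.
Qed.
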